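(* Let $0 < q \leq 2$. (a) If a compact set $K \subset \mathbb{R}^2$ has the same Newtonian capacity as a closed disk $B \subset \mathbb{R}^2$ centered at the origin, $\mathrm{Cap}_1(K)=\mathrm{Cap}_1(B)>0$, then $$\int_K |x|^q \, d\mu \geq \int_B |x|^q \, d\nu$$ where $\mu$ and $\nu$ are the Newtonian equilibrium measures ($1$-equilibrium measures) of $K$ and $B$ regarded as sets in $\mathbb{R}^3$. (b) If a compact set $K \subset \mathbb{R}$ has the same logarithmic capacity as a closed interval $I \subset \mathbb{R}$ centered at the origin, $\mathrm{Cap}_0(K)=\mathrm{Cap}_0(I)>0$, then $$\int_K |x|^q \, d\mu \geq \int_I |x|^q \, d\nu$$ where $\mu$ and $\nu$ are the logarithmic equilibrium measures of $K$ and $I$ regarded as sets in $\mathbb{R}^2$.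
   Context: For a compact set $K$ in Euclidean space, the logarithmic energy is $V_{log}(K)=\inf_\mu \int_K\int_K \log\frac{1}{|x-y|}\,d\mu(x)d\mu(y)$ and, for $p>0$, the Riesz $p$-energy is $V_p(K)=\inf_\mu \int_K\int_K \frac{1}{|x-y|^p}\,d\mu(x)d\mu(y)$, where the infimum is over all Borel probability measures $\mu$ on $K$ (the energy of the empty set is $+\infty$). The infimum is attained, and when the energy is finite the minimizing measure is unique; it is called the logarithmic equilibrium measure, respectively the $p$-equilibrium measure, of $K$. The capacity is $\mathrm{Cap}_p(K)=V_p(K)^{-1/p}$ for $p>0$ and $\mathrm{Cap}_0(K)=\exp(-V_{log}(K))$ for $p=0$ (logarithmic capacity); it is positive if and only if the corresponding energy is finite. Newtonian energy and capacity in $\mathbb{R}^3$ correspond to $p=1$. *)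

(* Defs.v *)
From mathcomp Require Import all_boot all_order all_algebra.
From mathcomp Require Import all_classical all_reals all_analysis.
Import Order.TTheory GRing.Theory Num.Theory.
Import numFieldNormedType.Exports.

Set Implicit Arguments.
Unset Strict Implicit.
Unset Printing Implicit Defensive.

Local Open Scope classical_set_scope.
Local Open Scope ring_scope.

(* The library norm `|x| on row vectors is the sup norm; it induces the same
   topology (hence the same compact and Borel sets) as the Euclidean norm. *)
Definition enorm (R : realType) (n : nat) (x : 'rV[R]_n) : R :=
  Num.sqrt (\sum_(i < n) x 0 i ^+ 2).

(* R^n with its Borel sigma-algebra; the carrier is 'rV[R]_n itself. *)
Notation borelRn R n := (g_sigma_algebraType (@open 'rV[R]_n)).

(* log(1/|x-y|) for p = 0 and 1/|x-y|^p otherwise. Inverse and logarithm are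
   the extended-real ones (0^-1 = +oo, lne +oo = +oo), so the kernel is +oo on
   the diagonal. *)
Definition riesz_kernel (R : realType) (n : nat) (p : R) (x y : 'rV[R]_n) : \bar R :=
  if p == 0 then lne ((enorm (x - y))%:E^-1)%E
  else (((enorm (x - y)) `^ p)%:E^-1)%E.

(* A Borel probability measure on K is encoded as a probability measure on R^n
   giving full mass to K. *)
Definition carried_by (R : realType) (n : nat) (K : set 'rV[R]_n)
    (mu : probability (borelRn R n) R) : Prop :=
  mu K = 1%E.

Definition energy_of (R : realType) (n : nat) (p : R) (K : set 'rV[R]_n)
    (mu : probability (borelRn R n) R) : \bar R :=
  (\int[mu]_(y in K) \int[mu]_(x in K) riesz_kernel p x y)%E.

Definition energy (R : realType) (n : nat) (p : R) (K : set 'rV[R]_n) : \bar R :=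
  ereal_inf [set energy_of p K mu | mu in carried_by K].

(* V^(-1/p) is written (V^-1)^(1/p): the library sets poweR +oo r = +oo even
   for r < 0, whereas the capacity of a set of infinite energy is 0. *)
Definition Cap (R : realType) (n : nat) (p : R) (K : set 'rV[R]_n) : \bar R :=
  if p == 0 then expeR (- energy p K)%E
  else poweR ((energy p K)^-1)%E p^-1.

Definition is_equilibrium (R : realType) (n : nat) (p : R) (K : set 'rV[R]_n)
    (mu : probability (borelRn R n) R) : Prop :=
  carried_by K mu /\ energy_of p K mu = energy p K.

Definition disk (R : realType) (r : R) : set 'rV[R]_2 :=
  [set x | enorm x <= r].

Definition plane_to_space (R : realType) (x : 'rV[R]_2) : 'rV[R]_3 :=
  row_mx x (0 : 'rV[R]_1).

Definition line_to_plane (R : realType) (x : R) : 'rV[R]_2 :=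
  row_mx (const_mx x : 'rV[R]_1) (0 : 'rV[R]_1).

(* Main.v *)
From HB Require Import structures.
Require Import Defs.
From mathcomp Require Import all_boot all_order all_algebra.
From mathcomp Require Import all_classical all_reals all_analysis.
From mathcomp Require Import measurable_realfun ring lra.
Import Order.TTheory GRing.Theory Num.Theory.
Import numFieldNormedType.Exports.
Set Implicit Arguments.
Unset Strict Implicit.
Unset Printing Implicit Defensive.
Local Open Scope classical_set_scope.
Local Open Scope ring_scope.

(** Write [E] for the embedded compact set, [B] for the embedded disc or
    interval of radius [r], [k] for the Newtonian or logarithmic kernel,
    [I(m1, m2)] for the mutual energy of two measures and [V] for the common
    energy of the two equilibrium measures [mu] and [nu] (equal capacities
    mean equal energies).

    For every radius [0 < s <= r] there is a positive measure [tau_s] carried by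
    the concentric disc or interval of radius [s], hence by [B], whose potential
    is constant there: a multiple of its equilibrium measure.  Outside, the
    potential falls short of that constant by [a * G(|x| / s)], where [a > 0]
    depends on [s] only and [G >= 0] vanishes for arguments at most [1].  Comparing the
    integrals of [G(|x| / s)] against [mu] and [nu] is therefore the same as
    comparing [I(mu, tau_s)] and [I(nu, tau_s)], in the opposite order:
    - [I(nu, tau_s) >= V * tau_s(1)], because [nu] minimises the energy on [B]
      and [tau_s] lives on [B] (first variation, [variational]);
    - [I(mu, tau_s) <= V * tau_s(1)], because the potential of [mu] is at most
      [V] everywhere (Frostman's theorem together with the maximum principle,
      [equilibrium_potential_le]).
    So the integral of [G(|x| / s)] is smaller for [nu] than for [mu]; for
    [s > r] it is even zero for [nu].  Since the integral over [s > 0] of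
    [s^(q-1) G(t / s)] is a positive multiple of [t^q], mixing the scales
    gives the inequality between the moments ([moment_le]).  This part is
    [moment_comparison]; it is common to the two kernels, which enter through
    the properties collected in [admissible].

    The maximum principle is obtained without differentiating potentials: both
    kernels satisfy, up to a fourth-order error, the mean value inequality for
    the neighbours of a point along the coordinate axes, and a nearly maximal
    point of a bounded function with this property yields a contradiction
    ([discrete_max_principle]).

    The measures [tau_s] are explicit.  For the interval, [tau_s] is the
    projection of the uniform measure of a circle of radius [s]; writing a
    difference of cosines as a product of sines splits the kernel into two
    translates of one periodic function, so the potential is constant
    ([arcsine_pot_inside]).  For the disc, [tau_s] has the density
    [1 / sqrt(1 - |w|^2)] rescaled to radius [s]; along the lines through a
    point [x] the kernel cancels the Jacobian, and the integral of the density
    over a chord of slope [m] is a constant times [1 / sqrt(1 + m^2)], whichever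
    chord it is, so the potential only records which lines through [x] meet the
    disc ([disc_potE]). *)

(** * Perturbing a measure of minimal energy *)

Lemma prob_of_measure d (T : measurableType d) (R : realType)
    (m : {measure set T -> \bar R}) :
  m setT = 1%E -> exists P : probability T R,
  (forall A, P A = m A) /\
  forall D (f : T -> \bar R), (\int[P]_(x in D) f x = \int[m]_(x in D) f x)%E.
Proof.
move=> m1.
pose w (A : set T) := m A.
pose M := isMeasure.Build _ _ _ w (measure0 m) (measure_ge0 m)
  (@measure_semi_sigma_additive _ _ _ m).
pose m' : {measure set T -> \bar R} := HB.pack w M.
pose Pm := @Measure_isProbability.Build _ _ R m' m1.
pose P : probability T R := HB.pack w M Pm.
by exists P.
Qed.

Lemma finite_of_measure d (T : measurableType d) (R : realType)
    (m : {measure set T -> \bar R}) :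
  (m setT < +oo)%E -> exists P : {finite_measure set T -> \bar R},
  (forall A, P A = m A) /\
  forall D (f : T -> \bar R), (\int[P]_(x in D) f x = \int[m]_(x in D) f x)%E.
Proof.
move=> m1.
pose w (A : set T) := m A.
pose M := isMeasure.Build _ _ _ w (measure0 m) (measure_ge0 m)
  (@measure_semi_sigma_additive _ _ _ m).
pose m' : {measure set T -> \bar R} := HB.pack w M.
have m1' : fin_num_fun w by apply: (lty_fin_num_fun (mu := m')).
pose Pm := @Measure_isFinite.Build _ _ R m' m1'.
pose P : {finite_measure set T -> \bar R} := HB.pack w M Pm.
by exists P.
Qed.

Section density.
Context d (T : measurableType d) (R : realType).
Variables (mu : {measure set T -> \bar R}) (h : T -> R).
Hypotheses (mh : measurable_fun setT h) (h0 : forall x, 0 <= h x).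

Import HBNNSimple.
Local Open Scope ereal_scope.

(** Integration against a density is checked on simple functions and extended
    by monotone convergence. *)
Lemma exists_density : exists m : {measure set T -> \bar R},
  (forall A, measurable A -> m A = \int[mu]_(x in A) (h x)%:E) /\
  forall f : T -> \bar R, measurable_fun setT f -> (forall x, 0 <= f x) ->
    \int[m]_x f x = \int[mu]_x (f x * (h x)%:E).
Proof.
pose w (A : set T) := \int[mu]_(x in A) (h x)%:E.
have meh : measurable_fun setT (EFin \o h) by exact/measurable_EFinP.
have eh0 x : 0 <= (h x)%:E by rewrite lee_fin.
have w0 : w set0 = 0 by rewrite /w integral_set0.
have wge A : 0 <= w A by exact: integral_ge0.
have wadd : semi_sigma_additive w.
  move=> A mA tA mUA; rewrite /w ge0_integral_bigcup//; last first.
    exact: measurable_funTS.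
  by apply: is_cvg_ereal_nneg_natsum_cond => n _ _; exact: integral_ge0.
pose M := isMeasure.Build _ _ _ w w0 wge wadd.
pose m : {measure set T -> \bar R} := HB.pack w M.
exists m; split => // f mf f0.
pose g := nnsfun_approx measurableT mf.
have nd x : {homo (fun n => (g n x)%:E) : p q / (p <= q)%N >-> p <= q}.
  by move=> p q pq; rewrite lee_fin; exact/lefP/nd_nnsfun_approx.
have gf x : (fun n => (g n x)%:E) @ \oo --> f x.
  by apply: cvg_nnsfun_approx.
transitivity (limn (fun n => \int[m]_x (g n x)%:E)).
  rewrite -monotone_convergence//.
  - by apply: eq_integral => y _; apply/esym/cvg_lim => //.
  - by move=> n; exact/measurable_EFinP/measurable_funP.
  - by move=> n y _; rewrite lee_fin.
rewrite [X in limn X](_ : _ = (fun n => \int[mu]_x ((g n x)%:E * (h x)%:E))).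
  rewrite -monotone_convergence//; last 3 first.
  - move=> n; apply: emeasurable_funM => //.
    exact/measurable_EFinP/measurable_funP.
  - by move=> n x _; rewrite mule_ge0// lee_fin.
  - by move=> x _ p q pq; rewrite lee_wpmul2r//; exact: nd.
  apply: eq_integral => x _; apply/cvg_lim => //.
  by apply: cvgeZr => //; exact: gf.
apply/funext => n.
transitivity (\int[m]_x (\sum_(y \in range (g n)) (y * \1_(g n @^-1` [set y]) x)%:E)).
  by apply: eq_integral => t tE; rewrite /= fimfunE -fsumEFin.
rewrite ge0_integral_fsum//; last 2 first.
- by move=> y; apply/measurable_EFinP/measurable_funM.
- by move=> y x _; rewrite nnfun_muleindic_ge0.
transitivity (\int[mu]_x
   (\sum_(y \in range (g n)) (y * \1_(g n @^-1` [set y]) x)%:E * (h x)%:E)); last first.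
  apply: eq_integral => t tE; rewrite -ge0_mule_fsuml.
    by rewrite /= fimfunE -fsumEFin.
  by move=> y; rewrite nnfun_muleindic_ge0.
rewrite ge0_integral_fsum//; last 2 first.
- move=> y; apply: emeasurable_funM => //.
  by apply/measurable_EFinP/measurable_funM.
- by move=> y x _; rewrite mule_ge0// nnfun_muleindic_ge0.
apply: eq_fsbigr => r rhn.
rewrite integralZl_indic_nnsfun// integral_indic// setIT.
have r0 : (0 <= r)%R by move: rhn; rewrite inE => -[t _ <-].
under eq_integral do rewrite EFinM -muleA.
rewrite ge0_integralZl_EFin//.
- congr (_ * _); rewrite /m/= /w integral_mkcond; apply: eq_integral => x _.
  by rewrite epatch_indic muleC.
- by move=> x _; rewrite mule_ge0// lee_fin.
- by apply: emeasurable_funM => //; apply/measurable_EFinP.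
Qed.
End density.

(** First variation at [t = 0]: for the [t] chosen in the proof the second-order
    term is smaller than the first-order one. *)
Lemma quadratic_perturbation (R : realFieldType) (v a b : R) :
  (forall t, 0 < t < 1 -> v <= (1 - t)^+2 * v + 2 * t * (1 - t) * a + t ^+ 2 * b) ->
  v <= a.
Proof.
move=> key; rewrite leNgt; apply/negP => av.
have n0 := normr_ge0 (v - 2 * a + b); have n1 := ler_norm (v - 2 * a + b).
(* [c] is larger than both the second-order coefficient and [v - a]. *)
pose c := `|v - 2 * a + b| + 2 * (v - a) + 1.
have c0 : 0 < c by rewrite /c; lra.
pose t := (v - a) / c.
have t0 : 0 < t by rewrite divr_gt0//; lra.
have t1 : t < 1 by rewrite ltr_pdivrMr// mul1r /c; lra.
have := key t; rewrite t0 t1 => /(_ isT) H.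
have tc : t * c = v - a by rewrite /t divfK// gt_eqF.
have : t * (2 * (v - a)) <= t * (t * (v - 2 * a + b)) by lra.
rewrite ler_pM2l// => H1.
have H2 : t * (v - 2 * a + b) <= t * c by rewrite ler_pM2l// /c; lra.
lra.
Qed.

Lemma exists_restriction d (T : measurableType d) (R : realType)
    (mu : {finite_measure set T -> \bar R}) (A : set T) :
  measurable A -> exists tau : {finite_measure set T -> \bar R},
  (forall C, measurable C -> tau C = mu (C `&` A)) /\
  forall f : T -> \bar R, measurable_fun setT f -> (forall x, (0 <= f x)%E) ->
    (\int[tau]_x f x = \int[mu]_(x in A) f x)%E.
Proof.
move=> mA.
have m1A : measurable_fun setT (\1_A : T -> R) by exact: measurable_indic.
have i0 x : 0 <= (\1_A x : R) by rewrite indicE.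
have [m [mE mint]] := exists_density mu m1A i0.
have mC C : measurable C -> m C = mu (C `&` A).
  by move=> mC; rewrite mE// integral_indic// setIC.
have mT : (m setT < +oo)%E.
  by rewrite mC// setTI ltey_eq fin_num_measure.
have [tau [tauE tauint]] := finite_of_measure mT.
exists tau; split => [C mC'|f mf f0]; first by rewrite tauE mC.
rewrite tauint mint// [RHS]integral_mkcond.
by apply: eq_integral => x _; rewrite epatch_indic.
Qed.

Section variational.
Context d (T : measurableType d) (R : realType).
Variable (k : T * T -> \bar R).
Hypotheses (mk : measurable_fun setT k) (k0 : forall z, (0 <= k z)%E).
Hypothesis ksym : forall x y, k (x, y) = k (y, x).
Local Open Scope ereal_scope.

Definition pot (m : {measure set T -> \bar R}) x := \int[m]_y k (x, y).
Definition mutual (m1 m2 : {measure set T -> \bar R}) := \int[m1]_x pot m2 x.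

Lemma kernel_section x : measurable_fun setT (fun y => k (x, y)).
Proof. by apply: measurableT_comp => //. Qed.

Lemma pot_ge0 m x : 0 <= pot m x.
Proof. exact: integral_ge0. Qed.

Lemma mutual_ge0 m1 m2 : 0 <= mutual m1 m2.
Proof. by apply: integral_ge0 => x _; exact: pot_ge0. Qed.

Lemma measurable_pot (m : {finite_measure set T -> \bar R}) :
  measurable_fun setT (pot m).
Proof. exact: measurable_fun_fubini_tonelli_F. Qed.

Lemma mutualC (m1 m2 : {finite_measure set T -> \bar R}) :
  mutual m1 m2 = mutual m2 m1.
Proof.
rewrite /mutual /pot fubini_tonelli//; apply: eq_integral => x _.
by apply: eq_integral => y _; rewrite ksym.
Qed.

(** Replacing [mu] by the mixture [(1 - t) mu + t tau / tau(1)] cannot decrease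
    the energy; the term of order [t] gives the inequality. *)
Lemma variational (mu : probability T R) (tau : {finite_measure set T -> \bar R})
    (K : set T) (mK : measurable K) :
  mu K = 1 -> tau (~` K) = 0 ->
  (forall P : probability T R, P K = 1 -> mutual mu mu <= mutual P P) ->
  mutual mu mu < +oo -> mutual tau tau < +oo ->
  mutual mu mu * tau setT <= mutual mu tau.
Proof.
move=> muK tauK minmu muoo tauoo.
have [->|tau0] := eqVneq (tau setT) 0; first by rewrite mule0 mutual_ge0.
have tfin : tau setT \is a fin_num by exact: fin_num_measure.
set M := fine (tau setT).
have M0 : (0 < M)%R by rewrite fine_gt0// lt0e tau0 measure_ge0/= ltey_eq tfin.
have [->|Joo] := eqVneq (mutual mu tau) +oo; first by rewrite leey.
have Vf : mutual mu mu \is a fin_num by rewrite ge0_fin_numE// mutual_ge0.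
have tf : mutual tau tau \is a fin_num by rewrite ge0_fin_numE// mutual_ge0.
have Jf : mutual mu tau \is a fin_num by rewrite ge0_fin_numE ?mutual_ge0// ltey.
set v := fine (mutual mu mu); set b := fine (mutual tau tau).
set a := fine (mutual mu tau).
suff key t : (0 < t < 1)%R ->
    (v <= (1 - t)^+2 * v + 2 * t * (1 - t) * (a / M) + t ^+ 2 * (b / M ^+ 2))%R.
  rewrite -(fineK Vf) -(fineK tfin) -(fineK Jf) -/M -/v -/a -EFinM lee_fin.
  rewrite -ler_pdivlMr//; set a' := (a / M)%R in key *; set b' := (_ / _ ^+ 2)%R in key.
  exact: (quadratic_perturbation key).
move=> /andP[t0 t1].
have c1 : (0 <= 1 - t)%R by lra.
have c2 : (0 <= t / M)%R by rewrite divr_ge0// ltW.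
pose m1 := [the measure _ _ of mscale (NngNum c1) mu].
pose m2 := [the measure _ _ of mscale (NngNum c2) tau].
pose m := [the measure _ _ of measure_add m1 m2].
have mE A : m A = (1 - t)%:E * mu A + (t / M)%:E * tau A.
  by rewrite [LHS]measure_addE.
have mT : m setT = 1.
  rewrite mE probability_setT mule1 -(fineK tfin) -/M -EFinM -EFinD.
  by congr EFin; field; rewrite gt_eqF.
have [P [PE Pint]] := prob_of_measure mT.
have PK : P K = 1.
  have tK : tau K = tau setT.
    rewrite -(setUv K) measureU//; last by rewrite setICr.
      by rewrite [X in (_ + X)%R]tauK addr0.
    exact: measurableC.
  by rewrite PE mE muK tK; move: mT; rewrite mE probability_setT.
have mint f : measurable_fun setT f -> (forall x, 0 <= f x) ->
    \int[P]_x f x = (1 - t)%:E * \int[mu]_x f x + (t / M)%:E * \int[tau]_x f x.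
  move=> mf f0; rewrite Pint ge0_integral_measure_add//.
  by rewrite !ge0_integral_mscale.
have potP x : pot P x = (1 - t)%:E * pot mu x + (t / M)%:E * pot tau x.
  by rewrite /pot mint//; exact: kernel_section.
have mp m' : measurable_fun setT (pot m') -> forall c : R, measurable_fun setT (fun x => c%:E * pot m' x).
  by move=> mp' c; exact: measurable_funeM.
have := minmu P PK; rewrite -(fineK Vf) -/v.
have -> : mutual P P = ((1 - t) ^+ 2 * v + 2 * t * (1 - t) * (a / M) + t ^+ 2 * (b / M ^+ 2))%:E.
  have intP (m' : {measure set T -> \bar R}) : \int[m']_x pot P x =
     (1 - t)%:E * mutual m' mu + (t / M)%:E * mutual m' tau.
    under eq_integral do rewrite potP.
    rewrite ge0_integralD//=.
    - rewrite !ge0_integralZl_EFin//; try exact: measurable_pot; by move=> *; exact: pot_ge0.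
    - by move=> x _; rewrite mule_ge0// ?lee_fin// pot_ge0.
    - by apply: mp; exact: measurable_pot.
    - by move=> x _; rewrite mule_ge0// ?lee_fin// pot_ge0.
    - by apply: mp; exact: measurable_pot.
  rewrite {1}/mutual mint//; [|exact: measurable_pot|exact: pot_ge0].
  rewrite !intP (mutualC tau mu) -(fineK Vf) -(fineK tf) -(fineK Jf) -/v -/a -/b.
  rewrite -!(EFinM, EFinD); congr EFin; field; by rewrite gt_eqF.
by rewrite lee_fin.
Qed.

(** On the complement of the exceptional set the potential of [mu] has mean at
    least [V], by [variational] applied to the restriction of [mu]; on the
    exceptional set it exceeds [V].  As the overall mean is [V], the
    exceptional set is null. *)
Lemma frostman (mu : probability T R) (K : set T) (mK : measurable K) (eta : R) :
  mu K = 1 ->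
  (forall P : probability T R, P K = 1 -> mutual mu mu <= mutual P P) ->
  mutual mu mu < +oo -> (0 < eta)%R ->
  mu [set x | mutual mu mu + eta%:E <= pot mu x] = 0.
Proof.
move=> muK minmu muoo eta0.
set V := mutual mu mu; set A := [set x | _].
have mp := measurable_pot mu.
have mA : measurable A.
  by rewrite -[A]setTI; exact: emeasurable_fun_c_infty.
have mB : measurable (~` A) by exact: measurableC.
have Vf : V \is a fin_num by rewrite ge0_fin_numE// mutual_ge0.
have [tau [tauE tauint']] := exists_restriction mu mB.
have tauV : V * mu (~` A) <= \int[mu]_(x in ~` A) pot mu x.
  rewrite -(tauint' _ mp (pot_ge0 mu)) -[leRHS]/(mutual tau mu) mutualC.
  have -> : mu (~` A) = tau setT by rewrite tauE// setTI.
  apply: (variational mK) => //.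
    rewrite (tauE _ (measurableC mK)); apply: le_anti; rewrite measure_ge0 andbT.
    have <- : mu (~` K) = 0 by rewrite probability_setC// muK subee.
    have mKc : measurable (~` K) by exact: measurableC.
    by apply: le_measure; rewrite ?inE//; first exact: measurableI.
  apply: le_lt_trans muoo; rewrite {1}/mutual tauint'; [|exact: measurable_pot|exact: pot_ge0].
  apply: (@le_trans _ _ (\int[mu]_x pot tau x)).
    by apply: ge0_subset_integral => //; [exact: measurable_pot|move=> x _; exact: pot_ge0].
  apply: ge0_le_integral => //; [by move=> x _; exact: pot_ge0|exact: measurable_pot|].
  move=> x _; rewrite /pot tauint'//; last exact: kernel_section.
  by apply: ge0_subset_integral => //; exact: kernel_section.
have VA : (V + eta%:E) * mu A <= \int[mu]_(x in A) pot mu x.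
  rewrite -integral_cst//; apply: ge0_le_integral => //.
  - by move=> x _; rewrite adde_ge0 ?mutual_ge0// lee_fin ltW.
  - exact: measurable_funTS.
have VE : V = \int[mu]_(x in A) pot mu x + \int[mu]_(x in ~` A) pot mu x.
  rewrite -ge0_integral_setU ?setUv//; first by move=> x _; exact: pot_ge0.
  by apply/disj_set2P; rewrite setICr.
have AB : mu (~` A) = 1 - mu A by exact: probability_setC.
have mAf : mu A \is a fin_num by exact: fin_num_measure.
move: (leeD VA tauV); rewrite -VE AB -(fineK Vf) -(fineK mAf) => H.
have : ((fine V + eta) * fine (mu A) + fine V * (1 - fine (mu A)) <= fine V)%R.
  by rewrite -lee_fin.
move=> H'; have : (eta * fine (mu A) <= 0)%R by lra.
rewrite pmulr_rle0// => mA0; congr EFin; apply/eqP; rewrite eq_le mA0/=.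
exact: fine_ge0.
Qed.

End variational.

(** * Euclidean norm and a discrete maximum principle *)

Lemma measurable_sqrtr (R : realType) : measurable_fun setT (@Num.sqrt R).
Proof. by apply: continuous_measurable_fun; exact: sqrt_continuous. Qed.

Section enorm_theory.
Context (R : realType) (n : nat).
Implicit Types x y z : 'rV[R]_n.

Lemma enorm_ge0 x : 0 <= enorm x.
Proof. exact: sqrtr_ge0. Qed.

Lemma enorm_sqr x : enorm x ^+ 2 = \sum_(i < n) x 0 i ^+ 2.
Proof. by rewrite sqr_sqrtr// sumr_ge0// => i _; rewrite sqr_ge0. Qed.

Lemma coord_le_enorm x i : `|x 0 i| <= enorm x.
Proof.
rewrite -sqrtr_sqr ler_wsqrtr// (bigD1 i)//= lerDl sumr_ge0// => j _.
exact: sqr_ge0.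
Qed.

Lemma enorm_eq0 x : (enorm x == 0) = (x == 0).
Proof.
apply/eqP/eqP => [x0|->]; last first.
  rewrite /enorm big1 ?sqrtr0// => i _; by rewrite mxE expr0n.
apply/rowP => i; rewrite mxE; apply/eqP; rewrite -normr_le0 -x0.
exact: coord_le_enorm.
Qed.

Lemma enormN x : enorm (- x) = enorm x.
Proof. by congr Num.sqrt; apply: eq_bigr => i _; rewrite mxE sqrrN. Qed.

Lemma enormZ a x : enorm (a *: x) = `|a| * enorm x.
Proof.
rewrite /enorm -(sqrtr_sqr a) -sqrtrM ?sqr_ge0// mulr_sumr.
by congr Num.sqrt; apply: eq_bigr => i _; rewrite mxE exprMn.
Qed.

Lemma enormB x y : enorm (x - y) = enorm (y - x).
Proof. by rewrite -enormN opprB. Qed.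

Lemma cauchy_schwarz x y : \sum_(i < n) x 0 i * y 0 i <= enorm x * enorm y.
Proof.
have [->|x0] := eqVneq x 0.
  rewrite (_ : enorm 0 = 0) ?mul0r; last by apply/eqP; rewrite enorm_eq0.
  by rewrite big1// => i _; rewrite mxE mul0r.
have [->|y0] := eqVneq y 0.
  rewrite (_ : enorm 0 = 0) ?mulr0; last by apply/eqP; rewrite enorm_eq0.
  by rewrite big1// => i _; rewrite mxE mulr0.
have a0 : 0 < enorm x by rewrite lt_neqAle eq_sym enorm_eq0 x0 enorm_ge0.
have b0 : 0 < enorm y by rewrite lt_neqAle eq_sym enorm_eq0 y0 enorm_ge0.
have : \sum_(i < n) 2 * (x 0 i * y 0 i) <= \sum_(i < n)
    (enorm y / enorm x * x 0 i ^+ 2 + enorm x / enorm y * y 0 i ^+ 2).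
  apply: ler_sum => i _; rewrite -subr_ge0.
  have -> : enorm y / enorm x * x 0 i ^+ 2 + enorm x / enorm y * y 0 i ^+ 2
     - 2 * (x 0 i * y 0 i) = (enorm y * x 0 i - enorm x * y 0 i)^+2 / (enorm x * enorm y).
    by field; rewrite !gt_eqF.
  by rewrite divr_ge0 ?sqr_ge0// mulr_ge0// ltW.
rewrite big_split/= -!mulr_sumr -!enorm_sqr.
have -> : enorm y / enorm x * enorm x ^+ 2 + enorm x / enorm y * enorm y ^+ 2
  = 2 * (enorm x * enorm y) by field; rewrite !gt_eqF.
by rewrite ler_pM2l.
Qed.

Lemma enormD x y : enorm (x + y) <= enorm x + enorm y.
Proof.
rewrite -(ler_pXn2r (n := 2))// ?nnegrE ?addr_ge0 ?enorm_ge0//.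
rewrite enorm_sqr sqrrD !enorm_sqr.
have -> : \sum_(i < n) (x + y) 0 i ^+ 2 = \sum_(i < n) x 0 i ^+ 2
   + (\sum_(i < n) x 0 i * y 0 i) *+ 2 + \sum_(i < n) y 0 i ^+ 2.
  rewrite -mulr_natl mulr_sumr -!big_split/=; apply: eq_bigr => i _.
  by rewrite mxE; ring.
by rewrite lerD2r lerD2l lerMn2r/= cauchy_schwarz.
Qed.

Lemma enorm_dist x y : enorm x <= enorm y + enorm (x - y).
Proof. by rewrite -{1}(subrK y x) addrC enormD. Qed.

Lemma enorm_distE x y : `|enorm x - enorm y| <= enorm (x - y).
Proof.
rewrite ler_norml; have := enorm_dist x y; have := enorm_dist y x.
by rewrite (enormB y x); lra.
Qed.

Lemma enorm_sqr_shift x (i : 'I_n) (r : R) :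
  enorm (x + r *: delta_mx 0 i) ^+ 2 = enorm x ^+ 2 + 2 * r * x 0 i + r ^+ 2.
Proof.
rewrite !enorm_sqr (bigD1 i)//= [in RHS](bigD1 i)//= !mxE !eqxx/= mulr1.
rewrite (_ : \sum_(j < n | _) (x + r *: delta_mx 0 i) 0 j ^+ 2 =
  \sum_(j < n | j != i) x 0 j ^+ 2); first by ring.
by apply: eq_bigr => j /negPf ji; rewrite !mxE ji/= mulr0 addr0.
Qed.

Lemma enorm_delta (i : 'I_n) : enorm (delta_mx 0 i : 'rV[R]_n) = 1.
Proof.
rewrite /enorm (bigD1 i)//= big1 ?addr0; first by rewrite mxE !eqxx expr1n sqrtr1.
by move=> j /negPf ji; rewrite mxE ji/= expr0n.
Qed.

Lemma measurable_coord (i : 'I_n) :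
  measurable_fun setT (fun x : borelRn R n => (x : 'rV[R]_n) 0 i).
Proof.
apply: (measurability _ (RGenOpens.measurableE R)) => _ [_ [a [b ->]] <-].
rewrite setTI; apply: sub_sigma_algebra.
have := @interval_open R (BRight a) (BLeft b) isT isT.
move/continuousP : (@coord_continuous R 1 n 0 i); exact.
Qed.

Lemma measurable_enormB :
  measurable_fun setT (fun z : borelRn R n * borelRn R n => enorm ((z.1 : 'rV[R]_n) - z.2)).
Proof.
apply: measurableT_comp; first exact: measurable_sqrtr.
apply: measurable_sum => i; apply: measurable_funX.
under eq_fun do rewrite !mxE.
apply: measurable_funB.
- exact: (measurableT_comp (measurable_coord i) measurable_fst).
- exact: (measurableT_comp (measurable_coord i) measurable_snd).
Qed.

Lemma measurable_enorm : measurable_fun setT (fun x : borelRn R n => enorm (x : 'rV[R]_n)).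
Proof.
rewrite /enorm; apply: measurableT_comp; first exact: measurable_sqrtr.
apply: measurable_sum => i; apply: measurable_funX.
exact: measurable_coord.
Qed.
End enorm_theory.

(** Adding [eps |x|^2] makes the mean inequality strict: at a nearly maximal
    point of [W + eps |x|^2] above level [v], the quadratic term contributes
    [eps rho^2] per direction, which beats the error [C rho^4] at a small
    scale [rho]. *)
Lemma discrete_max_principle (R : realType) (n : nat) (W : 'rV[R]_n -> R)
    (v M B : R) :
  (0 < n)%N -> (forall x, W x <= B) ->
  (forall x, v < W x -> enorm x < M) ->
  (exists C rho0 : R, [/\ 0 <= C, 0 < rho0 & forall x, v < W x ->
    forall rho, 0 < rho < rho0 ->
    2 * n%:R * W x <= \sum_(i < n)
       (W (x + rho *: delta_mx 0 i) + W (x - rho *: delta_mx 0 i)) + C * rho ^+ 4]) ->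
  forall x, W x <= v.
Proof.
move=> n0 WB WM [C [rho0 [C0 rho00 mv]]] xs; rewrite leNgt; apply/negP => vW.
pose delta := W xs - v; have delta0 : 0 < delta by rewrite subr_gt0.
have M0 : 0 < M by apply: le_lt_trans (WM _ vW); exact: enorm_ge0.
pose M1 := M + 1.
have M10 : 0 < M1 by rewrite addr_gt0.
pose eps := delta / (2 * M1 ^+ 2).
have eps0 : 0 < eps by rewrite divr_gt0// mulr_gt0// exprn_gt0.
have epsM : eps * M1 ^+ 2 = delta / 2 by rewrite /eps; field; rewrite gt_eqF.
pose D := [set W x + eps * enorm x ^+ 2 | x in [set x | enorm x <= M1]].
have xsM : enorm xs <= M1 by rewrite (le_trans (ltW (WM _ vW)))// lerDl.
have supD : has_sup D.
  split; first by exists (W xs + eps * enorm xs ^+ 2); exists xs.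
  exists (B + eps * M1 ^+ 2) => _ [x /= xM <-].
  rewrite lerD// ler_pM2l// ler_pXn2r// nnegrE ?enorm_ge0//; exact: ltW.
have leS x : enorm x <= M1 -> W x + eps * enorm x ^+ 2 <= sup D.
  by move=> xM; apply: ub_le_sup; [case: supD|exists x].
have nn0 : (0 : R) < n%:R by rewrite ltr0n.
(* The last bound on [rho] ensures [C rho^2 < n eps], the others that the
   neighbours stay in the ball of radius [M + 1] and in the range of the
   mean inequality. *)
pose rho := Num.min (Num.min (rho0 / 2) 1) (Num.sqrt (eps * n%:R / (C + 1))).
have q0 : 0 < eps * n%:R / (C + 1).
  have C1 : 0 < C + 1 by lra.
  by rewrite divr_gt0// mulr_gt0.
have r0 : 0 < rho by rewrite !lt_min divr_gt0//= ltr01/= sqrtr_gt0.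
have r1 : rho <= 1 by rewrite /rho !ge_min lexx orbT.
have rr : rho < rho0.
  apply: (@le_lt_trans _ _ (rho0 / 2)); last by lra.
  by rewrite /rho !ge_min lexx.
have rC : C * rho ^+ 2 < eps * n%:R.
  have : rho ^+ 2 <= eps * n%:R / (C + 1).
    rewrite -[leRHS]sqr_sqrtr; last exact: ltW.
    rewrite ler_pXn2r// ?nnegrE ?sqrtr_ge0 ?(ltW r0)//.
    by rewrite /rho ge_min lexx orbT.
  rewrite ler_pdivlMr; last by lra.
  have : 0 < rho ^+ 2 by rewrite exprn_gt0.
  set r2 := rho ^+ 2; set e := eps * _; nra.
have e1 : 0 < Num.min (eps * rho ^+ 2 / 2) (delta / 2).
  have r20 : 0 < rho ^+ 2 by rewrite exprn_gt0.
  have er0 := mulr_gt0 eps0 r20.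
  by rewrite lt_min; apply/andP; split; lra.
have [_ [x0 /= x0M <-]] := sup_adherent e1 supD.
rewrite ltrBlDr -ltrBlDl lt_min => /andP[S1 S2].
have Sxs := leS _ xsM.
have es0 : 0 <= eps * enorm xs ^+ 2 by rewrite mulr_ge0// ?sqr_ge0// ltW.
have ex0 : eps * enorm x0 ^+ 2 <= delta / 2.
  by rewrite -epsM ler_pM2l// ler_pXn2r// nnegrE ?enorm_ge0// ltW.
have vx0 : v < W x0 by rewrite /delta in S2 ex0 *; lra.
have x0M' := WM _ vx0.
have := mv _ vx0 rho; rewrite r0 rr => /(_ isT) mvx.
have nb (s : R) (i : 'I_n) : `|s| = rho -> enorm (x0 + s *: delta_mx 0 i) <= M1.
  move=> sr; apply: (le_trans (enormD _ _)); rewrite enormZ enorm_delta mulr1 sr.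
  by rewrite lerD// ltW.
have : \sum_(i < n) (W (x0 + rho *: delta_mx 0 i) + W (x0 - rho *: delta_mx 0 i)) <=
   \sum_(i < n) (2 * sup D - 2 * eps * (enorm x0 ^+ 2 + rho ^+ 2)).
  apply: ler_sum => i _.
  have := leS _ (nb rho i (gtr0_norm r0)).
  have := leS _ (nb (- rho) i (eq_trans (normrN _) (gtr0_norm r0))).
  rewrite !enorm_sqr_shift scaleNr; set a := W _; set b := W _; lra.
rewrite sumr_const card_ord -mulr_natl => Hs.
have H := le_trans mvx (lerD Hs (lexx (C * rho ^+ 4))).
have {H} : n%:R * (2 * (W x0 + eps * enorm x0 ^+2 - sup D + eps * rho ^+ 2)) <= C * rho ^+ 4 by lra.
apply/negP; rewrite -ltNge.
apply: (@lt_le_trans _ _ (n%:R * (eps * rho ^+ 2))); last first.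
  by rewrite ler_pM2l//; lra.
rewrite (_ : rho ^+ 4 = rho ^+ 2 * rho ^+ 2); last by rewrite -exprD.
rewrite [ltRHS](_ : _ = (eps * n%:R) * rho ^+ 2); last by ring.
by rewrite mulrA ltr_pM2r// exprn_gt0.
Qed.

(** * Maximum principle for potentials of radial kernels *)

(** What the argument uses of a kernel [phi(|x - y|)]: [adm_doubling] carries
    bounds from a set to its complement, [adm_lip] makes truncated potentials
    Lipschitz, [adm_mean] is subharmonicity away from the origin in the form
    of a discrete mean value inequality along the coordinate axes, and
    [adm_decay] controls potentials at infinity. *)
Record admissible (R : realType) (n : nat) (phi : R -> \bar R) : Prop := Admissible {
  adm_ge0 : forall t, (0 <= phi t)%E;
  adm_meas : measurable_fun setT phi;
  adm_doubling : forall s t, 0 <= s -> s <= 3 * t ->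
    (phi t <= 3%:E * phi s + 3%:E)%E;
  adm_lip : forall j : R, 0 <= j -> exists C : R, 0 <= C /\
    forall s t, 0 <= s -> 0 <= t ->
    (mine (phi s) j%:E <= mine (phi t) j%:E + (C * `|s - t|)%:E)%E;
  adm_mean : forall d : R, 0 < d -> exists C rho0 : R, [/\ 0 <= C, 0 < rho0 &
    forall (z : 'rV[R]_n), d <= enorm z -> forall rho, 0 < rho < rho0 ->
    ((2 * n%:R)%:E * phi (enorm z) <= \sum_(i < n)
       (phi (enorm (z + rho *: delta_mx 0 i)%R) + phi (enorm (z - rho *: delta_mx 0 i)%R))
      + (C * rho ^+ 4)%:E)%E];
  adm_decay : forall eta : R, 0 < eta -> exists M, forall t, M <= t -> (phi t <= eta%:E)%E
}.

Section max_principle.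
Context (R : realType) (n : nat) (phi : R -> \bar R).
Hypothesis adm : admissible n phi.
Hypothesis n0 : (0 < n)%N.
Let T := borelRn R n.
Local Open Scope ereal_scope.

Definition excess (j : R) (t : R) : \bar R := maxe (phi t - j%:E) 0.

Lemma excess_ge0 j t : 0 <= excess j t.
Proof. by rewrite /excess le_max lexx orbT. Qed.

Lemma min_excess j t : phi t = mine (phi t) j%:E + excess j t.
Proof.
rewrite /excess; case: (phi t) (adm_ge0 adm t) => [r _| _|//].
- rewrite -EFinB -EFin_min -EFin_max -EFinD; congr EFin.
  by case: (leP r j) => rj; [rewrite max_r|rewrite max_l]; lra.
- by rewrite addye// maxye /mine ltNge leey /=.
Qed.

Lemma excess_doubling j s t : (0 <= s)%R -> (s <= 3 * t)%R ->
  excess (3 * j + 3) t <= 3%:E * excess j s.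
Proof.
move=> s0 st; have := adm_doubling adm s0 st.
move: (adm_ge0 adm s); rewrite /excess.
case: (phi s) => [r r0| _ _|//].
- case: (phi t) => [r'|//|]; last by rewrite maxNye mule_ge0// le_max lexx orbT.
  rewrite -!(EFinB, EFin_max, EFinM, EFinD) !lee_fin => H.
  by rewrite ge_max; case: (leP (r - j) 0)%R => ?; apply/andP; split; lra.
- by rewrite addye// maxye mulry gtr0_sg// mul1e leey.
Qed.

Lemma measurable_excess j : measurable_fun setT (excess j).
Proof.
apply: measurable_maxe; last exact: measurable_cst.
by apply: emeasurable_funB; [exact: (adm_meas adm)|exact: measurable_cst].
Qed.

Lemma measurable_distfrom (x : 'rV[R]_n) :
  measurable_fun setT (fun y : T => enorm (x - (y : 'rV[R]_n))).
Proof.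
exact: (measurableT_comp (@measurable_enormB R n) (pair1_measurable (x : T))).
Qed.

Lemma measurable_of_dist (f : R -> \bar R) (D : set T) (x : 'rV[R]_n) :
  measurable_fun setT f ->
  measurable_fun D (fun y : T => f (enorm (x - (y : 'rV[R]_n)))).
Proof.
move=> mf; apply: measurable_funTS; apply: measurableT_comp => //.
exact: measurable_distfrom.
Qed.

Variables (mu : {measure set T -> \bar R}) (F : set T) (mF : measurable F).

(** For [x] outside [F], let [y'] be a nearly closest point of [F]; then
    [|y' - y| <= 3 |x - y|] for the other points [y] of [F], so the doubling
    property carries the bound at [y'] over to [x].  As [F] may accumulate at
    [x], it is exhausted by its points at distance at least [1 / (i + 1)]. *)
Lemma tail_bound (j eta : R) : (0 <= eta)%R ->
  (forall x : 'rV[R]_n, F x -> \int[mu]_(y in F) excess j (enorm (x - y)) <= eta%:E) ->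
  forall x : 'rV[R]_n, \int[mu]_(y in F) excess (3 * j + 3) (enorm (x - y)) <= (3 * eta)%:E.
Proof.
move=> eta0 Fe x.
have me j' D (y : 'rV[R]_n) : measurable_fun D (fun z : T => excess j' (enorm (y - (z : 'rV[R]_n)))).
  exact: measurable_of_dist (measurable_excess j').
have step (y' : 'rV[R]_n) (G : set T) : measurable G -> G `<=` F -> F y' ->
    (forall y : 'rV[R]_n, G y -> (enorm (y' - y) <= 3 * enorm (x - y))%R) ->
    \int[mu]_(y in G) excess (3 * j + 3) (enorm (x - y)) <= (3 * eta)%:E.
  move=> mG GF Fy' Gy.
  apply: (@le_trans _ _ (\int[mu]_(y in G) (3%:E * excess j (enorm (y' - y))))).
    apply: (@ge0_le_integral _ _ _ mu G mG (fun y : T => excess (3 * j + 3) (enorm (x - (y : 'rV[R]_n))%R))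
      (fun y : T => 3%:E * excess j (enorm (y' - (y : 'rV[R]_n))%R))).
    - by move=> *; exact: excess_ge0.
    - exact: me.
    - by apply: measurable_funeM; exact: me.
    - by move=> y Gy'; apply: excess_doubling; [exact: enorm_ge0|exact: Gy].
  rewrite ge0_integralZl_EFin//; do ?[by move=> *; exact: excess_ge0|exact: me].
  rewrite EFinM lee_pmul2l//; apply: le_trans (Fe _ Fy').
  by apply: ge0_subset_integral => //; do ?[exact: me|by move=> *; exact: excess_ge0].
have [Fx|Fx] := pselect (F x).
  apply: (step x) => // y _; have := enorm_ge0 (x - y); lra.
have [F0|/set0P F0] := eqVneq F set0.
  by rewrite F0 integral_set0 lee_fin mulr_ge0.
pose G i := F `&` [set y : T | (i.+1%:R^-1 <= enorm (x - (y : 'rV[R]_n)))%R].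
have mG i : measurable (G i).
  apply: measurableI => //; rewrite -[X in measurable X]setTI.
  by apply: measurable_fun_le => //; exact: measurable_distfrom.
have GF : \bigcup_i G i = F.
  apply/seteqP; split => [y [i _ []]//|y Fy].
  have : (0 < enorm (x - (y : 'rV[R]_n)))%R.
    rewrite lt_neqAle enorm_ge0 andbT eq_sym enorm_eq0 subr_eq0.
    by apply/eqP => xy; apply: Fx; rewrite xy.
  move=> d0; exists (Num.truncn (enorm (x - (y : 'rV[R]_n)))^-1) => //; split => //=.
  rewrite -[leRHS]invrK lef_pV2 ?posrE ?invr_gt0//.
  by apply/ltW; exact: truncnS_gt.
have Gnd : {homo G : a b / (a <= b)%N >-> (a <= b)%O}.
  move=> a b ab; apply/subsetPset => y [Fy /= ya]; split => //=.
  by apply: le_trans ya; rewrite lef_pV2 ?posrE// ler_nat.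
have := @ge0_nondecreasing_set_cvg_integral _ _ _ G
  (fun y : T => excess (3 * j + 3) (enorm (x - (y : 'rV[R]_n)))) mu Gnd mG
  (fun i => me _ _ _) (fun i y _ => excess_ge0 _ _).
rewrite GF => /(@cvg_lim _ _ _ _ _ _ _) <- //; apply: lime_le.
  by apply: ereal_nondecreasing_is_cvgn; apply: ge0_nondecreasing_set_nondecreasing_integral => //;
    move=> *; exact: excess_ge0.
apply: nearW => i.
pose D := [set enorm (x - (y : 'rV[R]_n)) | y in F].
have D0 : has_inf D.
  split; first by case: F0 => y Fy; exists (enorm (x - y)); exists y.
  by exists 0%R => _ [y _ <-]; exact: enorm_ge0.
have i0 : (0 < i.+1%:R^-1 :> R)%R by rewrite invr_gt0.
have [_ [y' Fy' <-] y'd] := inf_adherent i0 D0.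
apply: (step y') => //; first by move=> y [].
move=> y [Fy /= iy].
have dy : (inf D <= enorm (x - y))%R by apply: ge_inf; [case: D0|exists y].
have := enormD (y' - x) (x - y); rewrite addrA subrK (enormB y' x) => tri.
have aux (a b c e f : R) : (a <= b + c -> b < e + f -> e <= c -> f <= c -> a <= 3 * c)%R.
  by lra.
exact: (aux _ _ _ _ _ tri y'd dy iy).
Qed.

(** Close to [F] the bound on [F] survives up to a multiple of [eta], since the
    truncated potential is Lipschitz and the remainder is uniformly small
    by [tail_bound]; away from [F] the mean inequality holds, and
    [discrete_max_principle] concludes. *)
Lemma potential_max_principle (R0 j eta v : R) :
  mu F <= 1 -> (0 <= j)%R -> (0 < eta)%R -> (0 <= v)%R ->
  (forall x : 'rV[R]_n, F x -> (enorm x <= R0)%R) ->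
  (forall x : 'rV[R]_n, F x -> \int[mu]_(y in F) phi (enorm (x - y)) <= v%:E) ->
  (forall x : 'rV[R]_n, F x -> \int[mu]_(y in F) excess j (enorm (x - y)) <= eta%:E) ->
  forall x : 'rV[R]_n, \int[mu]_(y in F) phi (enorm (x - y)) <= (v + 4 * eta)%:E.
Proof.
move=> muF j0 eta0 v0 FR Fv Fe.
pose w (x : 'rV[R]_n) := \int[mu]_(y in F) phi (enorm (x - y)).
pose j1 := (3 * j + 3)%R.
pose w1 (x : 'rV[R]_n) := \int[mu]_(y in F) mine (phi (enorm (x - y))) j1%:E.
pose w2 (x : 'rV[R]_n) := \int[mu]_(y in F) excess j1 (enorm (x - y)).
have mphi D (x : 'rV[R]_n) : measurable_fun D (fun y : T => phi (enorm (x - (y : 'rV[R]_n)))).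
  exact: measurable_of_dist (adm_meas adm).
have j10 : (0 <= j1)%R by rewrite /j1; lra.
have mmin D (x : 'rV[R]_n) : measurable_fun D (fun y : T => mine (phi (enorm (x - (y : 'rV[R]_n)))) j1%:E).
  by apply: measurable_mine; [exact: mphi|exact: measurable_cst].
have min0 t : 0 <= mine (phi t) j1%:E by rewrite le_min (adm_ge0 adm)/= lee_fin.
have me D (y : 'rV[R]_n) : measurable_fun D (fun z : T => excess j1 (enorm (y - (z : 'rV[R]_n)))).
  exact: measurable_of_dist (measurable_excess j1).
have wE x : w x = w1 x + w2 x.
  rewrite -ge0_integralD//; last by move=> *; exact: excess_ge0.
  by apply: eq_integral => y _; exact: min_excess.
have w2le x : w2 x <= (3 * eta)%:E by apply: tail_bound => //; exact: ltW.
have intc (c : R) : (0 <= c)%R -> \int[mu]_(y in F) c%:E <= c%:E.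
  move=> c0; rewrite integral_cst// -[leRHS]mule1 lee_pmul// ?lee_fin//.
have w1le x : w1 x <= j1%:E.
  apply: le_trans (intc _ j10); apply: ge0_le_integral => //.
  by move=> y _; rewrite ge_min lexx orbT.
have w0 x : 0 <= w x by apply: integral_ge0 => y _; exact: (adm_ge0 adm).
have w10 x : 0 <= w1 x by apply: integral_ge0 => y _.
have w20 x : 0 <= w2 x by apply: integral_ge0 => y _; exact: excess_ge0.
have wle x : w x <= (j1 + 3 * eta)%:E by rewrite wE EFinD leeD.
have wfin x : w x \is a fin_num.
  by rewrite ge0_fin_numE//; apply: le_lt_trans (wle x) _; rewrite ltry.
pose W x := fine (w x).
have wW x : w x = (W x)%:E by rewrite fineK.
suff main : forall x, (W x <= v + 4 * eta)%R by move=> x; rewrite -/(w x) wW lee_fin.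
have [C [C0 lipC]] := adm_lip adm j10.
have w1lip (x x' : 'rV[R]_n) : w1 x <= w1 x' + (C * enorm (x - x'))%:E.
  apply: (@le_trans _ _ (\int[mu]_(y in F) (mine (phi (enorm (x' - y))) j1%:E + (C * enorm (x - x'))%:E))).
    apply: ge0_le_integral => //.
      by apply: emeasurable_funD => //; exact: measurable_cst.
    move=> y _; apply: le_trans (lipC _ (enorm (x' - y)) (enorm_ge0 _) (enorm_ge0 _)) _.
    rewrite leeD2l// lee_fin ler_wpM2l//.
    by apply: le_trans (enorm_distE _ _) _; rewrite opprB addrA subrK.
  rewrite ge0_integralD//; last by move=> y _; rewrite lee_fin mulr_ge0// enorm_ge0.
  by rewrite leeD2l//; apply: intc; rewrite mulr_ge0// enorm_ge0.
pose d := (eta / (C + 1))%R.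
have C1 : (0 < C + 1)%R by lra.
have d0 : (0 < d)%R by rewrite divr_gt0.
have near (x y : 'rV[R]_n) : F y -> (enorm (x - y) <= d)%R -> (W x <= v + 4 * eta)%R.
  move=> Fy xy; rewrite -lee_fin -wW wE.
  have : (C * enorm (x - y) <= eta)%R.
    have : ((C + 1) * enorm (x - y) <= eta)%R by rewrite mulrC -ler_pdivlMr.
    have := enorm_ge0 (x - y); lra.
  rewrite -lee_fin => xe; rewrite (_ : (v + 4 * eta = v + eta + 3 * eta)%R); last by lra.
  rewrite EFinD leeD// EFinD; apply: le_trans (w1lip x y) _; rewrite leeD//.
  by apply: le_trans (Fv _ Fy); rewrite -/(w y) wE leeDl.
have [M1 M1phi] := adm_decay adm eta0.
have far (x : 'rV[R]_n) : (R0 + M1 <= enorm x)%R -> (W x <= eta)%R.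
  move=> xM; rewrite -lee_fin -wW; apply: le_trans (intc _ (ltW eta0)).
  apply: ge0_le_integral => //; first by move=> y _; exact: (adm_ge0 adm).
  move=> y Fy; apply: M1phi; have := enorm_dist x y; have := FR _ Fy; lra.
apply: (@discrete_max_principle R n W _ (R0 + M1)%R (j1 + 3 * eta)%R) => //.
- by move=> x'; rewrite -lee_fin -wW.
- move=> x' x'v; rewrite ltNge; apply/negP => /far; lra.
have [C' [rho0 [C'0 rho00 mean]]] := adm_mean adm d0.
exists C', rho0; split => // x' x'v rho rho01.
have Fd (y : 'rV[R]_n) : F y -> (d <= enorm (x' - y))%R.
  move=> Fy; rewrite leNgt; apply/negP => /ltW /(near _ _ Fy); lra.
rewrite -lee_fin EFinD EFinM -wW -sumEFin.
under eq_bigr do rewrite EFinD -!wW.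
have Cr : (0 <= C' * rho ^+ 4)%R.
  by case/andP: rho01 => r0 _; rewrite mulr_ge0// exprn_ge0// ltW.
apply: (@le_trans _ _ (\int[mu]_(y in F) (\sum_(i < n)
   (phi (enorm (x' + rho *: delta_mx 0 i - y)%R) + phi (enorm (x' - rho *: delta_mx 0 i - y)%R))
      + (C' * rho ^+ 4)%:E))).
  rewrite -ge0_integralZl_EFin//; last by move=> y _; exact: (adm_ge0 adm).
  apply: ge0_le_integral => //.
  - by move=> y _; rewrite mule_ge0 ?(adm_ge0 adm)// lee_fin mulr_ge0.
  - by apply: measurable_funeM.
  - apply: emeasurable_funD; last exact: measurable_cst.
    by apply: emeasurable_sum => i; apply: emeasurable_funD.
  - move=> y Fy; have := mean _ (Fd _ Fy) rho rho01.
    move=> H; apply: (le_trans H); rewrite leeD2r//; apply: lee_sum => i _.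
    by rewrite (addrAC x' (rho *: _)) (addrAC x' (- (rho *: _)))%R.
rewrite ge0_integralD//; last 2 first.
- by move=> y _; apply: sume_ge0 => i _; rewrite adde_ge0 ?(adm_ge0 adm).
- by apply: emeasurable_sum => i; apply: emeasurable_funD.
rewrite leeD ?intc// ge0_integral_sum//; last 2 first.
- by move=> i; apply: emeasurable_funD.
- by move=> i y _; rewrite adde_ge0 ?(adm_ge0 adm).
apply: lee_sum => i _; rewrite ge0_integralD//; by move=> y _; exact: (adm_ge0 adm).
Qed.

End max_principle.

(** * The equilibrium potential is bounded by the energy *)

Section equilibrium_potential.
Context (R : realType) (n : nat) (phi : R -> \bar R).
Hypothesis adm : admissible n phi.
Hypothesis n0 : (0 < n)%N.
Let T := borelRn R n.
Local Open Scope ereal_scope.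

Definition dkernel (z : T * T) : \bar R := phi (enorm ((z.1 : 'rV[R]_n) - z.2)).

Lemma measurable_dkernel : measurable_fun setT dkernel.
Proof.
exact: (measurableT_comp (adm_meas adm) (@measurable_enormB R n)).
Qed.

Lemma dkernel_ge0 z : 0 <= dkernel z.
Proof. exact: (adm_ge0 adm). Qed.

Lemma dkernelC x y : dkernel (x, y) = dkernel (y, x).
Proof. by rewrite /dkernel/= enormB. Qed.

(** The truncated kernels increase to the kernel, whose double integral is
    finite, so the remainders tend to zero. *)
Lemma mutual_excess_small (mu : probability T R) (eps : R) : (0 < eps)%R ->
  mutual dkernel mu mu < +oo ->
  exists j : R, (0 <= j)%R /\
  \int[mu]_x \int[mu]_y excess phi j (enorm ((x : 'rV[R]_n) - (y : 'rV[R]_n))) <= eps%:E.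
Proof.
move=> eps0 Joo.
pose g (m : nat) z := mine (dkernel z) m%:R%:E.
have mk := measurable_dkernel; have k0 := dkernel_ge0.
have mg m : measurable_fun setT (g m).
  by apply: measurable_mine => //; exact: measurable_cst.
have g0 m z : 0 <= g m z by rewrite /g le_min k0/= lee_fin.
have gnd z : {homo g^~ z : a b / (a <= b)%N >-> a <= b}.
  move=> a b ab; rewrite /g le_min !ge_min lexx/=.
  by rewrite lee_fin ler_nat ab orbT.
have gcvg z : limn (g^~ z) = dkernel z.
  apply/cvg_lim => //; rewrite /g; case: (dkernel z) (k0 z) => [r r0| _|//].
  - apply: cvg_near_cst; near=> m; rewrite min_l// lee_fin.
    by near: m; exact: nbhs_infty_ger.
  - apply/cvgeyPge => A; near=> m.
    rewrite min_r ?leey// lee_fin; near: m; exact: nbhs_infty_ger.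
have V : \int[mu \x mu]_z dkernel z = mutual dkernel mu mu.
  by rewrite fubini_tonelli1.
have cv : \int[mu \x mu]_z g m z @[m --> \oo] --> mutual dkernel mu mu.
  rewrite -V; under eq_integral do rewrite -gcvg.
  by apply: cvg_monotone_convergence.
have Vf : mutual dkernel mu mu \is a fin_num.
  by rewrite ge0_fin_numE// mutual_ge0.
have [m Hm] : exists m, mutual dkernel mu mu - eps%:E <= \int[mu \x mu]_z g m z.
  apply/not_existsP => H.
  have : mutual dkernel mu mu <= mutual dkernel mu mu - eps%:E.
    rewrite -{1}(cvg_lim _ cv)//; apply: lime_le.
      by apply/cvg_ex; eexists; exact: cv.
    by apply: nearW => m; have /negP := H m; rewrite -ltNge => /ltW.
  rewrite -(fineK Vf) -EFinB lee_fin; lra.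
exists m%:R; split => //.
have me : measurable_fun setT (fun z : T * T => excess phi m%:R (enorm ((z.1 : 'rV[R]_n) - z.2))).
  exact: (measurableT_comp (measurable_excess adm _) (@measurable_enormB R n)).
rewrite -(fubini_tonelli1 _ me)//; last by move=> z; exact: excess_ge0.
have : mutual dkernel mu mu = \int[mu \x mu]_z g m z + \int[mu \x mu]_z excess phi m%:R (enorm ((z.1 : 'rV[R]_n) - z.2)).
  rewrite -V -ge0_integralD//; last by move=> z _; exact: excess_ge0.
  by apply: eq_integral => z _; exact: (min_excess adm).
move: Hm; set a := \int[_]_z g m z; set b := \int[_]_z _; set c := mutual _ _ _.
have a0 : 0 <= a by exact: integral_ge0.
have b0 : 0 <= b by apply: integral_ge0 => z _; exact: excess_ge0.
have cf : c \is a fin_num by [].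
move=> Hm cE.
have af : a \is a fin_num.
  by rewrite ge0_fin_numE// (le_lt_trans _ Joo)// -/c cE leeDl.
have bf : b \is a fin_num.
  by rewrite ge0_fin_numE// (le_lt_trans _ Joo)// -/c cE leeDr.
move: Hm cE; rewrite -(fineK af) -(fineK bf) -(fineK cf) -EFinB -EFinD !lee_fin.
by move=> Hm [cE]; lra.
Unshelve. all: by end_near.
Qed.

(** Off a set of measure at most [eta], the potential of [mu] is at most
    [V + eta] (by [frostman]) and its tails are at most [eta].  Restricted to the
    remaining set [F], the measure [mu] thus has a potential bounded
    everywhere by [V + 5 eta], which is integrated against [tau]; the discarded
    part costs at most [B eta], as the potential of [tau] is bounded by [B]. *)
Lemma equilibrium_potential_le (mu : probability T R)
    (tau : {finite_measure set T -> \bar R}) (K : set T) (R0 B : R) :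
  measurable K -> mu K = 1 -> (forall x : 'rV[R]_n, K x -> (enorm x <= R0)%R) ->
  (forall P : probability T R, P K = 1 ->
     mutual dkernel mu mu <= mutual dkernel P P) ->
  mutual dkernel mu mu < +oo ->
  (0 <= B)%R -> (forall x, K x -> pot dkernel tau x <= B%:E) ->
  mutual dkernel mu tau <= mutual dkernel mu mu * tau setT.
Proof.
move=> mK muK KR minmu Joo B0 tauB.
have mk := measurable_dkernel; have k0 := dkernel_ge0; have ks := dkernelC.
have Vf : mutual dkernel mu mu \is a fin_num.
  by rewrite ge0_fin_numE// mutual_ge0.
set V := mutual dkernel mu mu in Vf *.
have V0 : (0 <= fine V)%R by rewrite fine_ge0// mutual_ge0.
have tf : tau setT \is a fin_num by exact: fin_num_measure.
have M0 : (0 <= fine (tau setT))%R by rewrite fine_ge0.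
apply/lee_addgt0Pr => e e0.
set M := fine (tau setT) in M0.
(* The error terms below add up to at most [eta * (5 M + B)]. *)
have [eta [eta0 etaE]] : exists eta : R, (0 < eta)%R /\ (eta * (5 * M + B + 1) = e)%R.
  have d0 : (0 < 5 * M + B + 1)%R by lra.
  exists (e / (5 * M + B + 1))%R; split; first by rewrite divr_gt0.
  by rewrite divfK// gt_eqF.
(* Bounding the double integral by [eta^2] makes the set where the inner
   integral exceeds [eta] of measure at most [eta], by Markov's inequality. *)
have [j [j0 Hj]] := mutual_excess_small (mulr_gt0 eta0 eta0) Joo.
pose Te (x : T) := \int[mu]_y excess phi j (enorm ((x : 'rV[R]_n) - (y : 'rV[R]_n))).
have mTe : measurable_fun setT Te.
  apply: (@measurable_fun_fubini_tonelli_F _ _ _ _ _ _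
    (fun z : T * T => excess phi j (enorm ((z.1 : 'rV[R]_n) - z.2)))).
    exact: (measurableT_comp (measurable_excess adm _) (@measurable_enormB R n)).
  by move=> z; exact: excess_ge0.
have Te0 x : 0 <= Te x by apply: integral_ge0 => y _; exact: excess_ge0.
pose A1 := [set x : T | eta%:E <= Te x].
pose A2 := [set x : T | V + eta%:E <= pot dkernel mu x].
have mA1 : measurable A1 by rewrite -[A1]setTI; exact: emeasurable_fun_c_infty.
have mA2 : measurable A2.
  by rewrite -[A2]setTI; apply: emeasurable_fun_c_infty => //; exact: measurable_pot.
have muA2 : mu A2 = 0 by exact: (frostman mk k0 ks mK).
have muA1 : mu A1 <= eta%:E.
  have : eta%:E * mu A1 <= (eta * eta)%:E.
    apply: le_trans Hj; rewrite -integral_cst//.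
    apply: (@le_trans _ _ (\int[mu]_(x in A1) Te x)).
      apply: ge0_le_integral => //; last exact: measurable_funTS.
      by move=> x _; rewrite lee_fin ltW.
    by apply: ge0_subset_integral.
  by rewrite EFinM lee_pmul2l.
pose F := K `\` (A1 `|` A2).
have mF : measurable F by apply: measurableD => //; exact: measurableU.
have muCK : mu (~` K) = 0 by rewrite probability_setC// muK subee.
have muCF : mu (~` F) <= eta%:E.
  have sub : ~` F `<=` (~` K `|` (A1 `|` A2)).
    by move=> x; rewrite /F /setD /= not_andP notK => -[]; [left|right].
  have mCK : measurable (~` K) by exact: measurableC.
  have mA := measurableU _ _ mA1 mA2.
  apply: (@le_trans _ _ (mu (~` K `|` (A1 `|` A2)))).
    by apply: le_measure => //; rewrite inE; [exact: measurableC|exact: measurableU].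
  apply: (@le_trans _ _ (mu (~` K) + mu (A1 `|` A2))); first exact: measureU2.
  rewrite muCK add0e.
  apply: (@le_trans _ _ (mu A1 + mu A2)); first exact: measureU2.
  by rewrite muA2 adde0.
have mpt : measurable_fun setT (pot dkernel tau) by exact: measurable_pot.
have pt0 x : 0 <= pot dkernel tau x by exact: pot_ge0.
have [muF [muFE muFint]] := exists_restriction mu mF.
have potF (x : T) : pot dkernel muF x <= (fine V + 5 * eta)%:E.
  rewrite /pot muFint//; last exact: kernel_section.
  have -> : (fine V + 5 * eta = (fine V + eta) + 4 * eta)%R by lra.
  apply: (potential_max_principle adm n0 mF (R0 := R0) (j := j)) => //.
  - exact: probability_le1.
  - by lra.
  - by move=> y [/KR].
  - move=> y [_ /not_orP[_ /negP]]; rewrite -ltNge -(fineK Vf) => /ltW yV.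
    rewrite EFinD; apply: le_trans yV; apply: ge0_subset_integral => //.
      exact: (kernel_section mk).
    by move=> z _; exact: (k0 (y, z)).
  - move=> y [_ /not_orP[/negP + _]]; rewrite -ltNge => /ltW yV.
    apply: le_trans yV; apply: ge0_subset_integral => //.
      exact: measurable_of_dist (measurable_excess adm j).
    by move=> z _; exact: excess_ge0.
have mCF : measurable (~` F) by exact: measurableC.
have -> : mutual dkernel mu tau = mutual dkernel tau muF +
    \int[mu]_(x in ~` F) pot dkernel tau x.
  rewrite (mutualC mk k0 ks tau muF) /mutual (muFint _ mpt pt0).
  rewrite -ge0_integral_setU ?setUv//.
  by apply/disj_set2P; rewrite setICr.
have I1 : mutual dkernel tau muF <= ((fine V + 5 * eta) * M)%:E.
  rewrite EFinM fineK// -integral_cst//.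
  apply: ge0_le_integral => //; [by move=> x _; exact: pot_ge0|exact: measurable_pot].
have I2 : \int[mu]_(x in ~` F) pot dkernel tau x <= (B * eta)%:E.
  apply: (@le_trans _ _ (B%:E * mu (~` F))).
    rewrite -integral_cst//; apply: ae_ge0_le_integral => //.
      exact: measurable_funTS.
    exists (~` K); split; [exact: measurableC|exact: muCK|].
    move=> x /= H Kx; apply: H => _; exact: tauB.
  by rewrite EFinM; apply: lee_wpmul2l; rewrite ?lee_fin.
apply: (le_trans (leeD I1 I2)).
rewrite -(fineK Vf) -(fineK tf) -/M -!(EFinM, EFinD) lee_fin -etaE; lra.
Qed.

End equilibrium_potential.

(** * The Newtonian and the truncated logarithmic kernels *)

Definition newton (R : realType) (t : R) : \bar R :=
  if t <= 0 then +oo%E else (t^-1)%:E.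

(** The logarithmic kernel made nonnegative: it equals [L - ln t] as long as
    [t <= e^L]. *)
Definition logpot (R : realType) (L t : R) : \bar R :=
  if t <= 0 then +oo%E else (Num.max 0 (L - ln t))%:E.

Lemma measurable_invr (R : realType) : measurable_fun setT (fun x : R => x^-1).
Proof.
rewrite (_ : (fun _ => _) = (fun x => if x < 0 then - powR (- x) (-1) else powR x (-1))).
  apply: measurable_fun_ifT => /=.
  - by apply: measurable_fun_ltr.
  - apply: measurableT_comp => //.
    by apply: (measurableT_comp (@measurable_powR R (-1))).
  - exact: measurable_powR.
apply/funext => x; case: ltP => x0; last by rewrite powR_inv1.
by rewrite powR_inv1 ?oppr_ge0 ?ltW// invrN opprK.
Qed.

(** The left-hand side is the cubic Taylor polynomial of [w^(-1/2)] at [w = 1],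
    evaluated at [w = u^2]. *)
Lemma taylor_inv (R : realFieldType) (u : R) : 0 < u ->
  (35 - 35 * u ^+ 2 + 21 * u ^+ 4 - 5 * u ^+ 6) / 16 <= u^-1.
Proof.
move=> u0; rewrite -[leRHS]mul1r ler_pdivlMr// -subr_ge0.
have -> : 1 - (35 - 35 * u ^+ 2 + 21 * u ^+ 4 - 5 * u ^+ 6) / 16 * u =
  ((u - 1) ^+ 2) ^+ 2 * (5 * u ^+ 3 + 20 * u ^+ 2 + 29 * u + 16) / 16 by field.
rewrite divr_ge0// mulr_ge0 ?sqr_ge0// !addr_ge0// mulr_ge0 ?exprn_ge0// ltW//.
Qed.

(** [taylor_inv] applied to [|x + rho e_i| / |x|] and [|x - rho e_i| / |x|].
    Summed over the three directions, the terms of order [rho^2] cancel: this is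
    the harmonicity of [1 / |x|]. *)
Lemma newton_pair (R : realType) (x : 'rV[R]_3) (i : 'I_3) (rho b p r2 : R) :
  0 < rho -> rho < enorm x / 2 ->
  b = (enorm x)^-1 -> p = rho ^+ 2 * b ^+ 2 ->
  r2 = 4 * p * (b ^+ 2 * x 0 i ^+ 2) ->
  b * (2 - p + 3/4 * (p ^+ 2 + r2) - 5 / 8 * (p ^+ 3 + 3 * p * r2)) <=
  (enorm (x + rho *: delta_mx 0 i))^-1 + (enorm (x - rho *: delta_mx 0 i))^-1.
Proof.
move=> r0 rx bE pE r2E.
have x0 : 0 < enorm x by lra.
have b0 : 0 < b by rewrite bE invr_gt0.
have pos (s : R) : `|s| = rho -> 0 < enorm (x + s *: delta_mx 0 i).
  move=> sr; have := enorm_dist x (x + s *: delta_mx 0 i).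
  by rewrite opprD addrA subrr sub0r enormN enormZ enorm_delta sr; lra.
have one (s : R) : `|s| = rho ->
   forall t, t = b ^+ 2 * (2 * s * x 0 i + s ^+ 2) ->
   b * (1 - t / 2 + 3 / 8 * t ^+ 2 - 5 / 16 * t ^+ 3) <= (enorm (x + s *: delta_mx 0 i))^-1.
  move=> sr t tE; have u0 := pos s sr; set u := enorm _ in u0 *.
  have := taylor_inv (mulr_gt0 b0 u0).
  have -> : u^-1 = b * (b * u)^-1 by field; rewrite !gt_eqF.
  rewrite -(ler_pM2l b0); apply: le_trans.
  have -> : (b * u) ^+ 6 = ((b * u) ^+ 2) ^+ 3 by rewrite -exprM.
  have -> : (b * u) ^+ 4 = ((b * u) ^+ 2) ^+ 2 by rewrite -exprM.
  have -> : (b * u) ^+ 2 = 1 + t.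
    rewrite exprMn /u enorm_sqr_shift tE bE; field; by rewrite gt_eqF.
  by rewrite ler_pM2l//; lra.
pose t1 := b ^+ 2 * (2 * rho * x 0 i + rho ^+ 2).
pose t2 := b ^+ 2 * (2 * (- rho) * x 0 i + (- rho) ^+ 2).
have H1 := one rho (gtr0_norm r0) t1 erefl.
have H2 := one (- rho) (eq_trans (normrN _) (gtr0_norm r0)) t2 erefl.
rewrite scaleNr in H2.
have -> : b * (2 - p + 3 / 4 * (p ^+ 2 + r2) - 5 / 8 * (p ^+ 3 + 3 * p * r2)) =
  b * (1 - t1 / 2 + 3 / 8 * t1 ^+ 2 - 5 / 16 * t1 ^+ 3) +
  b * (1 - t2 / 2 + 3 / 8 * t2 ^+ 2 - 5 / 16 * t2 ^+ 3).
  by rewrite /t1 /t2 r2E pE; field.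
by rewrite lerD.
Qed.

Lemma newtonE (R : realType) (t : R) : 0 < t -> newton t = (t^-1)%:E.
Proof. by move=> t0; rewrite /newton leNgt t0. Qed.

Lemma logpotE (R : realType) (L t : R) :
  0 < t -> logpot L t = (Num.max 0 (L - ln t))%:E.
Proof. by move=> t0; rewrite /logpot leNgt t0. Qed.

Lemma admissible_newton (R : realType) : admissible 3 (@newton R).
Proof.
split.
- by move=> t; rewrite /newton; case: (leP t 0) => // t0; rewrite lee_fin invr_ge0 ltW.
- apply: measurable_fun_ifT => //=.
    by apply: measurable_fun_ler.
  by apply/measurable_EFinP; exact: measurable_invr.
- move=> s t s0 st.
  have [s00|s00] := leP s 0; first by rewrite {2}/newton s00 mulry gtr0_sg// mul1e addye// leey.
  have t0 : 0 < t by lra.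
  rewrite !newtonE// -EFinM -EFinD lee_fin.
  have : s * t^-1 <= 3 by rewrite ler_pdivrMr.
  rewrite -ler_pdivlMl// mulrC; lra.
- move=> j j0; exists (j ^+ 2); split; first exact: sqr_ge0.
  move=> s t s0 t0.
  have jC : (j%:E <= j%:E + (j ^+ 2 * `|s - t|)%:E)%E.
    by rewrite leeDl// lee_fin mulr_ge0// sqr_ge0.
  have mj x : (mine x j%:E <= j%:E)%E by rewrite ge_min lexx orbT.
  have [jt|tj] := leP j%:E (newton t).
    by apply: le_trans (mj _) _.
  have {tj} [tpos tj] : 0 < t /\ t^-1 < j.
    by move: tj; rewrite /newton; case: (leP t 0) => // ? ; rewrite lte_fin.
  have jpos : 0 < j by apply: lt_trans tj; rewrite invr_gt0.
  rewrite (newtonE tpos) -EFinD.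
  have [ts|st] := leP t s.
    apply: (@le_trans _ _ (t^-1)%:E).
      rewrite ge_min newtonE ?lee_fin; last exact: lt_le_trans ts.
      by rewrite lef_pV2 ?posrE// ?ts//; apply: lt_le_trans ts.
    by rewrite lee_fin lerDl mulr_ge0// sqr_ge0.
  pose s' := Num.max s j^-1.
  have s'0 : 0 < s' by rewrite lt_max invr_gt0 jpos orbT.
  have s't : s' < t by rewrite gt_max st/= -[t]invrK ltf_pV2 ?posrE ?invr_gt0.
  apply: (@le_trans _ _ (s'^-1)%:E).
    rewrite /s'; case: (leP s j^-1) => sj; first by rewrite invrK mj.
    by rewrite ge_min newtonE ?lexx// (lt_trans _ sj)// invr_gt0.
  rewrite lee_fin -lerBlDl.
  have -> : s'^-1 - t^-1 = (s'^-1 * t^-1) * (t - s') by field; rewrite !gt_eqF.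
  rewrite ltr0_norm ?subr_lt0// opprB.
  apply: ler_pM; [by rewrite mulr_ge0 ?invr_ge0 ?ltW|by rewrite subr_ge0 ltW| |].
    have s'j : s'^-1 <= j by rewrite invf_ple ?posrE// le_max lexx orbT.
    by rewrite expr2; apply: ler_pM => //; rewrite ?invr_ge0 ltW.
  by rewrite lerD2l lerN2 le_max lexx.
- move=> d d0; exists (6 / d ^+ 5), (d / 2); split.
  + by rewrite divr_ge0// exprn_ge0// ltW.
  + by rewrite divr_gt0.
  move=> z dz rho /andP[r0 rd].
  have z0 : 0 < enorm z by apply: lt_le_trans dz.
  have rz : rho < enorm z / 2 by lra.
  have pos (s : R) (i : 'I_3) : `|s| = rho -> 0 < enorm (z + s *: delta_mx 0 i).
    move=> sr; have := enorm_dist z (z + s *: delta_mx 0 i).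
    by rewrite opprD addrA subrr sub0r enormN enormZ enorm_delta sr; lra.
  rewrite newtonE//.
  have -> : (\sum_(i < 3) (newton (enorm (z + rho *: delta_mx 0 i)%R) +
     newton (enorm (z - rho *: delta_mx 0 i)%R)))%E =
     (\sum_(i < 3) ((enorm (z + rho *: delta_mx 0 i))^-1 + (enorm (z - rho *: delta_mx 0 i))^-1))%:E.
    rewrite -sumEFin; apply: eq_bigr => i _; rewrite !newtonE//.
      by rewrite -scaleNr; apply: pos; rewrite normrN gtr0_norm.
    by apply: pos; rewrite gtr0_norm.
  rewrite -EFinM -EFinD lee_fin.
  have := @ler_sum _ _ (index_enum 'I_3) xpredT _ _ (fun i _ => @newton_pair _ z i rho _ _ _ r0 rz erefl erefl erefl).
  set S := \sum_(i < 3) ((enorm _)^-1 + _).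
  set b := (enorm z)^-1; set p := rho ^+ 2 * b ^+ 2.
  rewrite -mulr_sumr => H.
  have zz : \sum_(i < 3) b ^+ 2 * z 0 i ^+ 2 = 1.
    by rewrite -mulr_sumr -enorm_sqr /b exprVn mulVf// gt_eqF// exprn_gt0.
  have : b * (6 - 21/4 * p ^+ 2 - 15/8 * p ^+ 3) <= S.
    apply: le_trans H; rewrite le_eqVlt; apply/orP; left; apply/eqP; congr (_ * _).
    move: zz; rewrite !big_ord_recr !big_ord0 /= !add0r.
    set a0 := b ^+ 2 * _; set a1 := b ^+ 2 * _; set a2 := b ^+ 2 * _ => zz.
    have -> : a2 = 1 - a0 - a1 by lra.
    by field.
  have b0 : 0 < b by rewrite invr_gt0.
  have bd : b <= d^-1 by rewrite lef_pV2 ?posrE.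
  have pb : p <= 1/4.
    have : rho * b <= 1/2 by rewrite ler_pdivrMr//; lra.
    have : 0 < rho * b by rewrite mulr_gt0.
    rewrite /p -exprMn; set w := rho * b => w0 w1; nra.
  have p0 : 0 <= p by rewrite mulr_ge0 ?sqr_ge0.
  have key : b * (21/4 * p ^+ 2 + 15/8 * p ^+ 3) <= 6 / d ^+ 5 * rho ^+ 4.
    have -> : 6 / d ^+ 5 * rho ^+ 4 = 6 * (d^-1 ^+ 5 * rho ^+ 4).
      by rewrite exprVn mulrA.
    apply: (@le_trans _ _ (6 * (b ^+ 5 * rho ^+ 4))).
      have -> : 6 * (b ^+ 5 * rho ^+ 4) = b * (6 * p ^+ 2) by rewrite /p; ring.
      rewrite ler_pM2l//; nra.
    rewrite ler_pM2l// ler_pM2r ?exprn_gt0// ler_pXn2r// nnegrE ?invr_ge0 ltW//.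
  move: key; lra.
- move=> eta eta0; exists eta^-1 => t et.
  have t0 : 0 < t by apply: lt_le_trans et; rewrite invr_gt0.
  rewrite newtonE// lee_fin -[leRHS]invrK lef_pV2 ?posrE ?invr_gt0//.
Qed.

(** The product of the squared distances from [(x, y)] to the four points at
    distance [rho] on the axes, with [a = x^2 + y^2]; this is the harmonicity of
    the logarithm in the plane, up to order four. *)
Lemma log_product_le (R : realFieldType) (x y rho a : R) :
  a = x ^+ 2 + y ^+ 2 ->
  (a + 2 * rho * x + rho ^+ 2) * (a + 2 * (- rho) * x + (-rho) ^+ 2) *
  ((a + 2 * rho * y + rho ^+ 2) * (a + 2 * (- rho) * y + (-rho) ^+ 2)) <=
  (a ^+ 2 + rho ^+ 4) ^+ 2.
Proof.
move=> aE; rewrite -subr_ge0.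
have -> : (a ^+ 2 + rho ^+ 4) ^+ 2 - (a + 2 * rho * x + rho ^+ 2) * (a + 2 * (- rho) * x + (-rho) ^+ 2) *
  ((a + 2 * rho * y + rho ^+ 2) * (a + 2 * (- rho) * y + (-rho) ^+ 2)) =
  4 * (rho ^+ 2 * (x ^+ 2 - y ^+ 2)) ^+ 2 by rewrite aE; ring.
by rewrite mulr_ge0// sqr_ge0.
Qed.

Lemma admissible_logpot (R : realType) (L : R) : admissible 2 (logpot L).
Proof.
have nE := @logpotE R L.
split.
- by move=> t; rewrite /logpot; case: (leP t 0) => // t0; rewrite lee_fin le_max lexx.
- apply: measurable_fun_ifT => //=; first by apply: measurable_fun_ler.
  apply/measurable_EFinP; apply: measurable_maxr => //.
  by apply: measurable_funB => //; exact: measurable_ln.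
- move=> s t s0 st.
  have [s00|s00] := leP s 0.
    by rewrite {2}/logpot s00 mulry gtr0_sg// mul1e addye// leey.
  have t0 : 0 < t by lra.
  rewrite !nE// -EFinM -EFinD lee_fin.
  have : ln s <= ln 3 + ln t by rewrite -lnM ?posrE// ler_ln ?posrE// mulr_gt0.
  have := @ln_sublinear R 3 ltac:(by []).
  rewrite !maxEle; case: ifP => ?; case: ifP => ?; lra.
- move=> j j0; pose m := expR (L - j); have m0 : 0 < m by exact: expR_gt0.
  exists m^-1; split; first by rewrite invr_ge0 ltW.
  move=> s t s0 t0.
  have jC : (j%:E <= j%:E + (m^-1 * `|s - t|)%:E)%E.
    by rewrite leeDl// lee_fin mulr_ge0// invr_ge0 ltW.
  have mj x : (mine x j%:E <= j%:E)%E by rewrite ge_min lexx orbT.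
  have [jt|tj] := leP j%:E (logpot L t).
    by apply: le_trans (mj _) _.
  have {tj} [tpos tj] : 0 < t /\ Num.max 0 (L - ln t) < j.
    by move: tj; rewrite /logpot; case: (leP t 0) => // ? ; rewrite lte_fin.
  have mt : m < t.
    move: tj; rewrite gt_max => /andP[_ tj].
    by rewrite -(lnK tpos) ltr_expR; lra.
  rewrite (nE _ tpos) -EFinD.
  have [ts|st] := leP t s.
    have spos : 0 < s by apply: lt_le_trans ts.
    apply: (@le_trans _ _ (Num.max 0 (L - ln t))%:E).
      rewrite ge_min nE// lee_fin ge_max !le_max lexx/=.
      by rewrite lerD2l lerN2 ler_ln ?posrE// ts orbT.
    by rewrite lee_fin lerDl mulr_ge0// invr_ge0 ltW.
  pose s' := Num.max s m.
  have s'0 : 0 < s' by rewrite lt_max m0 orbT.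
  have s't : s' < t by rewrite gt_max st.
  apply: (@le_trans _ _ (Num.max 0 (L - ln s'))%:E).
    rewrite /s'; case: (leP s m) => sm.
      by apply: le_trans (mj _) _; rewrite lee_fin le_max /m expRK; apply/orP; right; lra.
    by rewrite ge_min nE ?lexx// (lt_trans m0).
  rewrite lee_fin.
  have lnq : ln t - ln s' <= m^-1 * `|s - t|.
    rewrite -ln_div ?posrE//.
    have -> : t / s' = 1 + (t - s') / s' by field; rewrite gt_eqF.
    apply: (@le_trans _ _ ((t - s') / s')).
      by apply: le_ln1Dx; apply: (@lt_le_trans _ _ 0)=> //; rewrite divr_ge0 ?subr_ge0// ltW.
    rewrite ltr0_norm ?subr_lt0// opprB mulrC; apply: ler_pM.
    - by rewrite invr_ge0 ltW.
    - by rewrite subr_ge0 ltW.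
    - by rewrite lef_pV2 ?posrE// le_max lexx orbT.
    - by rewrite lerD2l lerN2 le_max lexx.
  rewrite ge_max; apply/andP; split.
    by rewrite addr_ge0// ?le_max ?lexx// mulr_ge0// invr_ge0 ltW.
  have : L - ln t <= Num.max 0 (L - ln t) by rewrite le_max lexx orbT.
  lra.
- move=> d d0; exists (d ^+ 4)^-1, (d / 2); split.
  + by rewrite invr_ge0 exprn_ge0// ltW.
  + by rewrite divr_gt0.
  move=> z dz rho /andP[r0 rd].
  have z0 : 0 < enorm z by apply: lt_le_trans dz.
  have pos (s : R) (i : 'I_2) : `|s| = rho -> 0 < enorm (z + s *: delta_mx 0 i).
    move=> sr; have := enorm_dist z (z + s *: delta_mx 0 i).
    by rewrite opprD addrA subrr sub0r enormN enormZ enorm_delta sr; lra.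
  have posp i : 0 < enorm (z + rho *: delta_mx 0 i) by apply: pos; rewrite gtr0_norm.
  have posn i : 0 < enorm (z + (- rho) *: delta_mx 0 i) by apply: pos; rewrite normrN gtr0_norm.
  rewrite nE//.
  under eq_bigr do rewrite -scaleNr !nE//.
  under eq_bigr do rewrite -EFinD.
  rewrite sumEFin -EFinM -EFinD lee_fin.
  have lnsq (u : R) : 0 < u -> ln u = 2^-1 * ln (u ^+ 2).
    by move=> u0; rewrite lnXn//; set l := ln u; lra.
  have C0 : 0 <= (d ^+ 4)^-1 * rho ^+ 4.
    by rewrite mulr_ge0 ?invr_ge0 ?exprn_ge0// ltW.
  have [Lz|zL] := leP (L - ln (enorm z)) 0.
    rewrite mulr0 addr_ge0// sumr_ge0// => i _.
    by rewrite addr_ge0// le_max lexx.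
  have mx w : L - ln w <= Num.max 0 (L - ln w) by rewrite le_max lexx orbT.
  apply: (@le_trans _ _ (\sum_(i < 2) ((L - ln (enorm (z + rho *: delta_mx 0 i))) +
    (L - ln (enorm (z + (- rho) *: delta_mx 0 i)))) + (d ^+ 4)^-1 * rho ^+ 4)); last first.
    by rewrite lerD2r; apply: ler_sum => i _; rewrite lerD.
  under eq_bigr do rewrite (lnsq _ (posp _)) (lnsq _ (posn _)).
  have sqp i := exprn_gt0 2 (posp i); have sqn i := exprn_gt0 2 (posn i).
  rewrite !big_ord_recr big_ord0 /= add0r.
  set i0 := widen_ord _ _; set i1 := ord_max.
  have zz : enorm z ^+ 2 = z 0 i0 ^+ 2 + z 0 i1 ^+ 2.
    by rewrite enorm_sqr !big_ord_recr big_ord0 /= add0r.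
  have := log_product_le rho zz; rewrite -!enorm_sqr_shift => prodle.
  have a0 : 0 < enorm z ^+ 2 by rewrite exprn_gt0.
  have q0 : 0 < (enorm z ^+ 2) ^+ 2 + rho ^+ 4 by rewrite addr_gt0// exprn_gt0.
  have : ln (enorm (z + rho *: delta_mx 0 i0) ^+ 2) + ln (enorm (z + (- rho) *: delta_mx 0 i0) ^+ 2)
    + (ln (enorm (z + rho *: delta_mx 0 i1) ^+ 2) + ln (enorm (z + (- rho) *: delta_mx 0 i1) ^+ 2))
    <= 2 * ln ((enorm z ^+ 2) ^+ 2 + rho ^+ 4).
    rewrite -!lnM ?posrE ?mulr_gt0// mulr_natl -lnXn// ler_ln ?posrE ?mulr_gt0 ?exprn_gt0//.
  have : ln ((enorm z ^+ 2) ^+ 2 + rho ^+ 4) <= 4 * ln (enorm z) + (d ^+ 4)^-1 * rho ^+ 4.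
    have -> : (enorm z ^+ 2) ^+ 2 + rho ^+ 4 = enorm z ^+ 4 * (1 + rho ^+ 4 / enorm z ^+ 4).
      by field; rewrite gt_eqF.
    have e0 : 0 <= rho ^+ 4 / enorm z ^+ 4 by rewrite divr_ge0// exprn_ge0// ltW.
    rewrite lnM ?posrE ?exprn_gt0//; last by rewrite ltr_wpDr.
    rewrite lnXn// -[_ *+ 4]mulr_natl lerD2l.
    apply: le_trans (le_ln1Dx _) _; first by apply: lt_le_trans e0.
    rewrite mulrC ler_pM2r ?exprn_gt0//.
    by rewrite lef_pV2 ?posrE ?exprn_gt0// ler_pXn2r// nnegrE ltW.
  set l1 := ln _; set l2 := ln _; set l3 := ln _; set l4 := ln _; set l5 := ln _; set l6 := ln _; lra.
- move=> eta eta0; exists (expR L) => t et.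
  have t0 : 0 < t by apply: lt_le_trans et; exact: expR_gt0.
  rewrite nE// lee_fin ge_max (ltW eta0)/=.
  have : L <= ln t by rewrite -(expRK L) ler_ln ?posrE// expR_gt0.
  lra.
Qed.

(** * Affine changes of variable and superposition of scales *)

Section lebesgue_tools.
Context (R : realType).
Notation leb := (@lebesgue_measure R).
Local Open Scope ereal_scope.

(** The image of the Lebesgue measure under the affine map, multiplied by [|a|],
    agrees with the Lebesgue measure on half-open intervals. *)
Lemma integral_affine (a b : R) (f : R -> \bar R) : a != 0%R ->
  measurable_fun setT f -> (forall x, 0 <= f x) ->
  \int[leb]_x f x = `|a|%:E * \int[leb]_x f (a * x + b)%R.
Proof.
move=> a0 mf f0.
pose h (x : measurableTypeR R) : measurableTypeR R := (a * x + b)%R.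
have mh : measurable_fun setT h.
  by apply: measurable_funD => //; exact: mulrl_measurable.
pose hm : {mfun (measurableTypeR R) >-> (measurableTypeR R)} :=
  HB.pack h (isMeasurableFun.Build _ _ _ _ h mh).
pose pm0 := [the measure _ _ of pushforward leb hm].
pose pm := pm0 mh.
have na : (0 <= `|a|)%R by [].
pose m := [the measure _ _ of mscale (NngNum na) pm].
have lm A : measurable A -> leb A = m A.
  apply: lebesgue_measure_unique => _ [[u v] /= _ <-].
  rewrite lebesgue_measure_itv/= lte_fin /m/= /mscale/= /pushforward.
  have [ap|an|] := ltgtP a 0%R; last by move/eqP; rewrite (negPf a0).
  - have -> : hm @^-1` `]u, v]%classic = `[((v - b) / a)%R, ((u - b) / a)%R[%classic.
      apply/seteqP; split => x; rewrite /preimage /= !in_itv/= /h => /andP[h1 h2]; apply/andP; split.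
      + by rewrite ler_ndivrMr// mulrC; lra.
      + by rewrite ltr_ndivlMr// mulrC; lra.
      + by move: h2; rewrite ltr_ndivlMr// mulrC; lra.
      + by move: h1; rewrite ler_ndivrMr// mulrC; lra.
    rewrite lebesgue_measure_itv/= lte_fin ltr_ndivrMr//.
    have -> : ((u - b) / a * a = u - b)%R by rewrite divfK.
    rewrite ltrD2r; case: ifP => uv; last by rewrite mule0.
    by rewrite -!EFinB -EFinM; congr EFin; rewrite ltr0_norm//; field.
  - have -> : hm @^-1` `]u, v]%classic = `]((u - b) / a)%R, ((v - b) / a)%R]%classic.
      apply/seteqP; split => x; rewrite /preimage /= !in_itv/= /h => /andP[h1 h2]; apply/andP; split.
      + by rewrite ltr_pdivrMr// mulrC; lra.
      + by rewrite ler_pdivlMr// mulrC; lra.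
      + by move: h1; rewrite ltr_pdivrMr// mulrC; lra.
      + by move: h2; rewrite ler_pdivlMr// mulrC; lra.
    rewrite lebesgue_measure_itv/= lte_fin ltr_pdivrMr//.
    have -> : ((v - b) / a * a = v - b)%R by rewrite divfK.
    rewrite ltrD2r; case: ifP => uv; last by rewrite mule0.
    by rewrite -!EFinB -EFinM; congr EFin; rewrite gtr0_norm//; field.
rewrite (eq_measure_integral m); last by move=> A mA _; exact: lm.
by rewrite ge0_integral_mscale// ge0_integral_pushforward//.
Qed.

Lemma integral_scale_shift (a b : R) (A : set R) (f : R -> \bar R) : a != 0%R ->
  measurable A -> measurable_fun setT f -> (forall x, 0 <= f x) ->
  \int[leb]_(x in A) f x =
    `|a|%:E * \int[leb]_(x in [set x | A (a * x + b)%R]) f (a * x + b)%R.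
Proof.
move=> a0 mA mf f0; rewrite [LHS]integral_mkcond.
rewrite (@integral_affine a b)//; last 2 first.
- rewrite epatch_indic; apply: emeasurable_funM => //.
  by apply/measurable_EFinP; exact: measurable_indic.
- by move=> x; rewrite /patch; case: ifP.
congr (_ * _); rewrite [RHS]integral_mkcond; apply: eq_integral => x _.
by rewrite /patch; congr (if _ then _ else _); apply/idP/idP; rewrite !inE.
Qed.

Lemma integral_shift_itv (c u v : R) (f : R -> \bar R) :
  measurable_fun setT f -> (forall x, 0 <= f x) ->
  \int[leb]_(x in `]u, v]) f (x + c)%R = \int[leb]_(x in `](u + c)%R, (v + c)%R]) f x.
Proof.
move=> mf f0; rewrite [RHS](@integral_scale_shift 1 c _ _ (oner_neq0 R))//.
rewrite normr1 mul1e; under [in RHS]eq_integral do rewrite mul1r.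
congr (integral _ _ _); apply/seteqP; split => x /=; rewrite !in_itv/= mul1r;
  by rewrite ltrD2r lerD2r.
Qed.

Lemma integral_itv_split (u v w : R) (f : R -> \bar R) : (u <= v)%R -> (v <= w)%R ->
  measurable_fun setT f -> (forall x, 0 <= f x) ->
  \int[leb]_(x in `]u, w]) f x = \int[leb]_(x in `]u, v]) f x + \int[leb]_(x in `]v, w]) f x.
Proof.
move=> uv vw mf f0; rewrite -ge0_integral_setU//.
- congr (integral _ _ _); apply/seteqP; split => x /=; rewrite !in_itv/=.
    by case: (leP x v) => xv /andP[ux xw]; [left|right]; rewrite ?ux ?xw.
  by case=> /andP[h1 h2]; apply/andP; split => //; [exact: le_trans vw|exact: le_lt_trans h1].
- exact: measurable_funTS.
- apply/disj_set2P; apply/seteqP; split => x //= []; rewrite !in_itv/= => /andP[_ xv] /andP[vx _].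
  by move: (lt_le_trans vx xv); rewrite ltxx.
Qed.

Lemma integral_period_shift (P c : R) (f : R -> \bar R) :
  (0 < P)%R -> (`|c| <= P)%R ->
  measurable_fun setT f -> (forall x, 0 <= f x) -> (forall x, f (x + P)%R = f x) ->
  \int[leb]_(x in `]0%R, P]) f (x + c)%R = \int[leb]_(x in `]0%R, P]) f x.
Proof.
move=> P0 cP mf f0 fP.
have pos c' : (0 <= c')%R -> (c' <= P)%R ->
    \int[leb]_(x in `]0%R, P]) f (x + c')%R = \int[leb]_(x in `]0%R, P]) f x.
  move=> c0 cP'; rewrite integral_shift_itv// add0r (@integral_itv_split c' P)//; last by lra.
  have -> : \int[leb]_(x in `]P, (P + c')%R]) f x = \int[leb]_(x in `]0%R, c']) f x.
    have := @integral_shift_itv P 0 c' f mf f0; rewrite add0r (addrC c') => <-.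
    by apply: eq_integral => x _; rewrite fP.
  by rewrite addeC -integral_itv_split.
have [c0|c0] := leP 0%R c; first by apply: pos; rewrite ?(ger0_norm c0) in cP *.
rewrite -(pos (c + P)%R); [|by rewrite ltr0_norm// in cP; lra|by lra].
by apply: eq_integral => x _; rewrite addrA fP.
Qed.

(** By scaling, the integral from [h^(n+1)] to [h] is [h^a] times the one from
    [h^n] to [1]; hence all these integrals are at most the solution [B] of
    [A + h^a B = B]. *)
Lemma integral_powR_lty (a : R) : (0 < a)%R ->
  \int[leb]_(x in `]0%R, 1%R]) (x `^ (a - 1))%:E < +oo.
Proof.
move=> a0; pose g (x : R) := (x `^ (a - 1))%:E.
have mg : measurable_fun setT g by apply/measurable_EFinP; exact: measurable_powR.
have g0 x : 0 <= g x by rewrite lee_fin powR_ge0.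
pose h : R := (2^-1)%R; have h0 : (0 < h)%R by rewrite invr_gt0.
have h1 : (h < 1)%R by rewrite invf_lt1// ltr1n.
pose A : R := (1 + h `^ (a - 1))%R.
have A0 : (0 <= A)%R by rewrite addr_ge0// powR_ge0.
have Ale : \int[leb]_(x in `]h, 1%R]) g x <= A%:E.
  apply: (@le_trans _ _ (\int[leb]_(x in `]h, 1%R]) A%:E)).
    apply: ge0_le_integral => //; first exact: measurable_funTS.
    move=> x /=; rewrite in_itv/= => /andP[hx x1]; rewrite lee_fin /A.
    have x0 : (0 < x)%R by apply: lt_trans hx.
    have [a1|a1] := leP 1%R a.
      have e1 : (1 `^ (a - 1) = 1 :> R)%R by rewrite powR1.
      apply: ler_wpDr; first exact: powR_ge0.
      by rewrite -[leRHS]e1 ge0_ler_powR ?nnegrE ?(ltW x0)//; lra.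
    rewrite ler_wpDl//.
    have e (y : R) : (y `^ (a - 1) = (y `^ (1 - a))^-1)%R.
      by rewrite -powRN opprB.
    rewrite !e lef_pV2 ?posrE ?powR_gt0//.
    by rewrite ge0_ler_powR ?nnegrE ?(ltW h0) ?(ltW x0)// ?(ltW hx)//; lra.
  rewrite integral_cst//= lebesgue_measure_itv/= lte_fin h1 -EFinB -EFinM lee_fin.
  by rewrite ler_piMr//; lra.
have ha : (h `^ a < 1)%R.
  have e1 : (1 `^ a = 1 :> R)%R by rewrite powR1.
  by rewrite -[ltRHS]e1 gt0_ltr_powR ?nnegrE// ltW.
have ha0 : (0 <= h `^ a)%R by exact: powR_ge0.
pose B : R := (A / (1 - h `^ a))%R.
have BE : (A + h `^ a * B = B)%R by rewrite /B; field; lra.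
pose D n := (`](h ^+ n)%R, 1%R])%classic.
have mD n : measurable (D n) by exact: measurable_itv.
have hn n : (0 < h ^+ n)%R by exact: exprn_gt0.
have hn1 n : (h ^+ n <= 1)%R by apply: exprn_ile1; exact: ltW.
have DB n : \int[leb]_(x in D n) g x <= B%:E.
  elim: n => [|n IH].
    rewrite /D expr0 set_itvoc0 integral_set0 lee_fin divr_ge0//; lra.
  rewrite /D (@integral_itv_split _ h)//; [|by rewrite exprS ler_piMr// ltW|exact: ltW].
  have -> : \int[leb]_(x in `](h ^+ n.+1)%R, h]) g x = (h `^ a)%:E * \int[leb]_(x in D n) g x.
    rewrite (@integral_scale_shift h 0)//; last by rewrite gt_eqF.
    rewrite gtr0_norm//.
    have -> : [set x : R | `](h ^+ n.+1)%R, h]%classic (h * x + 0)%R] = D n.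
      apply/seteqP; split => x /=; rewrite !in_itv/= addr0 exprS ltr_pM2l//;
      by rewrite ger_pMr.
    have -> : \int[leb]_(x in D n) g (h * x + 0)%R = \int[leb]_(x in D n) ((h `^ (a - 1))%:E * g x).
      apply: eq_integral => x; rewrite inE /D/= in_itv/= => /andP[hx _].
      by rewrite addr0 /g powRM ?EFinM// ltW// (lt_trans (hn n)).
    rewrite ge0_integralZl_EFin ?powR_ge0//; do ?[exact: (mD n)|exact: measurable_funTS].
    by rewrite muleA -EFinM mulr_powRB1// ltW.
  rewrite -BE addrC EFinD leeD// EFinM.
  by apply: lee_wpmul2l; rewrite ?lee_fin.
have Dnd : {homo D : n m / (n <= m)%N >-> (n <= m)%O}.
  move=> n m nm; apply/subsetPset => x; rewrite /D/= !in_itv/= => /andP[hx ->]; rewrite andbT.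
  by apply: le_lt_trans hx; apply: ler_wiXn2l => //; exact: ltW.
have DU : \bigcup_n D n = `]0%R, 1%R]%classic.
  apply/seteqP; split => x.
    by move=> [n _]; rewrite /D/= !in_itv/= => /andP[hx ->]; rewrite (lt_trans _ hx).
  rewrite /= in_itv/= => /andP[x0 x1].
  have : (h ^+ n)%R @[n --> \oo] --> (0 : R)%R by apply: cvg_expr; rewrite gtr0_norm.
  move/cvgrPdist_lt => /(_ x x0)[N _ HN]; exists N => //.
  have := HN N (leqnn N); rewrite /= sub0r normrN gtr0_norm// => hNx.
  by rewrite /D/= in_itv/= hNx x1.
have cv : \int[leb]_(x in D i) g x @[i --> \oo] --> \int[leb]_(x in \bigcup_i D i) g x.
  apply: ge0_nondecreasing_set_cvg_integral => // i.
  exact: measurable_funTS.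
move: cv; rewrite DU => cv; apply: (@le_lt_trans _ _ B%:E); last by rewrite ltry.
rewrite -(cvg_lim _ cv)//; apply: lime_le; first by apply/cvg_ex; eexists; exact: cv.
exact: nearW.
Qed.

End lebesgue_tools.

(** By scaling, the integral of [s^(q-1) G(X / s)] over [s > 0] is [k0 X^q] with
    a constant [k0], which is finite by the upper bound on [G] and positive by
    the lower bound.  Tonelli's theorem exchanges it with the integrals over
    [mu] and [nu]. *)
Lemma moment_le d (T : measurableType d) (R : realType) (X : T -> R)
    (mu nu : probability T R) (G : R -> R) (q C c L : R) :
  measurable_fun setT X -> (forall x, 0 <= X x) ->
  measurable_fun setT G -> (forall t, 0 <= G t) ->
  0 < q -> 0 <= C -> 0 < c -> 1 <= L ->
  (forall t, t <= 1 -> G t = 0) ->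
  (forall t, 0 < t -> G t <= C * t `^ (q / 2)) ->
  (forall t, L <= t -> c <= G t) ->
  (forall s, 0 < s -> (\int[nu]_x (G (X x / s))%:E <= \int[mu]_x (G (X x / s))%:E)%E) ->
  (\int[nu]_x (X x `^ q)%:E <= \int[mu]_x (X x `^ q)%:E)%E.
Proof.
move=> mX X0 mG G0 q0 C0 c0 L1 Gz GC Gc H.
pose leb := @lebesgue_measure R.
pose w (s Y : R) : R := if 0 < s then s `^ (q - 1) * G (Y / s) else 0.
have w0 s Y : 0 <= w s Y by rewrite /w; case: ifP => // _; rewrite mulr_ge0 ?powR_ge0.
have mw : measurable_fun setT (fun z : R * R => w z.1 z.2).
  apply: measurable_fun_ifT => //=.
    by apply: measurable_fun_ltr => //; exact: measurable_fst.
  apply: measurable_funM.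
    exact: (measurableT_comp (@measurable_powR R _) measurable_fst).
  apply: (measurableT_comp mG); apply: measurable_funM; first exact: measurable_snd.
  exact: (measurableT_comp (@measurable_invr R) measurable_fst).
have mw1 Y : measurable_fun setT (fun s => (w s Y)%:E).
  apply/measurable_EFinP.
  exact: (measurableT_comp mw (pair2_measurable Y)).
pose k0 := (\int[leb]_s (w s 1)%:E)%E.
have L0 : 0 < L by lra.
have wY Y : 0 <= Y -> (\int[leb]_s (w s Y)%:E = (Y `^ q)%:E * k0)%E.
  move=> Y0; have [->|Yn] := eqVneq Y 0.
    rewrite powR0 ?gt_eqF// mul0e; apply: integral0_eq => s _.
    by rewrite /w mul0r Gz// mulr0 if_same.
  have Yp : 0 < Y by rewrite lt_neqAle eq_sym Yn.
  rewrite (@integral_affine R Y 0 _ Yn (mw1 Y)); last by move=> s; rewrite lee_fin.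
  have -> : (\int[leb]_s (w (Y * s + 0)%R Y)%:E = \int[leb]_s ((Y `^ (q - 1))%:E * (w s 1)%:E))%E.
    apply: eq_integral => s _; rewrite -EFinM /w addr0 pmulr_rgt0//.
    case: ltP => s0; last by rewrite mulr0.
    rewrite powRM ?ltW// -mulrA; congr (_ * (_ * G _))%:E.
    by field; rewrite !gt_eqF.
  rewrite ge0_integralZl_EFin//; do ?[by move=> s _; rewrite lee_fin|exact: powR_ge0|exact: mw1].
  by rewrite muleA -EFinM gtr0_norm// mulr_powRB1.
have k0fin : (k0 < +oo)%E.
  suff H1 : (k0 <= C%:E * \int[leb]_(s in `]0%R, 1%R]) (s `^ (q / 2 - 1))%:E)%E.
    apply: (le_lt_trans H1); apply: lte_mul_pinfty => //.
    by apply: integral_powR_lty; exact: divr_gt0.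
  rewrite -ge0_integralZl_EFin//; last 2 first.
  - by move=> s _; rewrite lee_fin powR_ge0.
  - by apply/measurable_EFinP; apply: measurable_funTS; exact: measurable_powR.
  rewrite [leRHS]integral_mkcond epatch_indic; apply: ge0_le_integral => //.
  - by move=> s _; rewrite lee_fin.
  - exact: mw1.
  - apply: emeasurable_funM.
      by apply: measurable_funeM; apply/measurable_EFinP; exact: measurable_powR.
    by apply/measurable_EFinP; apply: measurable_indic; exact: measurable_itv.
  move=> s _ /=; rewrite indicE; case: (boolP (s \in _)).
    rewrite inE/= in_itv/= => /andP[s0 s1]; rewrite mule1 -EFinM lee_fin /w s0.
    apply: (@le_trans _ _ (s `^ (q - 1) * (C * (1 / s) `^ (q / 2)))).
      by rewrite ler_wpM2l ?powR_ge0// GC// divr_gt0.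
    rewrite mulrCA ler_wpM2l// div1r -powR_inv1; last exact: ltW.
    rewrite -powRrM -powRD; last by rewrite [s == 0]gt_eqF// implybT.
    by rewrite (_ : q - 1 + -1 * (q / 2) = q / 2 - 1)//; field.
  rewrite notin_setE/= in_itv/= => /negP; rewrite negb_and -leNgt -ltNge mule0 lee_fin /w.
  case: (ltP 0 s) => //= s0 s1; rewrite Gz ?mulr0//.
  by rewrite div1r invf_le1// ltW.
have k0pos : (0 < k0)%E.
  pose l := (2 * L)^-1.
  have l0 : 0 < l by rewrite invr_gt0 mulr_gt0.
  have lL : l < L^-1 by rewrite ltf_pV2 ?posrE ?mulr_gt0//; lra.
  pose m0 := l `^ q * L * c.
  have m00 : 0 < m0 by rewrite !mulr_gt0 ?powR_gt0.
  have H2 : (0 < \int[leb]_(s in `[l, L^-1%R]) m0%:E)%E.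
    rewrite integral_cst//= lebesgue_measure_itv/= lte_fin lL -EFinB -EFinM lte_fin.
    by rewrite mulr_gt0// subr_gt0.
  suff H1 : (\int[leb]_(s in `[l, L^-1%R]) m0%:E <= \int[leb]_(s in `[l, L^-1%R]) (w s 1)%:E)%E.
    apply: (lt_le_trans H2); apply: (le_trans H1).
    by apply: ge0_subset_integral => //; [exact: mw1|move=> s _; rewrite lee_fin].
  apply: ge0_le_integral => //.
  - by move=> s _; rewrite lee_fin ltW.
  - by apply: measurable_funTS; exact: mw1.
  move=> s /=; rewrite in_itv/= => /andP[ls sL].
  have s0 : 0 < s by apply: lt_le_trans ls.
  have Ls : L <= s^-1 by rewrite -[L]invrK lef_pV2 ?posrE// invr_gt0.
  rewrite lee_fin /w s0 div1r; apply: ler_pM; rewrite ?(ltW c0) ?Gc//.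
    by rewrite mulr_ge0 ?powR_ge0// ltW.
  have -> : s `^ (q - 1) = s `^ q * s^-1.
    by rewrite -(mulr_powRB1 (ltW s0) q0) mulrAC divff ?mul1r// gt_eqF.
  apply: ler_pM => //; rewrite ?powR_ge0 ?(ltW L0)//.
  by rewrite ge0_ler_powR ?nnegrE ?(ltW q0) ?(ltW l0) ?(ltW s0).
have mwX : measurable_fun setT (fun z : T * R => (w z.2 (X z.1))%:E).
  apply/measurable_EFinP.
  apply: (@measurableT_comp _ _ _ _ _ _ (fun z : R * R => w z.1 z.2) _ (fun z : T * R => (z.2, X z.1))) => //.
  apply: measurable_fun_pair; first exact: measurable_snd.
  exact: (measurableT_comp mX measurable_fst).
have wX0 z : (0 <= (w z.2 (X z.1))%:E)%E by rewrite lee_fin.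
have mXq : measurable_fun setT (fun x => (X x `^ q)%:E).
  by apply/measurable_EFinP; exact: (measurableT_comp (@measurable_powR R q) mX).
have E (P : probability T R) : ((\int[P]_x (X x `^ q)%:E) * k0 = \int[leb]_s \int[P]_x (w s (X x))%:E)%E.
  rewrite -ge0_integralZr//; [|by move=> x _; rewrite lee_fin powR_ge0|exact: ltW].
  under eq_integral do rewrite -wY//.
  exact: (@fubini_tonelli _ _ _ _ _ P leb (fun z : T * R => (w z.2 (X z.1))%:E)).
have k0f : k0 \is a fin_num by rewrite ge0_fin_numE// ltW.
rewrite -(@lee_pmul2r _ k0)// !E; apply: ge0_le_integral => //.
- by move=> s _; apply: integral_ge0 => x _; rewrite lee_fin.
- exact: (@measurable_fun_fubini_tonelli_G _ _ _ _ _ nu (fun z : T * R => (w z.2 (X z.1))%:E)).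
- exact: (@measurable_fun_fubini_tonelli_G _ _ _ _ _ mu (fun z : T * R => (w z.2 (X z.1))%:E)).
move=> s _; rewrite /w; case: ltP => s0; last by rewrite !integral0.
have mGX (P : probability T R) : (\int[P]_x (s `^ (q - 1) * G (X x / s))%:E = (s `^ (q - 1))%:E * \int[P]_x (G (X x / s))%:E)%E.
  rewrite -ge0_integralZl_EFin ?powR_ge0//; first by move=> x _; rewrite lee_fin.
  apply/measurable_EFinP; apply: (measurableT_comp mG).
  by apply: measurable_funM.
by rewrite !mGX; apply: lee_wpmul2l; rewrite ?lee_fin ?powR_ge0// H.
Qed.

(** * From potentials to moments *)

Section measurable_into_rV.
Context d (T : measurableType d) (R : realType) (n : nat).

(** Every open set is a countable union of cubes with rational centres and
    radii [1 / (k + 1)]. *)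
Lemma measurable_fun_rV (f : T -> 'rV[R]_n) :
  (forall i, measurable_fun setT (fun x => f x 0 i)) ->
  measurable_fun setT (f : T -> borelRn R n).
Proof.
move=> mf; apply: (@measurability _ _ T (borelRn R n) setT f (@open 'rV[R]_n)) => //.
move=> _ [U oU <-]; rewrite setTI.
pose box (p : 'rV[rat]_n * nat) : set 'rV[R]_n :=
  [set y | forall i, `|y 0 i - ratr (p.1 0 i)| < p.2.+1%:R^-1].
pose V (p : 'rV[rat]_n * nat) : set T :=
  if pselect (box p `<=` U) then f @^-1` box p else set0.
have -> : f @^-1` U = \bigcup_p V p.
  apply/seteqP; split => [x Ux|x [p _]]; last first.
    by rewrite /V; case: pselect => // pU /pU.
  have : nbhs (f x) U by exact: open_nbhs_nbhs.
  rewrite -nbhs_ballE => -[e /= e0 eU].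
  pose k := Num.truncn (2 / e).
  have [w [w0 we wE]] : exists w : R, [/\ 0 < w, 2 * w < e & w = k.+1%:R^-1].
    exists (k.+1%:R^-1); split => //.
    by rewrite ltr_pdivrMr// mulrC -ltr_pdivrMr//; exact: truncnS_gt.
  have /choice [p Hp] : forall i, exists p : rat, `|f x 0 i - ratr p| < w.
    move=> i; have lt : f x 0 i - w < f x 0 i + w by lra.
    have [p] := rat_in_itvoo lt; rewrite in_itv/= => /andP[p1 p2].
    by exists p; rewrite ltr_norml; apply/andP; split; lra.
  exists (\row_i p i, k) => //; rewrite /V; case: pselect => /=; last first.
    case=> y yb; apply: eU; split => // i j; rewrite ord1 /ball /=.
    have := yb j; rewrite !mxE/= -wE => y1; have y2 := Hp j.
    have -> : f x 0 j - y 0 j = (f x 0 j - ratr (p j)) - (y 0 j - ratr (p j)) by lra.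
    by apply: le_lt_trans (ler_normB _ _) _; lra.
  by move=> _ i; rewrite !mxE/= -wE; exact: Hp.
apply: countable_bigcupT_measurable => [|p]; first exact: countableP.
rewrite /V; case: pselect => [pU|npU] /=; last exact: measurable0.
have -> : f @^-1` box p = \bigcap_(i in [set: 'I_n]) [set x | `|f x 0 i - ratr (p.1 0 i)| < p.2.+1%:R^-1].
  by apply/seteqP; split => [x H i _|x H i]; exact: H.
apply: fin_bigcap_measurable => // i _; rewrite -[X in measurable X]setTI.
apply: measurable_fun_ltr => //; apply: measurableT_comp => //.
exact: measurable_funB.
Qed.
End measurable_into_rV.

Lemma exists_weighted_image d1 d2 (X : measurableType d1) (Y : measurableType d2)
    (R : realType) (m : {measure set X -> \bar R}) (f : X -> Y) (h : X -> R) :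
  measurable_fun setT f -> measurable_fun setT h -> (forall x, 0 <= h x) ->
  (\int[m]_x (h x)%:E < +oo)%E ->
  exists tau : {finite_measure set Y -> \bar R},
  forall g : Y -> \bar R, measurable_fun setT g -> (forall y, (0 <= g y)%E) ->
    (\int[tau]_y g y = \int[m]_x (g (f x) * (h x)%:E))%E.
Proof.
move=> mf mh h0 hoo.
have [m1 [m1E m1int]] := exists_density m mh h0.
pose pm0 := [the measure _ _ of pushforward m1 f]; pose pm := pm0 mf.
have pT : (pm setT < +oo)%E.
  by rewrite /pm /pm0 /= /pushforward preimage_setT m1E.
have [tau [tauE tauint]] := finite_of_measure pT.
exists tau => g mg g0; rewrite tauint ge0_integral_pushforward// preimage_setT m1int//.
  exact: measurableT_comp.
by move=> x; exact: g0.
Qed.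

Section comparison.
Context (R : realType) (n : nat) (phi : R -> \bar R).
Hypothesis adm : admissible n phi.
Hypothesis n0 : (0 < n)%N.
Let T := borelRn R n.
Local Open Scope ereal_scope.
Notation dk := (@dkernel R n phi).

Lemma integral_carrier (P : probability T R) (K : set T) (f : T -> \bar R) :
  measurable K -> P K = 1 -> measurable_fun setT f -> (forall x, 0 <= f x) ->
  \int[P]_(x in K) f x = \int[P]_x f x.
Proof.
move=> mK PK mf f0; rewrite [RHS](@ge0_negligible_integral _ _ _ P setT (~` K)) ?setTD ?setCK//.
- exact: measurableC.
- by rewrite [LHS]probability_setC// PK subee.
Qed.

Variables (mu nu : probability T R) (K B : set T) (R0 : R).
Hypotheses (mK : measurable K) (mB : measurable B).
Hypotheses (muK : mu K = 1) (nuB : nu B = 1).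
Hypothesis KR : forall x : 'rV[R]_n, K x -> (enorm x <= R0)%R.
Hypothesis minmu : forall P : probability T R, P K = 1 -> mutual dk mu mu <= mutual dk P P.
Hypothesis minnu : forall P : probability T R, P B = 1 -> mutual dk nu nu <= mutual dk P P.
Hypothesis muoo : mutual dk mu mu < +oo.
Hypothesis munu : mutual dk mu mu = mutual dk nu nu.

(** Both sides are compared with the common energy times the mass of [tau]. *)
Lemma mutual_comparison (tau : {finite_measure set T -> \bar R}) (Bd : R) :
  tau (~` B) = 0 -> (0 <= Bd)%R -> (forall x, (K `|` B) x -> pot dk tau x <= Bd%:E) ->
  mutual dk mu tau <= mutual dk nu tau.
Proof.
move=> tauB Bd0 tauBd.
have mk := measurable_dkernel adm; have k0 := dkernel_ge0 adm; have ks := @dkernelC R n phi.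
apply: (@le_trans _ _ (mutual dk mu mu * tau setT)).
  apply: (equilibrium_potential_le adm n0 mK muK KR minmu muoo Bd0).
  by move=> x Kx; apply: tauBd; left.
rewrite munu; apply: (variational mk k0 ks mB) => //; first by rewrite -munu.
apply: (@le_lt_trans _ _ (Bd%:E * tau setT)); last first.
  by apply: lte_mul_pinfty => //; rewrite ltey_eq fin_num_measure.
rewrite -integral_cst//; apply: ae_ge0_le_integral => //.
- by move=> x _; exact: pot_ge0.
- exact: measurable_pot.
- exists (~` B); split; [exact: measurableC|exact: tauB|].
  by move=> x /= H Bx; apply: H => _; apply: tauBd; right.
Qed.

(** Integrating [g + pot tau = C] turns the inequality between mutual energies
    into the reverse inequality between the integrals of [g]. *)
Lemma gap_comparison (tau : {finite_measure set T -> \bar R}) (C : R) (g : T -> R) :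
  tau (~` B) = 0 -> (0 <= C)%R -> measurable_fun setT g -> (forall x, 0 <= g x)%R ->
  (forall x, (K `|` B) x -> (g x)%:E + pot dk tau x = C%:E) ->
  \int[nu]_x (g x)%:E <= \int[mu]_x (g x)%:E.
Proof.
move=> tauB C0 mg g0 gC.
have mk := measurable_dkernel adm; have k0 := dkernel_ge0 adm.
have le : mutual dk mu tau <= mutual dk nu tau.
  apply: (mutual_comparison tauB C0) => x KBx; rewrite -(gC x KBx) leeDr// lee_fin.
  exact: g0.
have E (P : probability T R) (A : set T) : measurable A -> P A = 1 -> A `<=` K `|` B ->
    \int[P]_x (g x)%:E + mutual dk P tau = C%:E.
  move=> mA PA AKB.
  have meg : measurable_fun setT (EFin \o g) by exact/measurable_EFinP.
  have eg0 x : 0 <= (EFin \o g) x by rewrite lee_fin.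
  rewrite -[X in X + _](@integral_carrier P A (EFin \o g))//.
  rewrite /mutual -(@integral_carrier P A)//; [|exact: measurable_pot|exact: pot_ge0].
  rewrite -ge0_integralD//.
  - transitivity (\int[P]_(x in A) (cst C%:E) x); last first.
      by rewrite integral_cst//= -[RHS]mule1; congr (_ * _); exact: PA.
    by apply: eq_integral => x; rewrite inE => /AKB /gC.
  - exact: measurable_funTS.
  - by move=> x _; exact: pot_ge0.
  - by apply: measurable_funTS; exact: measurable_pot.
have Emu := E mu K mK muK (@subsetUl _ _ _).
have Enu := E nu B mB nuB (@subsetUr _ _ _).
have fin1 (a b : \bar R) : 0 <= a -> 0 <= b -> a + b = C%:E -> a \is a fin_num /\ b \is a fin_num.
  by case: a => [a| |] //; case: b => [b| |].
have gp (P : probability T R) : 0 <= \int[P]_x (g x)%:E.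
  by apply: integral_ge0 => x _; rewrite lee_fin.
have [f1 f2] := fin1 _ _ (gp mu) (mutual_ge0 k0 _ _) Emu.
have [f3 f4] := fin1 _ _ (gp nu) (mutual_ge0 k0 _ _) Enu.
move: le Emu Enu; rewrite -(fineK f1) -(fineK f2) -(fineK f3) -(fineK f4) -!EFinD !lee_fin.
by move=> le [Emu] [Enu]; lra.
Qed.

(** At the scales [s <= r] the integrals of [G(|x| / s)] are compared by
    [gap_comparison]; at the scales [s > r] the left-hand one is zero. *)
Lemma moment_comparison (G : R -> R) (q C c L r : R) :
  measurable_fun setT G -> (forall t, 0 <= G t)%R ->
  (0 < q)%R -> (0 <= C)%R -> (0 < c)%R -> (1 <= L)%R ->
  (forall t, t <= 1 -> G t = 0)%R ->
  (forall t, 0 < t -> G t <= C * t `^ (q / 2))%R ->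
  (forall t, L <= t -> c <= G t)%R ->
  (forall x : 'rV[R]_n, B x -> (enorm x <= r)%R) ->
  (forall s : R, (0 < s)%R -> (s <= r)%R ->
     exists (tau : {finite_measure set T -> \bar R}) (a C' : R),
     [/\ tau (~` B) = 0, (0 < a)%R, (0 <= C')%R &
       forall x : 'rV[R]_n, (K `|` B) x ->
         (a * G (enorm x / s))%:E + pot dk tau x = C'%:E]) ->
  \int[nu]_(x in B) (enorm (x : 'rV[R]_n) `^ q)%:E <= \int[mu]_(x in K) (enorm (x : 'rV[R]_n) `^ q)%:E.
Proof.
move=> mG G0 q0 C0 c0 L1 Gz GC Gc Br fam.
have mn := @measurable_enorm R n.
have mq : measurable_fun setT (fun x : T => (enorm (x : 'rV[R]_n) `^ q)%:E).
  by apply/measurable_EFinP; exact: (measurableT_comp (@measurable_powR R q) mn).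
have q00 (x : T) : 0 <= (enorm (x : 'rV[R]_n) `^ q)%:E by rewrite lee_fin powR_ge0.
rewrite (integral_carrier mB nuB mq q00) (integral_carrier mK muK mq q00).
apply: (@moment_le _ T R (fun x : T => enorm (x : 'rV[R]_n)) mu nu G q C c L) => //.
  by move=> x; exact: enorm_ge0.
move=> s s0.
have mGs : measurable_fun setT (fun x : T => G (enorm (x : 'rV[R]_n) / s)%R).
  by apply: (measurableT_comp mG); apply: measurable_funM.
have [sr|rs] := leP s r.
  have [tau [a [C' [tauB a0 C'0 H]]]] := fam s s0 sr.
  have := @gap_comparison tau C' (fun x : T => a * G (enorm (x : 'rV[R]_n) / s))%R tauB C'0.
  move=> gap; have {}gap := gap _ _ H; move: gap.
  have Z (P : probability T R) : \int[P]_x (a * G (enorm (x : 'rV[R]_n) / s))%:E =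
      a%:E * \int[P]_x (G (enorm (x : 'rV[R]_n) / s))%:E.
    rewrite -ge0_integralZl_EFin ?(ltW a0)//; first by move=> x _; rewrite lee_fin.
    exact/measurable_EFinP.
  rewrite !Z lee_pmul2l//; apply => //; first exact: measurable_funM.
  by move=> x; rewrite mulr_ge0// ltW.
have meG : measurable_fun setT (fun x : T => (G (enorm (x : 'rV[R]_n) / s))%:E).
  exact/measurable_EFinP.
have eG0 (x : T) : 0 <= (G (enorm (x : 'rV[R]_n) / s))%:E by rewrite lee_fin.
rewrite -(@integral_carrier nu B _ mB nuB meG eG0) integral0_eq; first exact: integral_ge0.
move=> x Bx; rewrite Gz//= ler_pdivrMr// mul1r.
by apply: le_trans (Br _ Bx) _; exact: ltW.
Qed.

End comparison.

(** * The arcsine measures of an interval *)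

Section trigo_facts.
Context (R : realType).
Implicit Types x y : R.

Lemma cosB_prod x y : cos x - cos y = 2 * (sin ((y + x) / 2) * sin ((y - x) / 2)).
Proof.
have e1 : cos x = cos ((y + x) / 2 - (y - x) / 2) by congr cos; field.
have e2 : cos y = cos ((y + x) / 2 + (y - x) / 2) by congr cos; field.
by rewrite e1 e2 cosB cosD; ring.
Qed.

Lemma cos_half x : 1 - cos x = 2 * sin (x / 2) ^+ 2.
Proof. by have := cosB_prod 0 x; rewrite cos0 addr0 subr0 => ->; rewrite expr2. Qed.

Lemma cos_lt1 x : 0 < x < 2 * pi -> cos x < 1.
Proof.
move=> /andP[x0 x2]; rewrite -subr_gt0 cos_half.
by rewrite mulr_gt0// exprn_gt0// sin_gt0_pi//; apply/andP; split; lra.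
Qed.

Lemma measurable_sin : measurable_fun setT (@sin R).
Proof. by apply: continuous_measurable_fun; exact: continuous_sin. Qed.

Lemma measurable_cos : measurable_fun setT (@cos R).
Proof. by apply: continuous_measurable_fun; exact: continuous_cos. Qed.

(** Up to [1] the mean value theorem gives a slope of at least [cos 1];
    beyond, the sine increases and [pi / 2 <= 2]. *)
Lemma sin_lower x : 0 <= x <= pi / 2 -> cos 1 / 2 * x <= sin x.
Proof.
have c1 := @cos1_gt0 R; have p2 := pi_ge2 R.
have le1 (y : R) : 0 <= y -> y <= 1 -> cos 1 * y <= sin y.
  move=> y0 y1.
  have [c cy] : exists2 c, c \in `[0, y] & sin y - sin 0 = cos c * (y - 0).
    apply: (MVT_segment y0 (fun z _ => is_derive_sin z)).
    by apply: continuous_subspaceT; exact: continuous_sin.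
  rewrite sin0 !subr0 => ->; rewrite ler_wpM2r//.
  move: cy; rewrite in_itv/= => /andP[c0 cy].
  have in1 : (1 : R) \in `[0, pi] by rewrite in_itv/= ler01/=; lra.
  have inc : c \in `[0, pi] by rewrite in_itv/= c0/=; lra.
  by rewrite leNgt ltr_cos// -leNgt; exact: le_trans cy y1.
move=> /andP[x0 x2]; have [x1|x1] := leP x 1.
  by apply: le_trans (le1 _ x0 x1); rewrite ler_wpM2r//; lra.
have pihalf2 : pi / 2 <= 2 :> R by have [/andP[_ ->]] := pihalf_02_cos_pihalf R.
have s1 := le1 1 ler01 (lexx 1).
apply: (@le_trans _ _ (sin 1)).
  apply: le_trans s1; rewrite mulr1.
  have : cos 1 * x <= cos 1 * 2 by rewrite ler_pM2l//; lra.
  lra.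
have in1 : (1 : R) \in `[- (pi / 2), pi / 2] by rewrite in_itv/=; apply/andP; split; lra.
have inx : x \in `[- (pi / 2), pi / 2] by rewrite in_itv/=; apply/andP; split; lra.
by rewrite leNgt ltr_sin// -leNgt; exact: ltW.
Qed.

End trigo_facts.

Section logsin.
Context (R : realType).
Notation leb := (@lebesgue_measure R).

Definition logsin (u : R) : \bar R := logpot 0 `|sin (u / 2)|.

Lemma logsin_ge0 u : (0 <= logsin u)%E.
Proof. exact: (adm_ge0 (admissible_logpot 0)). Qed.

Lemma measurable_logsin : measurable_fun setT logsin.
Proof.
apply: (measurableT_comp (adm_meas (admissible_logpot 0))).
apply: measurableT_comp => //.
by apply: (measurableT_comp (@measurable_sin R)); apply: measurable_funM.
Qed.

Lemma logsin_period u : logsin (u + 2 * pi) = logsin u.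
Proof.
rewrite /logsin; have -> : (u + 2 * pi) / 2 = u / 2 + pi by field.
by rewrite sinDpi normrN.
Qed.

Lemma neg_ln_le (w : R) : 0 < w -> - ln w <= 2 * w `^ (2^-1 - 1).
Proof.
move=> w0; have := @ln_sublinear R _ (powR_gt0 (2^-1 - 1) w0).
by rewrite ln_powR; set l := ln w; set p := _ `^ _; lra.
Qed.

Lemma scale_quotient (a c u : R) : c != 0 -> a * c * (u / (2 * c)) = a * (u / 2).
Proof. by move=> c0; field. Qed.

(** Near zero, [- ln sin(u / 2)] is bounded by a constant plus a multiple of
    [u^(-1/2)]; the other endpoint is symmetric. *)
Lemma integral_logsin_lty : (\int[leb]_(u in `]0%R, (2 * pi)%R]) logsin u < +oo)%E.
Proof.
have p0 : 0 < pi :> R by exact: pi_gt0.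
pose P : R := 2 * pi; have P0 : 0 < P by rewrite mulr_gt0.
have c1 := @cos1_gt0 R.
pose kp : R := cos 1 / 2 * pi; have kp0 : 0 < kp by rewrite mulr_gt0// divr_gt0.
pose K : R := `|ln kp|; have K0 : 0 <= K by exact: normr_ge0.
pose b (w : R) : R := K + 2 * w `^ (2^-1 - 1).
have b0 w : 0 <= b w by rewrite addr_ge0// mulr_ge0// powR_ge0.
pose g (v : R) : R := if (0 < v) && (v <= P) then b (v / P) else 0.
have g0 v : 0 <= g v by rewrite /g; case: ifP.
have mb : measurable_fun setT b.
  have mp := @measurable_powR R (2^-1 - 1).
  apply: measurable_funD; first exact: measurable_cst.
  by apply: measurable_funM; [exact: measurable_cst|exact: mp].
have mg : measurable_fun setT g.
  have mlt : measurable_fun setT (fun v : R => 0 < v) by apply: measurable_fun_ltr => //.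
  have mle : measurable_fun setT (fun v : R => v <= P) by apply: measurable_fun_ler => //.
  have mdiv : measurable_fun setT (fun v : R => v / P) by apply: measurable_funM => //.
  apply: measurable_fun_ifT => //; first exact: (measurable_and mlt mle).
  exact: (measurableT_comp mb mdiv).
have meg : measurable_fun setT (EFin \o g) by exact/measurable_EFinP.
have near0 (u : R) : 0 < u -> u <= pi -> (logsin u <= (g u)%:E)%E.
  move=> u0 up.
  have sp : 0 < sin (u / 2) by rewrite sin_gt0_pi//; apply/andP; split; lra.
  have uP : u <= P by rewrite /P; lra.
  rewrite /logsin gtr0_norm// logpotE// lee_fin /g u0 uP/= sub0r ge_max b0/=.
  have uP0 : 0 < u / P by rewrite divr_gt0.
  have low : kp * (u / P) <= sin (u / 2).
    have -> : kp * (u / P) = cos 1 / 2 * (u / 2) 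
      by rewrite /kp /P scale_quotient// gt_eqF.
    by apply: sin_lower; apply/andP; split; lra.
  have : ln (kp * (u / P)) <= ln (sin (u / 2)) by rewrite ler_ln ?posrE// mulr_gt0.
  rewrite lnM ?posrE//.
  have := neg_ln_le uP0; have := ler_norm (- ln kp); rewrite normrN /b -/K.
  by set l1 := ln kp; set l2 := ln (u / P); set l3 := ln (sin _); lra.
have even u : logsin (P - u) = logsin u.
  rewrite /logsin; have -> : (P - u) / 2 = - (u / 2) + pi by rewrite /P; field.
  by rewrite sinDpi sinN opprK.
have bound (u : R) : 0 < u -> u < P -> (logsin u <= (g u)%:E + (g (P - u))%:E)%E.
  move=> u0 uP; have [up|pu] := leP u pi.
    by apply: (le_trans (near0 _ u0 up)); rewrite leeDl// lee_fin.
  rewrite -even; apply: (@le_trans _ _ (g (P - u))%:E).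
    by apply: near0; rewrite /P in uP *; lra.
  by rewrite leeDr// lee_fin.
have intg : (\int[leb]_x (g x)%:E < +oo)%E.
  rewrite (@integral_affine R P 0) ?gt_eqF//.
  have -> : (\int[leb]_x (g (P * x + 0)%R)%:E = \int[leb]_(x in `]0%R, 1%R]) (b x)%:E)%E.
    rewrite [RHS]integral_mkcond; apply: eq_integral => x _.
    rewrite /patch addr0 /g pmulr_rgt0// -{2}(mulr1 P) ler_pM2l//.
    rewrite (mulrC P) mulfK ?gt_eqF//.
    case: ifPn => h; case: ifPn => //; rewrite ?inE/= ?in_itv/= ?h//.
      by move/negP; rewrite inE/= in_itv/= h.
    by rewrite (negPf h).
  apply: lte_mul_pinfty => //.
  rewrite /b; under eq_integral do rewrite EFinD EFinM.
  rewrite ge0_integralD//.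
  - rewrite integral_cst//= lebesgue_measure_itv/= lte01 oppr0 adde0 mule1.
    rewrite ge0_integralZl_EFin//.
    + apply: lte_add_pinfty; first by rewrite ltry.
      apply: lte_mul_pinfty => //; by apply: integral_powR_lty; rewrite invr_gt0.
    + by move=> x _; rewrite lee_fin powR_ge0.
    + by apply: measurable_funTS; apply/measurable_EFinP; exact: measurable_powR.
  - by move=> x _; rewrite mule_ge0// lee_fin powR_ge0.
  - by apply: measurable_funTS; apply: measurable_funeM; apply/measurable_EFinP; exact: measurable_powR.
have mg' : measurable_fun setT (fun x : R => (g (P - x))%:E).
  have mPx : measurable_fun setT (fun x : R => P - x).
    by apply: measurable_funB; [exact: measurable_cst|exact: measurable_id].
  by apply/measurable_EFinP; exact: (measurableT_comp mg mPx).
have intg' : (\int[leb]_x (g (P - x)%R)%:E < +oo)%E.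
  have N1 : -1 != 0 :> R by rewrite oppr_eq0 oner_eq0.
  have gE0 x : (0 <= (EFin \o g) x)%E by rewrite lee_fin.
  have := @integral_affine R (-1) P (EFin \o g) N1 meg gE0.
  rewrite normrN1 mul1e => ig.
  suff -> : (\int[leb]_x (g (P - x)%R)%:E = \int[leb]_x (g x)%:E)%E by [].
  by rewrite [RHS]ig; apply: eq_integral => x _; rewrite /= mulN1r addrC.
have ml := measurable_logsin.
have mgg : measurable_fun setT (fun x : R => (g x)%:E + (g (P - x)%R)%:E)%E.
  exact: emeasurable_funD.
rewrite -integral_itv_bndo_bndc; last exact: measurable_funTS.
apply: (@le_lt_trans _ _ (\int[leb]_(x in `]0%R, P[) ((g x)%:E + (g (P - x))%:E))%E).
  apply: ge0_le_integral => //.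
  - by move=> x _; exact: logsin_ge0.
  - exact: measurable_funTS.
  - exact: measurable_funTS.
  - by move=> x /=; rewrite in_itv/= => /andP[x0 xP]; exact: bound.
apply: (@le_lt_trans _ _ (\int[leb]_x ((g x)%:E + (g (P - x))%:E))%E).
  apply: ge0_subset_integral => // x _.
  by rewrite adde_ge0// lee_fin.
rewrite ge0_integralD//; do ?[by move=> x _; rewrite lee_fin].
exact: (lte_add_pinfty intg intg').
Qed.

End logsin.

Section line.
Context (R : realType).

Lemma line_coord0 (x : R) : line_to_plane x 0 ord0 = x.
Proof.
have -> : ord0 = lshift 1 ord0 :> 'I_(1 + 1) by apply/val_inj.
by transitivity ((const_mx x : 'rV[R]_1) 0 ord0); [exact: row_mxEl|rewrite mxE].
Qed.

Lemma line_coord1 (x : R) : line_to_plane x 0 ord_max = 0.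
Proof.
have -> : ord_max = rshift 1 ord0 :> 'I_(1 + 1) by apply/val_inj.
by transitivity ((0 : 'rV[R]_1) 0 ord0); [exact: row_mxEr|rewrite mxE].
Qed.

Lemma ord2P (i : 'I_2) : i = ord0 \/ i = ord_max.
Proof. by case: i => -[|[|//]] p; [left|right]; apply/val_inj. Qed.

Lemma lineB (x y : R) : line_to_plane x - line_to_plane y = line_to_plane (x - y).
Proof.
apply/rowP => i; rewrite mxE [X in _ + X]mxE.
have [->|->] := ord2P i; first by rewrite !line_coord0.
by rewrite !line_coord1 subrr.
Qed.

Lemma enorm_line (x : R) : enorm (line_to_plane x) = `|x|.
Proof.
rewrite /enorm !big_ord_recr big_ord0 /= add0r line_coord1.
have -> : widen_ord (leqnSn 1) ord_max = ord0 by apply/val_inj.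
by rewrite line_coord0 expr0n addr0 sqrtr_sqr.
Qed.

Lemma measurable_line d (T : measurableType d) (f : T -> R) :
  measurable_fun setT f -> measurable_fun setT (fun x => line_to_plane (f x) : borelRn R 2).
Proof.
move=> mf; apply: measurable_fun_rV => i.
have [->|->] := ord2P i.
- by under eq_fun do rewrite line_coord0.
- by under eq_fun do rewrite line_coord1; exact: measurable_cst.
Qed.
End line.

Section arcsine_potential.
Context (R : realType).
Notation leb := (@lebesgue_measure R).
Variable L : R.

(** The potential at [t] of the projection to a diameter of the uniform measure
    of the circle of radius [s]. *)
Definition arcsine_pot (s t : R) : \bar R :=
  (\int[leb]_(u in `]0%R, (2 * pi)%R]) logpot L `|t - s * cos u|%R)%E.

Let p0 : 0 < 2 * pi :> R. Proof. by rewrite mulr_gt0// pi_gt0. Qed.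

Lemma measurable_arcsine_kernel (s t : R) :
  measurable_fun setT (fun u => logpot L `|t - s * cos u|).
Proof.
apply: (measurableT_comp (adm_meas (admissible_logpot L))).
apply: measurableT_comp => //; apply: measurable_funB => //.
by apply: measurable_funM => //; exact: measurable_cos.
Qed.

Lemma logpot_ge0 t : (0 <= logpot L t)%E.
Proof. exact: (adm_ge0 (admissible_logpot L)). Qed.

(** [cos f - cos u] is twice the product of the sines of [(u + f) / 2] and
    [(u - f) / 2], and the logarithm separates the factors. *)
Lemma logpot_cosB (s f u : R) : 0 < s -> 2 * s <= expR L ->
  logpot L `|s * cos f - s * cos u| =
    ((L - ln (2 * s))%:E + (logsin (u + f) + logsin (u - f)))%E.
Proof.
move=> s0 sL; have s20 : 0 < 2 * s by rewrite mulr_gt0.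
rewrite -mulrBr cosB_prod mulrCA !normrM gtr0_norm// (gtr0_norm s0) mulrA.
rewrite /logsin; set A := sin _; set B := sin _.
have nny x : (0 <= x -> x != -oo :> \bar R)%E by case: x.
have ge00 t : (0 <= @logpot R 0 t)%E by exact: (adm_ge0 (admissible_logpot 0)).
have [->|A0] := eqVneq A 0.
  by rewrite normr0 mul0r mulr0 /logpot lexx addye ?addey// nny// ge00.
have [->|B0] := eqVneq B 0.
  by rewrite normr0 mulr0 mulr0 {1 3}/logpot lexx addey ?addey// nny// ge00.
have nA : 0 < `|A| by rewrite normr_gt0.
have nB : 0 < `|B| by rewrite normr_gt0.
rewrite !logpotE// ?mulr_gt0//.
have lA : ln `|A| <= 0 by apply: ln_le0; exact: sin_max.
have lB : ln `|B| <= 0 by apply: ln_le0; exact: sin_max.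
have lL : ln (2 * s) <= L by rewrite -(expRK L) ler_ln ?posrE// expR_gt0.
have lnAB : ln (2 * s * (`|A| * `|B|)) = ln (2 * s) + (ln `|A| + ln `|B|).
  have pA : `|A| \in Num.pos by rewrite posrE.
  have pB : `|B| \in Num.pos by rewrite posrE.
  have pAB : `|A| * `|B| \in Num.pos by rewrite posrE mulr_gt0.
  have ps : 2 * s \in Num.pos by rewrite posrE.
  by rewrite (lnM ps pAB) (lnM pA pB).
rewrite lnAB -!EFinD; congr EFin.
by rewrite !max_r; lra.
Qed.

(** With [t = s cos f], both translates of the periodic function [logsin] have
    the same integral over a period, so that [f] disappears. *)
Lemma arcsine_pot_inside (s t : R) : 0 < s -> 2 * s <= expR L -> `|t| <= s ->
  arcsine_pot s t = ((2 * pi * (L - ln (2 * s)))%:E +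
    (\int[leb]_(u in `]0%R, (2 * pi)%R]) logsin u + \int[leb]_(u in `]0%R, (2 * pi)%R]) logsin u))%E.
Proof.
move=> s0 sL ts.
have ts1 : -1 <= t / s <= 1.
  by rewrite -ler_norml normrM normfV (gtr0_norm s0) ler_pdivrMr// mul1r.
have [f [f0 fpi tE]] : exists f, [/\ 0 <= f, f <= pi & t = s * cos f].
  have [/andP[f0 fpi] cf] := acos_def ts1; exists (acos (t / s)); split => //.
  by rewrite cf mulrCA divff ?mulr1// gt_eqF.
have key u : logpot L `|t - s * cos u| =
    ((L - ln (2 * s))%:E + (logsin (u + f) + logsin (u - f)))%E.
  by rewrite tE logpot_cosB.
have lL : ln (2 * s) <= L by rewrite -(expRK L) ler_ln ?posrE ?expR_gt0 ?mulr_gt0.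
have ml (c : R) : measurable_fun setT (fun u : R => logsin (u + c)).
  by apply: (measurableT_comp (@measurable_logsin R)); apply: measurable_funD.
rewrite /arcsine_pot; under eq_integral do rewrite key.
rewrite ge0_integralD//; last 3 first.
- by move=> u _; rewrite lee_fin subr_ge0.
- by move=> u _; rewrite adde_ge0 ?logsin_ge0.
- by apply: measurable_funTS; apply: emeasurable_funD; exact: ml.
congr (_ + _)%E.
  by rewrite integral_cst//= lebesgue_measure_itv/= lte_fin p0 oppr0 adde0 -EFinM mulrC.
rewrite ge0_integralD//; last 4 first.
- by move=> u _; exact: logsin_ge0.
- by apply: measurable_funTS; exact: ml.
- by move=> u _; exact: logsin_ge0.
- by apply: measurable_funTS; exact: ml.
have shift (c : R) : `|c| <= 2 * pi -> (\int[leb]_(u in `]0%R, (2 * pi)%R]) logsin (u + c) =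
    \int[leb]_(u in `]0%R, (2 * pi)%R]) logsin u)%E.
  move=> cp; apply: integral_period_shift => //; [exact: measurable_logsin|exact: logsin_ge0|exact: logsin_period].
have pp := pi_gt0 R.
by rewrite !shift// ?normrN ger0_norm//; lra.
Qed.

Lemma arcsine_potN (s t : R) : arcsine_pot s (- t) = arcsine_pot s t.
Proof.
rewrite /arcsine_pot; pose F u := logpot L `|t - s * cos u|.
have pp := pi_gt0 R.
rewrite -[RHS](@integral_period_shift R (2 * pi) pi F)//.
- apply: eq_integral => u _; rewrite /F cosDpi; congr logpot.
  by rewrite -[LHS]normrN; congr (`|_|); ring.
- by rewrite gtr0_norm//; lra.
- exact: measurable_arcsine_kernel.
- by move=> u; exact: logpot_ge0.
- move=> u; rewrite /F (_ : u + 2 * pi = u + pi + pi); last by ring.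
  by rewrite !cosDpi opprK.
Qed.

End arcsine_potential.

Section loggap.
Context (R : realType).
Notation leb := (@lebesgue_measure R).
Let pp : 0 < pi :> R. Proof. exact: pi_gt0. Qed.
Let p0 : 0 < 2 * pi :> R. Proof. by rewrite mulr_gt0. Qed.

Definition loggap_integrand (t u : R) : R :=
  ln ((Num.max t 1 - cos u) / (1 - cos u)).

Definition loggapE (t : R) : \bar R :=
  (\int[leb]_(u in `]0%R, (2 * pi)%R[) (loggap_integrand t u)%:E)%E.

(** What the arcsine potential loses between the interval and a point at [t] times
    its half-length; the maximum with [1] makes it vanish for [t <= 1]. *)
Definition loggap (t : R) : R := fine (loggapE t).

Lemma loggap_integrand_ge0 t u : 0 <= loggap_integrand t u.
Proof.
have [c1|c1] := ltP (cos u) 1.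
  apply: ln_ge0; rewrite ler_pdivlMr ?subr_gt0// mul1r lerD2r.
  by rewrite le_max lexx orbT.
have cu1 : cos u = 1 by apply/eqP; rewrite eq_le c1 cos_le1.
by rewrite /loggap_integrand cu1 subrr invr0 mulr0 ln0.
Qed.

Lemma measurable_loggap_integrand :
  measurable_fun setT (fun z : R * R => loggap_integrand z.1 z.2).
Proof.
have mc : measurable_fun setT (fun z : R * R => cos z.2).
  exact: (measurableT_comp (@measurable_cos R) measurable_snd).
apply: measurableT_comp; first exact: measurable_ln.
apply: measurable_funM.
  apply: measurable_funB; last exact: mc.
  by apply: measurable_maxr; [exact: measurable_fst|exact: measurable_cst].
have m1 : measurable_fun setT (fun z : R * R => 1 - cos z.2).
  exact: measurable_funB.
exact: (measurableT_comp (@measurable_invr R) m1).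
Qed.

Lemma measurable_loggap_integrand1 t :
  measurable_fun setT (fun u => (loggap_integrand t u)%:E).
Proof.
apply/measurable_EFinP.
exact: (measurableT_comp measurable_loggap_integrand (pair1_measurable t)).
Qed.

Lemma loggapE_ge0 t : (0 <= loggapE t)%E.
Proof. by apply: integral_ge0 => u _; rewrite lee_fin loggap_integrand_ge0. Qed.

Lemma loggap_ge0 t : 0 <= loggap t.
Proof. by rewrite fine_ge0// loggapE_ge0. Qed.

Lemma measurable_loggap : measurable_fun setT loggap.
Proof.
apply: measurableT_comp; first exact: fine_measurable.
rewrite (_ : loggapE = fun t => (\int[leb]_u ((loggap_integrand t u)%:E * (\1_(`]0%R, (2 * pi)%R[%classic) u)%:E))%E).
  apply: (@measurable_fun_fubini_tonelli_F _ _ _ _ _ leb (fun z : R * R =>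
    (loggap_integrand z.1 z.2)%:E * (\1_(`]0%R, (2 * pi)%R[%classic) z.2)%:E)%E).
    apply: emeasurable_funM.
      by apply/measurable_EFinP; exact: measurable_loggap_integrand.
    apply/measurable_EFinP; apply: (measurableT_comp _ measurable_snd).
    exact: measurable_indic.
  by move=> z; rewrite mule_ge0// lee_fin ?loggap_integrand_ge0.
by apply/funext => t; rewrite /loggapE integral_mkcond epatch_indic.
Qed.

Lemma loggap0 t : t <= 1 -> loggap t = 0.
Proof.
move=> t1; rewrite /loggap /loggapE integral0_eq//= => u _.
rewrite /loggap_integrand max_r//.
have [->|c] := eqVneq (1 - cos u) 0; first by rewrite invr0 mulr0 ln0.
by rewrite divff// ln1.
Qed.

Lemma loggapE_le t : 1 <= t -> (loggapE t <= (2 * pi * ln t)%:E +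
    (\int[leb]_(u in `]0%R, (2 * pi)%R]) logsin u + \int[leb]_(u in `]0%R, (2 * pi)%R]) logsin u))%E.
Proof.
move=> t1; have ml := @measurable_logsin R.
have l0 (u : R) : (0 <= logsin u)%E by exact: logsin_ge0.
apply: (@le_trans _ _ (\int[leb]_(u in `]0%R, (2 * pi)%R[) ((ln t)%:E + (logsin u + logsin u)))%E).
  apply: ge0_le_integral => //.
  - by move=> u _; rewrite lee_fin loggap_integrand_ge0.
  - by apply: measurable_funTS; exact: measurable_loggap_integrand1.
  - by apply: measurable_funTS; apply: emeasurable_funD => //; exact: emeasurable_funD.
  move=> u /=; rewrite in_itv/= => /andP[u0 u2].
  have sp : 0 < sin (u / 2) by rewrite sin_gt0_pi//; apply/andP; split; lra.
  have c1 : cos u < 1 by apply: cos_lt1; rewrite u0.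
  rewrite /logsin gtr0_norm// logpotE// -!EFinD lee_fin /loggap_integrand max_l//.
  have cN := @cos_geN1 R u.
  apply: (@le_trans _ _ (ln (t / sin (u / 2) ^+ 2))).
    rewrite ler_ln ?posrE ?divr_gt0 ?subr_gt0 ?exprn_gt0//; [|by lra|by lra].
    rewrite ler_pdivrMr ?subr_gt0//.
    have -> : t / sin (u / 2) ^+ 2 * (1 - cos u) = 2 * t.
      by rewrite cos_half; field; rewrite gt_eqF.
    lra.
  rewrite ln_div ?posrE ?exprn_gt0//; last by lra.
  rewrite lnXn// lerD2l.
  have : ln (sin (u / 2)) <= 0 by apply: ln_le0; exact: sin_le1.
  by move=> ?; rewrite !max_r; lra.
rewrite ge0_integralD//; last 3 first.
- by move=> u _; rewrite lee_fin ln_ge0.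
- by move=> u _; rewrite adde_ge0.
- by apply: measurable_funTS; exact: emeasurable_funD.
rewrite integral_cst//= lebesgue_measure_itv/= lte_fin p0 oppr0 adde0 -EFinM mulrC leeD2l//.
rewrite integral_itv_bndo_bndc; last by apply: measurable_funTS; exact: emeasurable_funD.
by rewrite ge0_integralD//; apply: measurable_funTS.
Qed.

Lemma loggapE_fin t : loggapE t \is a fin_num.
Proof.
rewrite ge0_fin_numE ?loggapE_ge0//.
have [t1|t1] := leP t 1.
  rewrite /loggapE integral0_eq ?ltry// => u _.
  rewrite /loggap_integrand max_r//.
  have [->|c] := eqVneq (1 - cos u) 0; first by rewrite invr0 mulr0 ln0.
  by rewrite divff// ln1.
apply: (le_lt_trans (loggapE_le (ltW t1))); apply: lte_add_pinfty; first by rewrite ltry.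
by apply: lte_add_pinfty; exact: integral_logsin_lty.
Qed.

Lemma loggap_le (q : R) : 0 < q -> exists C : R, 0 <= C /\
  forall t, 0 < t -> loggap t <= C * t `^ (q / 2).
Proof.
move=> q0; set S := (\int[leb]_(u in `]0%R, (2 * pi)%R]) logsin u)%E.
have Sf : S \is a fin_num.
  by rewrite ge0_fin_numE ?integral_logsin_lty// integral_ge0// => u _; exact: logsin_ge0.
have S0 : 0 <= fine S by rewrite fine_ge0// integral_ge0// => u _; exact: logsin_ge0.
have C0 : 0 <= 2 * pi * (2 / q) + 2 * fine S.
  by rewrite addr_ge0// mulr_ge0// ?divr_ge0 ?(ltW q0) ?(ltW p0).
exists (2 * pi * (2 / q) + 2 * fine S); split => // t t0.
have [t1|t1] := leP t 1; first by rewrite loggap0// mulr_ge0 ?powR_ge0.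
have w0 : 0 < t `^ (q / 2) by rewrite powR_gt0.
have w1 : 1 <= t `^ (q / 2).
  by rewrite -[leLHS](powRr0 t) ler_powR ?(ltW t1)// divr_ge0 ?(ltW q0).
have lnt : ln t <= 2 / q * t `^ (q / 2).
  have := @ln_sublinear R _ w0; rewrite ln_powR => /ltW.
  by rewrite mulrC -ler_pdivlMr ?divr_gt0// invf_div mulrC.
rewrite -lee_fin /loggap fineK ?loggapE_fin//.
apply: (le_trans (loggapE_le (ltW t1))); rewrite -/S -(fineK Sf) -!EFinD lee_fin.
move: (t `^ _) w0 w1 lnt => w w0 w1 lnt.
have : 2 * pi * ln t <= 2 * pi * (2 / q * w) by rewrite ler_pM2l.
have : fine S <= fine S * w by rewrite ler_peMr.
lra.
Qed.

Lemma loggap_lower t : 3 <= t -> 2 * pi * ln 2 <= loggap t.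
Proof.
move=> t3; rewrite -lee_fin /loggap fineK ?loggapE_fin//.
have -> : (2 * pi * ln 2)%:E = (\int[leb]_(u in `]0%R, (2 * pi)%R[) (ln 2)%:E)%E.
  by rewrite integral_cst//= lebesgue_measure_itv/= lte_fin p0 oppr0 adde0 -EFinM mulrC.
have l20 : 0 <= ln 2 :> R by rewrite ln_ge0// ler1n.
apply: ge0_le_integral => //.
- by apply: measurable_funTS; exact: measurable_loggap_integrand1.
move=> u /=; rewrite in_itv/= => /andP[u0 u2].
have c1 : cos u < 1 by apply: cos_lt1; rewrite u0.
have cN := @cos_geN1 R u.
rewrite lee_fin /loggap_integrand max_l; last by lra.
rewrite ler_ln ?posrE ?divr_gt0 ?subr_gt0//; last by lra.
by rewrite ler_pdivlMr ?subr_gt0//; lra.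
Qed.

(** As long as the truncation of [logpot] is inactive, the difference of the
    kernels at [t] and at the endpoint [s] is the logarithm of the ratio of the
    distances. *)
Lemma loggap_arcsine (L s t : R) : 0 < s -> 2 * s <= expR L -> `|t| + s <= expR L ->
  ((loggap (`|t| / s))%:E + arcsine_pot L s t = arcsine_pot L s s)%E.
Proof.
move=> s0 sL tL; have [ts|st] := leP `|t| s.
  rewrite loggap0 ?ler_pdivrMr ?mul1r// add0e !arcsine_pot_inside//.
  by rewrite gtr0_norm.
have -> : arcsine_pot L s t = arcsine_pot L s `|t|.
  by have [t0|t0] := leP 0 t; [rewrite ger0_norm|rewrite ltr0_norm// arcsine_potN].
move: (`|t|) st tL => {}t st tL.
have mk x : measurable_fun setT (fun u => logpot L `|x - s * cos u|).
  exact: measurable_arcsine_kernel.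
have k0 := @logpot_ge0 R L.
rewrite /loggap fineK ?loggapE_fin// /arcsine_pot -!integral_itv_bndo_bndc;
  do ?[by apply: measurable_funTS; exact: mk].
rewrite -ge0_integralD//; last 3 first.
- by move=> u _; rewrite lee_fin loggap_integrand_ge0.
- by apply: measurable_funTS; exact: measurable_loggap_integrand1.
- by apply: measurable_funTS; exact: mk.
apply: eq_integral => u; rewrite inE/= in_itv/= => /andP[u0 u2].
have c1 : cos u < 1 by apply: cos_lt1; rewrite u0.
have cN := @cos_geN1 R u.
have sc : 0 < s - s * cos u by rewrite -{1}(mulr1 s) -mulrBr mulr_gt0// subr_gt0.
have tc : 0 < t - s * cos u by lra.
have scL : ln (s - s * cos u) <= L.
  rewrite -(expRK L) ler_ln ?posrE ?expR_gt0//; apply: le_trans sL.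
  have : s * (- cos u) <= s * 1 by rewrite ler_pM2l//; lra.
  lra.
have tcL : ln (t - s * cos u) <= L.
  rewrite -(expRK L) ler_ln ?posrE ?expR_gt0//; apply: le_trans tL.
  have : s * (- cos u) <= s * 1 by rewrite ler_pM2l//; lra.
  lra.
rewrite !gtr0_norm// !logpotE// -EFinD; congr EFin.
rewrite /loggap_integrand max_l; last by rewrite ler_pdivlMr// mul1r ltW.
have -> : (t / s - cos u) / (1 - cos u) = (t - s * cos u) / (s - s * cos u).
  by field; rewrite !gt_eqF// subr_gt0.
by rewrite ln_div ?posrE// !max_r; lra.
Qed.

End loggap.

(** * Image measures and chord integrals *)

Lemma exists_product d1 d2 (T1 : measurableType d1) (T2 : measurableType d2) (R : realType)
    (m1 : {sigma_finite_measure set T1 -> \bar R}) (m2 : {sigma_finite_measure set T2 -> \bar R}) :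
  exists m : {measure set (T1 * T2)%type -> \bar R},
  forall f : T1 * T2 -> \bar R, measurable_fun setT f -> (forall z, (0 <= f z)%E) ->
    (\int[m]_z f z = \int[m1]_x \int[m2]_y f (x, y))%E.
Proof.
exists (product_measure1 m1 m2) => f mf f0; exact: fubini_tonelli1.
Qed.

(** The weight [h2] is put on the last two factors first: it yields a finite
    measure there, so that the product with [m1] is again covered by Tonelli's
    theorem. *)
Lemma exists_iterated_image d1 d2 d3 d (T1 : measurableType d1) (T2 : measurableType d2)
    (T3 : measurableType d3) (Y : measurableType d) (R : realType)
    (m1 : {sigma_finite_measure set T1 -> \bar R}) (m2 : {sigma_finite_measure set T2 -> \bar R})
    (m3 : {sigma_finite_measure set T3 -> \bar R})
    (f : T1 * (T2 * T3) -> Y) (h1 : T1 -> R) (h2 : T2 * T3 -> R) :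
  measurable_fun setT f -> measurable_fun setT h1 -> measurable_fun setT h2 ->
  (forall x, 0 <= h1 x) -> (forall z, 0 <= h2 z) ->
  (\int[m1]_x (h1 x)%:E < +oo)%E -> (\int[m2]_y \int[m3]_z (h2 (y, z))%:E < +oo)%E ->
  exists tau : {finite_measure set Y -> \bar R},
  forall g : Y -> \bar R, measurable_fun setT g -> (forall y, (0 <= g y)%E) ->
    (\int[tau]_y g y = \int[m1]_x \int[m2]_y \int[m3]_z
       (g (f (x, (y, z))) * (h1 x * h2 (y, z))%:E))%E.
Proof.
move=> mf mh1 mh2 h10 h20 h1oo h2oo.
have [m23 m23E] := exists_product m2 m3.
have meh2 : measurable_fun setT (EFin \o h2) by exact/measurable_EFinP.
have eh20 z : (0 <= (EFin \o h2) z)%E by rewrite lee_fin.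
have h2oo' : (\int[m23]_z (h2 z)%:E < +oo)%E by rewrite m23E.
have mid : measurable_fun setT (id : T2 * T3 -> (T2 * T3)%type) by exact: measurable_id.
have [D DE] := exists_weighted_image mid mh2 h20 h2oo'.
have [m mE] := exists_product m1 D.
have mh1' : measurable_fun setT (fun z : T1 * (T2 * T3) => h1 z.1).
  exact: measurableT_comp mh1 measurable_fst.
have h1oo' : (\int[m]_z (h1 z.1)%:E < +oo)%E.
  rewrite mE; [|exact/measurable_EFinP|by move=> z; rewrite lee_fin].
  have meh1 : measurable_fun setT (EFin \o h1) by exact/measurable_EFinP.
  have [r rE] : exists r : R, D setT = r%:E.
    by exists (fine (D setT)); rewrite fineK// fin_num_measure.
  have r0 : 0 <= r by rewrite -lee_fin -rE.
  have cE x : (\int[D]_y (h1 (x, y).1)%:E = (h1 x)%:E * r%:E)%E.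
    by rewrite -rE -integral_cst.
  under eq_integral do rewrite cE.
  rewrite ge0_integralZr//; last by move=> x _; rewrite lee_fin.
  by rewrite muleC lte_mul_pinfty.
have [tau tauE] := exists_weighted_image mf mh1' (fun z => h10 z.1) h1oo'.
exists tau => g mg g0; rewrite tauE//.
have mgf : measurable_fun setT (fun z => g (f z)) by exact: measurableT_comp mg mf.
have mF : measurable_fun setT (fun z : T1 * (T2 * T3) => g (f z) * (h1 z.1)%:E)%E.
  by apply: emeasurable_funM => //; exact/measurable_EFinP.
rewrite mE//; last by move=> z; rewrite mule_ge0// lee_fin.
apply: eq_integral => x _ /=.
have mFx : measurable_fun setT (fun z : T2 * T3 => g (f (x, z)) * (h1 x)%:E)%E.
  exact: (measurableT_comp mF (pair1_measurable x)).
rewrite DE//; last by move=> z; rewrite mule_ge0// lee_fin.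
rewrite m23E.
- apply: eq_integral => y _; apply: eq_integral => z _.
  by rewrite EFinM muleA.
- by apply: emeasurable_funM.
- by move=> z; rewrite !mule_ge0// lee_fin.
Qed.

Section chord.
Context (R : realType).
Notation leb := (@lebesgue_measure R).

(** The value [0] for [a <= 0] encodes the supports of the densities
    [invsqrt (1 - w^2)] and [invsqrt (1 - u^2 - v^2)]. *)
Definition invsqrt (a : R) : R := (Num.sqrt a)^-1.

Lemma invsqrt_ge0 a : 0 <= invsqrt a.
Proof. by rewrite invr_ge0 sqrtr_ge0. Qed.

Lemma invsqrt_npos a : a <= 0 -> invsqrt a = 0.
Proof. by move=> a0; rewrite /invsqrt ler0_sqrtr// invr0. Qed.

Lemma invsqrtM a b : 0 <= a -> invsqrt (a * b) = invsqrt a * invsqrt b.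
Proof. by move=> a0; rewrite /invsqrt sqrtrM// invfM. Qed.

Lemma invsqrt_sqr a : 0 <= a -> invsqrt a * invsqrt a = a^-1.
Proof. by move=> a0; rewrite /invsqrt -invfM -expr2 sqr_sqrtr. Qed.

Lemma measurable_invsqrt : measurable_fun setT invsqrt.
Proof. exact: (measurableT_comp (@measurable_invr R) (@measurable_sqrtr R)). Qed.

Lemma invsqrt_le a b : 0 < a -> a <= b -> invsqrt b <= invsqrt a.
Proof.
move=> a0 ab; rewrite /invsqrt lef_pV2 ?posrE ?sqrtr_gt0//; last exact: lt_le_trans ab.
by rewrite ler_wsqrtr.
Qed.

Lemma measurable_sqr_id : measurable_fun setT (fun w : R => w ^+ 2).
Proof. exact: measurable_funX. Qed.

Lemma measurable_cheb : measurable_fun setT (fun w : R => (invsqrt (1 - w ^+ 2))%:E).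
Proof.
apply/measurable_EFinP; apply: (measurableT_comp measurable_invsqrt).
by apply: measurable_funB; [exact: measurable_cst|exact: measurable_sqr_id].
Qed.

(** The mass of the unnormalised arcsine law. *)
Definition cheb_mass : \bar R := (\int[leb]_w (invsqrt (1 - w ^+ 2))%:E)%E.

(** Each of the two endpoint singularities is of the type [v^(-1/2)]. *)
Lemma cheb_mass_lty : (cheb_mass < +oo)%E.
Proof.
have [g [g0 mg goo gE]] : exists g : R -> \bar R, [/\ (forall v, (0 <= g v)%E),
    measurable_fun setT g, (\int[leb]_v g v < +oo)%E &
    forall v, 0 < v -> v <= 1 -> g v = (invsqrt v)%:E].
  exists ((fun v : R => (v `^ (2^-1 - 1))%:E) \_ `]0%R, 1%R]); split.
  - by move=> v; rewrite patchE; case: ifP => // _; rewrite lee_fin powR_ge0.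
  - rewrite epatch_indic; apply: emeasurable_funM.
      by apply/measurable_EFinP; exact: measurable_powR.
    by apply/measurable_EFinP; apply: measurable_indic; exact: measurable_itv.
  - by rewrite -integral_mkcond; apply: integral_powR_lty; rewrite invr_gt0.
  move=> v v0 v1; rewrite patchE mem_set/=; last by rewrite in_itv/= v0.
  have -> : 2^-1 - 1 = - 2^-1 :> R by field.
  by rewrite powRN powR12_sqrt// ltW.
have N1 : -1 != 0 :> R by rewrite oppr_eq0 oner_eq0.
have i1 := integral_affine 1 N1 mg g0.
have i2 := integral_affine 1 (oner_neq0 R) mg g0.
rewrite normrN1 mul1e in i1; rewrite normr1 mul1e in i2.
have maff (a : R) : measurable_fun setT (fun w : R => g (a * w + 1)).
  apply: (measurableT_comp mg); apply: measurable_funD; last exact: measurable_cst.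
  by apply: measurable_funM; [exact: measurable_cst|exact: measurable_id].
have bound (w : R) : ((invsqrt (1 - w ^+ 2))%:E <= g (-1 * w + 1)%R + g (1 * w + 1)%R)%E.
  have [w1|w1] := leP (1 - w ^+ 2) 0; first by rewrite invsqrt_npos// adde_ge0.
  have f : 1 - w ^+ 2 = (1 - w) * (1 + w) by ring.
  have [w0|w0] := leP 0 w.
    have wp : 0 < 1 - w by move: w1; rewrite f pmulr_lgt0//; lra.
    apply: (@le_trans _ _ (g (-1 * w + 1)%R)); last by rewrite leeDl.
    rewrite gE; [|lra|lra]; rewrite lee_fin; apply: invsqrt_le; first lra.
    have -> : -1 * w + 1 = (1 - w) * 1 by ring.
    by rewrite f ler_pM2l//; lra.
  have wp : 0 < 1 + w by move: w1; rewrite f pmulr_rgt0//; lra.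
  apply: (@le_trans _ _ (g (1 * w + 1)%R)); last by rewrite leeDr.
  rewrite gE; [|lra|lra]; rewrite lee_fin; apply: invsqrt_le; first lra.
  have -> : 1 * w + 1 = 1 * (1 + w) by ring.
  by rewrite f ler_pM2r//; lra.
apply: (@le_lt_trans _ _ (\int[leb]_w (g (-1 * w + 1)%R + g (1 * w + 1)%R))%E).
  apply: ge0_le_integral => //.
  - by move=> w _; rewrite lee_fin invsqrt_ge0.
  - exact: measurable_cheb.
  - by apply: emeasurable_funD; exact: maff.
have i1oo : (\int[leb]_w g (-1 * w + 1)%R < +oo)%E by rewrite -i1.
have i2oo : (\int[leb]_w g (1 * w + 1)%R < +oo)%E by rewrite -i2.
rewrite ge0_integralD//; [exact: lte_add_pinfty|exact: maff|exact: maff].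
Qed.

Lemma cheb_mass_gt0 : (0 < cheb_mass)%E.
Proof.
apply: (@lt_le_trans _ _ (\int[leb]_(w in `](-1)%R, 1%R[) 1%:E)%E).
  by rewrite integral_cst//= lebesgue_measure_itv/= lte_fin ifT ?mul1e ?lte_fin; lra.
apply: (@le_trans _ _ (\int[leb]_(w in `](-1)%R, 1%R[) (invsqrt (1 - w ^+ 2))%:E)%E).
  apply: ge0_le_integral => //; first by apply: measurable_funTS; exact: measurable_cheb.
  move=> w /=; rewrite in_itv/= => /andP[w1 w2]; rewrite lee_fin.
  have i1 : invsqrt (1 : R) = 1 by rewrite /invsqrt sqrtr1 invr1.
  rewrite -[X in (X <= _)%R]i1.
  apply: invsqrt_le; last by have := sqr_ge0 w; lra.
  have -> : 1 - w ^+ 2 = (1 - w) * (1 + w) by ring.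
  by rewrite mulr_gt0; lra.
apply: ge0_subset_integral => //; first exact: measurable_cheb.
by move=> w _; rewrite lee_fin invsqrt_ge0.
Qed.

Definition cheb : R := fine cheb_mass.

Lemma chebE : cheb_mass = cheb%:E.
Proof. by rewrite fineK// ge0_fin_numE ?cheb_mass_lty// ltW// cheb_mass_gt0. Qed.

Lemma cheb_gt0 : 0 < cheb.
Proof. by rewrite -lte_fin -chebE cheb_mass_gt0. Qed.

(** Completing the square reduces to [1 - w^2], where the length of the chord
    cancels: only the leading coefficient [C] and the sign of the discriminant
    matter. *)
Lemma integral_invsqrt_quadratic (A B C : R) : 0 < C ->
  (\int[leb]_u (invsqrt (A - 2 * B * u - C * u ^+ 2))%:E =
   (if 0 < B ^+ 2 + A * C then cheb * invsqrt C else 0)%:E)%E.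
Proof.
move=> C0; have Cn : C != 0 by rewrite gt_eqF.
have sq u : A - 2 * B * u - C * u ^+ 2 = (B ^+ 2 + A * C) / C - C * (u + B / C) ^+ 2 by field.
have [d0|d0] := leP (B ^+ 2 + A * C) 0.
  apply: integral0_eq => u _; rewrite invsqrt_npos// sq subr_le0.
  apply: (@le_trans _ _ 0); first by rewrite ler_pdivrMr// mul0r.
  by rewrite mulr_ge0 ?sqr_ge0 ?(ltW C0).
set d := B ^+ 2 + A * C in sq d0 *.
have s0 : 0 < Num.sqrt d by rewrite sqrtr_gt0.
have a0 : Num.sqrt d / C != 0 by rewrite gt_eqF// divr_gt0.
have mq : measurable_fun setT (fun u : R => (invsqrt (A - 2 * B * u - C * u ^+ 2))%:E).
  apply/measurable_EFinP; apply: (measurableT_comp measurable_invsqrt).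
  apply: measurable_funB; last first.
    by apply: measurable_funM; [exact: measurable_cst|exact: measurable_sqr_id].
  apply: measurable_funB; first exact: measurable_cst.
  by apply: measurable_funM; [exact: measurable_cst|exact: measurable_id].
have q0 u : (0 <= (invsqrt (A - 2 * B * u - C * u ^+ 2))%:E)%E by rewrite lee_fin invsqrt_ge0.
rewrite (integral_affine (- (B / C)) a0 mq q0).
have E (w : R) : invsqrt (A - 2 * B * (Num.sqrt d / C * w - B / C) - C * (Num.sqrt d / C * w - B / C) ^+ 2) =
    invsqrt (d / C) * invsqrt (1 - w ^+ 2).
  rewrite -invsqrtM ?divr_ge0 ?ltW// sq subrK; congr invsqrt.
  by rewrite !exprMn sqr_sqrtr ?ltW//; field.
under eq_integral do rewrite E EFinM.
rewrite ge0_integralZl_EFin ?invsqrt_ge0//; last 2 first.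
- by move=> w _; rewrite lee_fin invsqrt_ge0.
- exact: measurable_cheb.
rewrite -/cheb_mass chebE -!EFinM; congr EFin.
rewrite gtr0_norm ?divr_gt0// invsqrtM ?ltW// mulrA mulrC; congr (_ * _).
rewrite /invsqrt; have sC : 0 < Num.sqrt C by rewrite sqrtr_gt0.
have CE : C = Num.sqrt C * Num.sqrt C by rewrite -expr2 sqr_sqrtr ?ltW.
by rewrite sqrtrV ?ltW// invrK mulrACA divff ?gt_eqF// mul1r {1}CE invfM -mulrA mulVf ?mulr1// gt_eqF.
Qed.

Lemma integral_oneDsqrV : (\int[leb]_m ((1 + m ^+ 2)^-1)%:E = pi%:E)%E.
Proof.
have := @ge0_symfun_integralT R (fun m => (oneDsqr m)^-1).
rewrite /oneDsqr => ->.
- have -> : [set x : R | 0 <= x] = `[0%R, +oo[%classic.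
    by apply/seteqP; split => x /=; rewrite in_itv/= andbT.
  by rewrite integral0y_oneDsqr -EFinM mulrC divfK.
- by move=> x; rewrite invr_ge0 addr_ge0// sqr_ge0.
- exact: continuous_oneDsqrV.
- by move=> x /=; rewrite sqrrN.
Qed.

End chord.

(** * The potential of the disc density *)

Ltac measurable_polynomial :=
  repeat first [exact: measurable_fst | exact: measurable_snd | exact: measurable_cst
    | exact: measurable_id | apply: measurable_funB | apply: measurable_funD
    | apply: measurable_funM | apply: measurable_funX].

Section disc_potential.
Context (R : realType).
Notation leb := (@lebesgue_measure R).

Definition planar_dist (x1 x2 u v : R) : R := Num.sqrt ((x1 - u) ^+ 2 + (x2 - v) ^+ 2).

Definition disc_density (u v : R) : R := invsqrt (1 - (u ^+ 2 + v ^+ 2)).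

(** The potential in the plane of the disc of the measure of density
    [disc_density], which is the projection of the uniform measure of the unit
    sphere, up to a factor. *)
Definition disc_pot (x1 x2 : R) : \bar R :=
  (\int[leb]_u \int[leb]_v (newton (planar_dist x1 x2 u v) * (disc_density u v)%:E))%E.

(** The condition says that the line of slope [m] through [(x1, x2)] meets the
    open unit disc. *)
Definition slope_density (x1 x2 m : R) : R :=
  if (x2 - m * x1) ^+ 2 < 1 + m ^+ 2 then cheb R * (1 + m ^+ 2)^-1 else 0.

Lemma newton_ge0 (t : R) : (0 <= newton t)%E.
Proof. exact: (adm_ge0 (admissible_newton R)). Qed.

Lemma disc_density_ge0 u v : 0 <= disc_density u v.
Proof. exact: invsqrt_ge0. Qed.

Lemma onep_sqr_gt0 (m : R) : 0 < 1 + m ^+ 2.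
Proof. by rewrite ltr_pwDl// sqr_ge0. Qed.

Lemma slope_density_ge0 x1 x2 m : 0 <= slope_density x1 x2 m.
Proof.
rewrite /slope_density; case: ifP => // _.
by rewrite mulr_ge0 ?invr_ge0 ?ltW ?cheb_gt0// onep_sqr_gt0.
Qed.

Lemma measurable_disc_density : measurable_fun setT (fun z : R * R => disc_density z.1 z.2).
Proof.
apply: (measurableT_comp (@measurable_invsqrt R)).
measurable_polynomial.
Qed.

Lemma measurable_disc_integrand (x1 x2 : R) : measurable_fun setT (fun z : R * R =>
  newton (planar_dist x1 x2 z.1 z.2) * (disc_density z.1 z.2)%:E)%E.
Proof.
apply: emeasurable_funM; last by apply/measurable_EFinP; exact: measurable_disc_density.
apply: (measurableT_comp (adm_meas (admissible_newton R))).
apply: (measurableT_comp (@measurable_sqrtr R)).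
measurable_polynomial.
Qed.

Lemma disc_integrand_ge0 x1 x2 u v :
  (0 <= newton (planar_dist x1 x2 u v) * (disc_density u v)%:E)%E.
Proof. by rewrite mule_ge0 ?newton_ge0// lee_fin disc_density_ge0. Qed.

Lemma measurable_slope_density : measurable_fun setT
  (fun z : (R * R) * R => slope_density z.1.1 z.1.2 z.2).
Proof.
have m1 : measurable_fun setT (fun z : (R * R) * R => z.1.1).
  exact: (measurableT_comp measurable_fst measurable_fst).
have m2 : measurable_fun setT (fun z : (R * R) * R => z.1.2).
  exact: (measurableT_comp measurable_snd measurable_fst).
have m3 : measurable_fun setT (fun z : (R * R) * R => z.2) by exact: measurable_snd.
have mp : measurable_fun setT (fun z : (R * R) * R => 1 + z.2 ^+ 2).
  by apply: measurable_funD; [exact: measurable_cst|exact: measurable_funX].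
apply: measurable_fun_ifT; last exact: measurable_cst.
  apply: measurable_fun_ltr; last exact: mp.
  by apply: measurable_funX; apply: measurable_funB => //; exact: measurable_funM.
apply: measurable_funM; first exact: measurable_cst.
exact: (measurableT_comp (@measurable_invr R) mp).
Qed.

Lemma measurable_slope_density1 x1 x2 : measurable_fun setT (fun m => (slope_density x1 x2 m)%:E).
Proof.
apply/measurable_EFinP.
exact: (measurableT_comp measurable_slope_density (pair1_measurable (x1, x2))).
Qed.

(** Points of the vertical line at [u] are parametrised by the slope of the line
    joining them to [(x1, x2)]; the Jacobian [|u - x1|] cancels the pole of the
    kernel. *)
Lemma integral_vertical (x1 x2 u : R) : u != x1 ->
  (\int[leb]_v (newton (planar_dist x1 x2 u v) * (disc_density u v)%:E) =
   \int[leb]_m (invsqrt (1 + m ^+ 2) *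
      invsqrt (1 - (u ^+ 2 + ((u - x1) * m + x2) ^+ 2)))%:E)%E.
Proof.
move=> ux; have a0 : u - x1 != 0 by rewrite subr_eq0.
have mf : measurable_fun setT (fun v =>
    newton (planar_dist x1 x2 u v) * (disc_density u v)%:E)%E.
  exact: (measurableT_comp (measurable_disc_integrand x1 x2) (pair1_measurable u)).
rewrite (integral_affine x2 a0 mf (disc_integrand_ge0 x1 x2 u)).
have n0 : 0 < `|u - x1| by rewrite normr_gt0.
have E (m : R) : (newton (planar_dist x1 x2 u ((u - x1) * m + x2)) *
    (disc_density u ((u - x1) * m + x2))%:E =
    `|u - x1|^-1%:E * (invsqrt (1 + m ^+ 2) *
      invsqrt (1 - (u ^+ 2 + ((u - x1) * m + x2) ^+ 2)))%:E)%E.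
  have -> : planar_dist x1 x2 u ((u - x1) * m + x2) = `|u - x1| * Num.sqrt (1 + m ^+ 2).
    rewrite -sqrtr_sqr -sqrtrM ?sqr_ge0//; congr Num.sqrt; ring.
  rewrite newtonE ?mulr_gt0 ?sqrtr_gt0 ?onep_sqr_gt0//.
  by rewrite -!EFinM invfM -mulrA.
under eq_integral do rewrite E.
rewrite ge0_integralZl_EFin ?invr_ge0//; last 2 first.
- by move=> m _; rewrite lee_fin mulr_ge0// invsqrt_ge0.
- apply/measurable_EFinP; apply: measurable_funM.
    by apply: (measurableT_comp (@measurable_invsqrt R)); measurable_polynomial.
  by apply: (measurableT_comp (@measurable_invsqrt R)); measurable_polynomial.
by rewrite muleA -EFinM divff ?mul1e// gt_eqF.
Qed.

(** After [integral_vertical] and Tonelli's theorem, the inner integral runs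
    along the line of slope [m], where [integral_invsqrt_quadratic] applies. *)
Lemma disc_potE (x1 x2 : R) : disc_pot x1 x2 = (\int[leb]_m (slope_density x1 x2 m)%:E)%E.
Proof.
pose H (z : R * R) : \bar R := (invsqrt (1 + z.2 ^+ 2) *
  invsqrt (1 - (z.1 ^+ 2 + ((z.1 - x1) * z.2 + x2) ^+ 2)))%:E.
have mH : measurable_fun setT H.
  apply/measurable_EFinP; apply: measurable_funM.
    by apply: (measurableT_comp (@measurable_invsqrt R)); measurable_polynomial.
  by apply: (measurableT_comp (@measurable_invsqrt R)); measurable_polynomial.
have H0 z : (0 <= H z)%E by rewrite lee_fin mulr_ge0// invsqrt_ge0.
transitivity (\int[leb]_u \int[leb]_m H (u, m))%E.
  have mL : measurable_fun setT (fun u : R => \int[leb]_v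
      (newton (planar_dist x1 x2 u v) * (disc_density u v)%:E))%E.
    apply: (@measurable_fun_fubini_tonelli_F _ _ _ _ _ leb (fun z : R * R =>
      newton (planar_dist x1 x2 z.1 z.2) * (disc_density z.1 z.2)%:E)%E).
      exact: measurable_disc_integrand.
    by move=> z; exact: disc_integrand_ge0.
  have mR : measurable_fun setT (fun u : R => \int[leb]_m H (u, m))%E.
    exact: (@measurable_fun_fubini_tonelli_F _ _ _ _ _ leb H).
  have mx1 : measurable ([set x1] : set (measurableTypeR R)) by exact: measurable_set1.
  rewrite /disc_pot (@ge0_negligible_integral _ _ _ leb setT [set x1])//; last 2 first.
  - by move=> u _; apply: integral_ge0 => v _; exact: disc_integrand_ge0.
  - exact: lebesgue_measure_set1.
  rewrite [RHS](@ge0_negligible_integral _ _ _ leb setT [set x1])//; last 2 first.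
  - by move=> u _; exact: integral_ge0.
  - exact: lebesgue_measure_set1.
  apply: eq_integral => u; rewrite inE => -[_ /= /eqP ux].
  exact: integral_vertical.
rewrite (@fubini_tonelli _ _ _ _ _ leb leb H)//; apply: eq_integral => m _.
rewrite /H/=; pose D := x2 - m * x1.
have E (u : R) : invsqrt (1 - (u ^+ 2 + ((u - x1) * m + x2) ^+ 2)) =
    invsqrt ((1 - D ^+ 2) - 2 * (m * D) * u - (1 + m ^+ 2) * u ^+ 2).
  by rewrite /D; congr invsqrt; ring.
under eq_integral do rewrite E EFinM.
rewrite ge0_integralZl_EFin ?invsqrt_ge0//; last 2 first.
- by move=> u _; rewrite lee_fin invsqrt_ge0.
- apply/measurable_EFinP; apply: (measurableT_comp (@measurable_invsqrt R)).
  by measurable_polynomial.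
rewrite integral_invsqrt_quadratic ?onep_sqr_gt0// -EFinM; congr EFin.
have -> : (m * D) ^+ 2 + (1 - D ^+ 2) * (1 + m ^+ 2) = 1 + m ^+ 2 - D ^+ 2 by ring.
rewrite subr_gt0 /slope_density -/D; case: ifP => _; last by rewrite mulr0.
by rewrite mulrCA invsqrt_sqr// ltW// onep_sqr_gt0.
Qed.

Lemma integral_slope : (\int[leb]_m (cheb R * (1 + m ^+ 2)^-1)%:E = (cheb R * pi)%:E)%E.
Proof.
under eq_integral do rewrite EFinM.
rewrite ge0_integralZl_EFin ?(ltW (cheb_gt0 R))//.
- by rewrite integral_oneDsqrV.
- by move=> m _; rewrite lee_fin invr_ge0 ltW// onep_sqr_gt0.
- apply/measurable_EFinP; apply: (measurableT_comp (@measurable_invr R)).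
  by measurable_polynomial.
Qed.

Lemma measurable_slope : measurable_fun setT (fun m : R => (cheb R * (1 + m ^+ 2)^-1)%:E).
Proof.
apply/measurable_EFinP; apply: measurable_funM; first exact: measurable_cst.
apply: (measurableT_comp (@measurable_invr R)).
by measurable_polynomial.
Qed.

Lemma disc_pot_le x1 x2 : (disc_pot x1 x2 <= (cheb R * pi)%:E)%E.
Proof.
rewrite disc_potE -integral_slope; apply: ge0_le_integral => //.
- by move=> m _; rewrite lee_fin slope_density_ge0.
- exact: measurable_slope_density1.
- exact: measurable_slope.
move=> m _; rewrite lee_fin /slope_density; case: ifP => // _.
by rewrite mulr_ge0 ?invr_ge0 ?ltW ?cheb_gt0// onep_sqr_gt0.
Qed.

(** A line through a point of the closed disc misses the open disc only if it is
    the tangent at that point, which excludes at most one slope, namely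
    [- x1 / x2]. *)
Lemma disc_pot_inside x1 x2 : x1 ^+ 2 + x2 ^+ 2 <= 1 -> disc_pot x1 x2 = (cheb R * pi)%:E.
Proof.
move=> x_le1; rewrite disc_potE -integral_slope.
have mb : measurable ([set - x1 / x2] : set (measurableTypeR R)) by exact: measurable_set1.
rewrite (@ge0_negligible_integral _ _ _ leb setT [set - x1 / x2])//; last 3 first.
- exact: measurable_slope_density1.
- by move=> m _; rewrite lee_fin slope_density_ge0.
- exact: lebesgue_measure_set1.
rewrite [RHS](@ge0_negligible_integral _ _ _ leb setT [set - x1 / x2])//; last 3 first.
- exact: measurable_slope.
- by move=> m _; rewrite lee_fin mulr_ge0 ?invr_ge0 ?ltW ?cheb_gt0// onep_sqr_gt0.
- exact: lebesgue_measure_set1.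
apply: eq_integral => m; rewrite inE => -[_ /= mx].
rewrite /slope_density ifT//.
have lagrange : (1 + m ^+ 2) * (x1 ^+ 2 + x2 ^+ 2) = (x2 - m * x1) ^+ 2 + (x1 + m * x2) ^+ 2 by ring.
have m0 := onep_sqr_gt0 m.
have cs : (1 + m ^+ 2) * (x1 ^+ 2 + x2 ^+ 2) <= 1 + m ^+ 2 by rewrite ger_pMr.
have [e|e] := eqVneq (x1 + m * x2) 0; last first.
  have : 0 < (x1 + m * x2) ^+ 2 by rewrite exprn_even_gt0.
  lra.
have x20 : x2 = 0.
  apply/eqP/negP => /negP x2n; apply: mx.
  by move/eqP: e; rewrite addr_eq0 => /eqP ->; rewrite opprK mulfK.
have x10 : x1 = 0 by rewrite -e x20; ring.
by rewrite x20 x10 mulr0 subrr expr0n.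
Qed.

(** Within the disc, the kernel with pole at the centre is at least [1]. *)
Lemma disc_mass_le : (\int[leb]_u \int[leb]_v (disc_density u v)%:E <= (cheb R * pi)%:E)%E.
Proof.
rewrite -(@disc_pot_inside 0 0); last by rewrite expr0n addr0.
have mI := measurable_disc_integrand 0 0.
have mD : measurable_fun setT (fun z : R * R => (disc_density z.1 z.2)%:E).
  by apply/measurable_EFinP; exact: measurable_disc_density.
apply: ge0_le_integral => //.
- by move=> u _; apply: integral_ge0 => v _; rewrite lee_fin disc_density_ge0.
- apply: (@measurable_fun_fubini_tonelli_F _ _ _ _ _ leb (fun z : R * R => (disc_density z.1 z.2)%:E) mD).
  by move=> z; rewrite lee_fin disc_density_ge0.
- apply: (@measurable_fun_fubini_tonelli_F _ _ _ _ _ leb (fun z : R * R => newton (planar_dist 0 0 z.1 z.2) * (disc_density z.1 z.2)%:E)%E mI).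
  by move=> z; exact: disc_integrand_ge0.
move=> u _; apply: ge0_le_integral => //.
- by move=> v _; rewrite lee_fin disc_density_ge0.
- exact: (measurableT_comp mD (pair1_measurable u)).
- exact: (measurableT_comp mI (pair1_measurable u)).
move=> v _; have [uv|uv] := leP 1 (u ^+ 2 + v ^+ 2).
  by rewrite /disc_density invsqrt_npos ?mule0// subr_le0.
rewrite -[leLHS]mul1e; apply: lee_wpmul2r; first by rewrite lee_fin disc_density_ge0.
rewrite /newton; case: (leP (planar_dist 0 0 u v) 0) => [_|d0]; first exact: leey.
rewrite lee_fin invf_ge1// -sqrtr1 ler_wsqrtr//.
by rewrite !sub0r !sqrrN ltW.
Qed.

(** At distance at least [2] from all points of the disc, the kernel is at most
    [1 / 2], and the mass is bounded by [disc_mass_le]. *)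
Lemma disc_pot_far x1 x2 : 9 <= x1 ^+ 2 + x2 ^+ 2 -> (disc_pot x1 x2 <= (cheb R * pi / 2)%:E)%E.
Proof.
move=> x9; have h0 : 0 <= 2^-1 :> R by rewrite invr_ge0.
have mI := measurable_disc_integrand x1 x2.
have mD : measurable_fun setT (fun z : R * R => (disc_density z.1 z.2)%:E).
  by apply/measurable_EFinP; exact: measurable_disc_density.
have D0 u v : (0 <= (disc_density u v)%:E)%E by rewrite lee_fin disc_density_ge0.
have mDD : measurable_fun setT (fun u : R => \int[leb]_v (disc_density u v)%:E)%E.
  by apply: (@measurable_fun_fubini_tonelli_F _ _ _ _ _ leb (fun z : R * R => (disc_density z.1 z.2)%:E) mD).
have mDu (u : R) : measurable_fun setT (fun v : R => (disc_density u v)%:E).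
  exact: (measurableT_comp mD (pair1_measurable u)).
apply: (@le_trans _ _ (2^-1%:E * \int[leb]_u \int[leb]_v (disc_density u v)%:E)%E); last first.
  by rewrite mulrC EFinM; apply: lee_wpmul2l; [rewrite lee_fin|exact: disc_mass_le].
rewrite -ge0_integralZl_EFin//; last by move=> u _; exact: integral_ge0.
apply: ge0_le_integral => //.
- by move=> u _; apply: integral_ge0 => v _; exact: disc_integrand_ge0.
- apply: (@measurable_fun_fubini_tonelli_F _ _ _ _ _ leb (fun z : R * R => newton (planar_dist x1 x2 z.1 z.2) * (disc_density z.1 z.2)%:E)%E mI).
  by move=> z; exact: disc_integrand_ge0.
- exact: measurable_funeM.
move=> u _; rewrite -ge0_integralZl_EFin//; last exact: (mDu u).
apply: ge0_le_integral => //.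
- by move=> v _; exact: disc_integrand_ge0.
- exact: (measurableT_comp mI (pair1_measurable u)).
- by apply: measurable_funeM; exact: (mDu u).
move=> v _; have [uv|uv] := leP 1 (u ^+ 2 + v ^+ 2).
  by rewrite /disc_density invsqrt_npos ?mule0// subr_le0.
apply: lee_wpmul2r => //.
have d2 : 2 <= planar_dist x1 x2 u v.
  have -> : 2 = Num.sqrt (2 ^+ 2) :> R by rewrite sqrtr_sqr ger0_norm.
  rewrite ler_wsqrtr//.
  have s1 := sqr_ge0 (x1 - 3 * u); have s2 := sqr_ge0 (x2 - 3 * v).
  rewrite -subr_ge0.
  have -> : (x1 - u) ^+ 2 + (x2 - v) ^+ 2 - 2 ^+ 2 =
    ((x1 - 3 * u) ^+ 2 + (x2 - 3 * v) ^+ 2) / 3 + 2 / 3 * (x1 ^+ 2 + x2 ^+ 2 - 9) +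
    2 * (1 - (u ^+ 2 + v ^+ 2)) by field.
  lra.
rewrite newtonE; last by apply: lt_le_trans d2.
by rewrite lee_fin lef_pV2 ?posrE//; apply: lt_le_trans d2.
Qed.

Lemma disc_pot_ge0 x1 x2 : (0 <= disc_pot x1 x2)%E.
Proof. by apply: integral_ge0 => u _; apply: integral_ge0 => v _; exact: disc_integrand_ge0. Qed.

Lemma measurable_disc_pot : measurable_fun setT (fun x : R * R => disc_pot x.1 x.2).
Proof.
under eq_fun do rewrite disc_potE.
apply: (@measurable_fun_fubini_tonelli_F _ _ _ _ _ leb
  (fun z : (R * R) * R => (slope_density z.1.1 z.1.2 z.2)%:E)).
  by apply/measurable_EFinP; exact: measurable_slope_density.
by move=> z; rewrite lee_fin slope_density_ge0.
Qed.

End disc_potential.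

(** * Averaging the disc potential over rotations *)

Lemma polar_form (R : realType) (a b : R) : exists alpha : R,
  [/\ `|alpha| <= 2 * pi, a = Num.sqrt (a ^+ 2 + b ^+ 2) * cos alpha
    & b = Num.sqrt (a ^+ 2 + b ^+ 2) * sin alpha].
Proof.
have pp := pi_gt0 R.
have ab0 : 0 <= a ^+ 2 + b ^+ 2 by rewrite addr_ge0 ?sqr_ge0.
set rho := Num.sqrt _; have rho2 : rho ^+ 2 = a ^+ 2 + b ^+ 2 by rewrite sqr_sqrtr.
have rho0 : 0 <= rho by rewrite sqrtr_ge0.
have [r0|rn] := eqVneq rho 0.
  have /eqP := rho2; rewrite r0 expr0n eq_sym paddr_eq0 ?sqr_ge0// !sqrf_eq0 => /andP[/eqP -> /eqP ->].
  by exists 0; rewrite !mul0r normr0 mulr_ge0// ltW.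
have rp : 0 < rho by rewrite lt_neqAle eq_sym rn.
have x1 : -1 <= a / rho <= 1.
  rewrite -ler_norml normrM normfV (gtr0_norm rp) ler_pdivrMr// mul1r.
  rewrite -(ler_pXn2r (n := 2))// ?nnegrE// real_normK ?num_real// rho2.
  by rewrite lerDl sqr_ge0.
have [/andP[al0 alp] ca] := acos_def x1; have sa := sin_acos x1.
have sb : rho * sin (acos (a / rho)) = `|b|.
  rewrite sa -{1}(gtr0_norm rp) -sqrtr_sqr -sqrtrM ?sqr_ge0// -(sqrtr_sqr b); congr Num.sqrt.
  have -> : rho ^+ 2 * (1 - (a / rho) ^+ 2) = rho ^+ 2 - a ^+ 2.
    by rewrite expr_div_n mulrBr mulr1 (mulrC (a ^+ 2)) mulVKf// expf_neq0.
  by rewrite rho2; ring.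
have ra : a = rho * cos (acos (a / rho)) by rewrite ca mulrCA divff ?mulr1.
have [b0|b0] := leP 0 b.
  exists (acos (a / rho)); split => //; last by rewrite sb ger0_norm.
  by rewrite ger0_norm//; lra.
exists (- acos (a / rho)); split; last 2 first.
- by rewrite cosN.
- by rewrite sinN mulrN sb ltr0_norm// opprK.
- by rewrite normrN ger0_norm//; lra.
Qed.

Section profile.
Context (R : realType).
Notation leb := (@lebesgue_measure R).
Let pp : 0 < pi :> R. Proof. exact: pi_gt0. Qed.
Let p0 : 0 < 2 * pi :> R. Proof. by rewrite mulr_gt0. Qed.

Definition disc_level : R := cheb R * pi.

Lemma disc_level_gt0 : 0 < disc_level.
Proof. by rewrite mulr_gt0// cheb_gt0. Qed.

(** Rotating the evaluation point by [- th] amounts to rotating the measure by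
    [th]; the mean over [th] is a radial potential. *)
Definition rotated_pot (a b th : R) : \bar R :=
  disc_pot (a * cos th + b * sin th) (b * cos th - a * sin th).

Definition disc_profile (t : R) : \bar R :=
  (\int[leb]_(th in `]0%R, (2 * pi)%R]) rotated_pot t 0 th)%E.

Lemma rotated_pot_ge0 a b th : (0 <= rotated_pot a b th)%E.
Proof. exact: disc_pot_ge0. Qed.

Lemma measurable_rotated_pot d (T : measurableType d) (a b th : T -> R) :
  measurable_fun setT a -> measurable_fun setT b -> measurable_fun setT th ->
  measurable_fun setT (fun z => rotated_pot (a z) (b z) (th z)).
Proof.
move=> ma mb mth.
have mc : measurable_fun setT (fun z => cos (th z)) by exact: (measurableT_comp (@measurable_cos R) mth).
have ms : measurable_fun setT (fun z => sin (th z)) by exact: (measurableT_comp (@measurable_sin R) mth).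
have m1 : measurable_fun setT (fun z => a z * cos (th z) + b z * sin (th z)).
  by apply: measurable_funD; exact: measurable_funM.
have m2 : measurable_fun setT (fun z => b z * cos (th z) - a z * sin (th z)).
  by apply: measurable_funB; exact: measurable_funM.
have m12 : measurable_fun setT (fun z => (a z * cos (th z) + b z * sin (th z), b z * cos (th z) - a z * sin (th z))).
  exact: measurable_fun_pair.
exact: (measurableT_comp (@measurable_disc_pot R) m12).
Qed.

Lemma rotated_sqr (a b th : R) :
  (a * cos th + b * sin th) ^+ 2 + (b * cos th - a * sin th) ^+ 2 = a ^+ 2 + b ^+ 2.
Proof.
transitivity ((a ^+ 2 + b ^+ 2) * (cos th ^+ 2 + sin th ^+ 2)); first by ring.
by rewrite cos2Dsin2 mulr1.
Qed.

Lemma measurable_rotated_pot1 a b : measurable_fun setT (rotated_pot a b).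
Proof. by apply: measurable_rotated_pot; [exact: measurable_cst|exact: measurable_cst|exact: measurable_id]. Qed.

(** In polar coordinates, changing the argument of [(a, b)] shifts [th], which
    does not affect the integral over a period. *)
Lemma rotated_pot_mean (a b : R) :
  (\int[leb]_(th in `]0%R, (2 * pi)%R]) rotated_pot a b th =
   disc_profile (Num.sqrt (a ^+ 2 + b ^+ 2)))%E.
Proof.
have [al [alp]] := polar_form a b.
rewrite /disc_profile; move: (Num.sqrt _) => rho aE bE.
have nal : `|- al| <= 2 * pi by rewrite normrN.
have per th : rotated_pot rho 0 (th + 2 * pi) = rotated_pot rho 0 th.
  rewrite /rotated_pot (_ : th + 2 * pi = th + pi + pi); last by ring.
  by rewrite !cosDpi !sinDpi !opprK.
have E := integral_period_shift p0 nal (measurable_rotated_pot1 rho 0)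
  (rotated_pot_ge0 rho 0) per.
rewrite -[RHS]E; apply: eq_integral => th _.
have e1 : a * cos th + b * sin th = rho * cos (th - al) + 0 * sin (th - al).
  by rewrite cosB aE bE; ring.
have e2 : b * cos th - a * sin th = 0 * cos (th - al) - rho * sin (th - al).
  by rewrite sinB aE bE; ring.
by rewrite /rotated_pot e1 e2.
Qed.

Lemma integral_cst_period (c : R) : (\int[leb]_(th in `]0%R, (2 * pi)%R]) c%:E = (2 * pi * c)%:E)%E.
Proof. by rewrite integral_cst//= lebesgue_measure_itv/= lte_fin p0 oppr0 adde0 -EFinM mulrC. Qed.

Lemma disc_profile_ge0 t : (0 <= disc_profile t)%E.
Proof. by apply: integral_ge0 => th _; exact: rotated_pot_ge0. Qed.

Lemma disc_profile_le t : (disc_profile t <= (2 * pi * disc_level)%:E)%E.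
Proof.
rewrite -integral_cst_period; apply: ge0_le_integral => //.
- by move=> th _; exact: rotated_pot_ge0.
- by apply: measurable_funTS; exact: measurable_rotated_pot1.
- by move=> th _; exact: disc_pot_le.
Qed.

Lemma disc_profile_inside t : t ^+ 2 <= 1 -> disc_profile t = (2 * pi * disc_level)%:E.
Proof.
move=> t1; rewrite -integral_cst_period; apply: eq_integral => th _.
by rewrite /rotated_pot disc_pot_inside// rotated_sqr expr0n addr0.
Qed.

Lemma disc_profile_far t : 3 <= t -> (disc_profile t <= (pi * disc_level)%:E)%E.
Proof.
move=> t3; have -> : pi * disc_level = 2 * pi * (disc_level / 2) by field.
rewrite -integral_cst_period; apply: ge0_le_integral => //.
- by move=> th _; exact: rotated_pot_ge0.
- by apply: measurable_funTS; exact: measurable_rotated_pot1.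
move=> th _; apply: disc_pot_far; rewrite rotated_sqr expr0n addr0.
have -> : 9 = 3 ^+ 2 :> R by ring.
by rewrite ler_pXn2r// nnegrE//; lra.
Qed.

Lemma measurable_disc_profile : measurable_fun setT disc_profile.
Proof.
rewrite (_ : disc_profile = fun t => (\int[leb]_th (rotated_pot t 0 th * (\1_(`]0%R, (2 * pi)%R]%classic) th)%:E))%E).
  apply: (@measurable_fun_fubini_tonelli_F _ _ _ _ _ leb (fun z : R * R =>
    (rotated_pot z.1 0 z.2 * (\1_(`]0%R, (2 * pi)%R]%classic) z.2)%:E)%E)).
    apply: emeasurable_funM.
      by apply: measurable_rotated_pot; [exact: measurable_fst|exact: measurable_cst|exact: measurable_snd].
    apply/measurable_EFinP; apply: (measurableT_comp _ measurable_snd).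
    exact: measurable_indic.
  by move=> z; rewrite mule_ge0 ?rotated_pot_ge0// lee_fin.
by apply/funext => t; rewrite /disc_profile integral_mkcond epatch_indic.
Qed.

(** The maximum with [0] extends the profile, meaningful for radii [t >= 0], to
    the whole line. *)
Definition disc_gap (t : R) : R := 2 * pi * disc_level - fine (disc_profile (Num.max t 0)).

Lemma disc_profile_fin t : disc_profile t \is a fin_num.
Proof.
by rewrite ge0_fin_numE ?disc_profile_ge0// (le_lt_trans (disc_profile_le t))// ltry.
Qed.

Lemma disc_gap_ge0 t : 0 <= disc_gap t.
Proof. by rewrite subr_ge0 -lee_fin fineK ?disc_profile_fin// disc_profile_le. Qed.

Lemma measurable_disc_gap : measurable_fun setT disc_gap.
Proof.
have mm : measurable_fun setT (fun t : R => Num.max t 0).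
  by apply: measurable_maxr; [exact: measurable_id|exact: measurable_cst].
have mp : measurable_fun setT (fun t : R => fine (disc_profile (Num.max t 0))).
  apply: measurableT_comp; first exact: fine_measurable.
  exact: (measurableT_comp measurable_disc_profile mm).
by apply: measurable_funB; [exact: measurable_cst|exact: mp].
Qed.

Lemma disc_gap0 t : t <= 1 -> disc_gap t = 0.
Proof.
move=> t1; rewrite /disc_gap disc_profile_inside ?subrr//.
by rewrite exprn_ile1// ?le_max ?lexx ?orbT// ge_max t1 ler01.
Qed.

Lemma disc_gap_le (q t : R) : 0 < q -> 0 < t -> disc_gap t <= 2 * pi * disc_level * t `^ (q / 2).
Proof.
have l0 : 0 <= 2 * pi * disc_level by rewrite mulr_ge0 ?ltW// disc_level_gt0.
move=> q0 t0; have [t1|t1] := leP t 1.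
  by rewrite disc_gap0// mulr_ge0// powR_ge0.
apply: (@le_trans _ _ (2 * pi * disc_level)).
  by rewrite gerBl fine_ge0// disc_profile_ge0.
rewrite ler_peMr// -[leLHS](powRr0 t) ler_powR ?(ltW t1)//.
by rewrite divr_ge0// ltW.
Qed.

Lemma disc_gap_lower t : 3 <= t -> pi * disc_level <= disc_gap t.
Proof.
move=> t3; have tm : Num.max t 0 = t by rewrite max_l//; lra.
have := disc_profile_far t3; rewrite /disc_gap tm.
by rewrite -(fineK (disc_profile_fin t)) lee_fin; lra.
Qed.

Lemma disc_gap_profile t : 0 <= t ->
  ((disc_gap t)%:E + disc_profile t = (2 * pi * disc_level)%:E)%E.
Proof.
move=> t0; rewrite /disc_gap max_l// -{2}(fineK (disc_profile_fin t)) -EFinD.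
by rewrite subrK.
Qed.

End profile.

(** * The averaged disc measure in space *)

Section plane.
Context (R : realType).

Definition planar_point (a b : R) : 'rV[R]_2 := \row_i (if i == ord0 then a else b).

Lemma planar_pointP (x : 'rV[R]_2) : x = planar_point (x 0 ord0) (x 0 ord_max).
Proof.
apply/rowP => i; rewrite mxE; have [->|->] := ord2P i; first by rewrite eqxx.
by [].
Qed.

Lemma enorm2 (x : 'rV[R]_2) : enorm x = Num.sqrt (x 0 ord0 ^+ 2 + x 0 ord_max ^+ 2).
Proof.
rewrite /enorm big_ord_recr big_ord1/=; congr (Num.sqrt (x 0 _ ^+ 2 + _)).
exact/val_inj.
Qed.

Lemma planar_point0 a b : planar_point a b 0 ord0 = a.
Proof. by rewrite mxE. Qed.

Lemma planar_point1 a b : planar_point a b 0 ord_max = b.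
Proof. by rewrite mxE. Qed.

Lemma enorm_planar_point a b : enorm (planar_point a b) = Num.sqrt (a ^+ 2 + b ^+ 2).
Proof. by rewrite enorm2 planar_point0 planar_point1. Qed.

Lemma planar_pointB a b c d :
  planar_point a b - planar_point c d = planar_point (a - c) (b - d).
Proof. by apply/rowP => i; rewrite !mxE; case: ifP. Qed.

Lemma plane_to_space_l (x : 'rV[R]_2) (j : 'I_2) : plane_to_space x 0 (lshift 1 j) = x 0 j.
Proof. exact: row_mxEl. Qed.

Lemma plane_to_space_r (x : 'rV[R]_2) (j : 'I_1) : plane_to_space x 0 (rshift 2 j) = 0.
Proof. by transitivity ((0 : 'rV[R]_1) 0 j); [exact: row_mxEr|rewrite mxE]. Qed.

Lemma plane_to_spaceB (x y : 'rV[R]_2) :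
  plane_to_space x - plane_to_space y = plane_to_space (x - y).
Proof.
apply/rowP => i; rewrite mxE [X in _ + X]mxE.
case: (@split_ordP 2 1 i) => j ->; first by rewrite !plane_to_space_l !mxE.
by rewrite !plane_to_space_r subr0.
Qed.

Lemma enorm_plane_to_space (x : 'rV[R]_2) : enorm (plane_to_space x) = enorm x.
Proof.
rewrite /enorm (@big_split_ord _ _ _ 2 1)/=; congr Num.sqrt.
rewrite [X in _ + X]big1 ?addr0; last by move=> i _; rewrite plane_to_space_r expr0n.
by apply: eq_bigr => i _; rewrite plane_to_space_l.
Qed.

Lemma measurable_space_point d (T : measurableType d) (a b : T -> R) :
  measurable_fun setT a -> measurable_fun setT b ->
  measurable_fun setT (fun z => plane_to_space (planar_point (a z) (b z)) : borelRn R 3).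
Proof.
move=> ma mb; apply: measurable_fun_rV => i.
case: (@split_ordP 2 1 i) => j ->.
  have [->|->] := ord2P j.
  - by under eq_fun do rewrite plane_to_space_l planar_point0.
  - by under eq_fun do rewrite plane_to_space_l planar_point1.
under eq_fun do rewrite plane_to_space_r.
exact: measurable_cst.
Qed.

Lemma newtonZ (s t : R) : 0 < s -> newton (s * t) = (s^-1%:E * newton t)%E.
Proof.
move=> s0; rewrite /newton pmulr_rle0//; case: ifP => _; last by rewrite invfM EFinM.
by rewrite mulry gtr0_sg ?mul1e// invr_gt0.
Qed.

(** The point [(u, v)] rotated by the angle [th] and scaled by [s], where
    [z = (th, (u, v))]. *)
Definition spin (s : R) (z : R * (R * R)) : 'rV[R]_2 :=
  planar_point (s * (z.2.1 * cos z.1 - z.2.2 * sin z.1))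
               (s * (z.2.1 * sin z.1 + z.2.2 * cos z.1)).

Lemma enorm_spin s z : 0 < s -> enorm (spin s z) = s * Num.sqrt (z.2.1 ^+ 2 + z.2.2 ^+ 2).
Proof.
move=> s0; rewrite enorm_planar_point -{3}(gtr0_norm s0) -sqrtr_sqr -sqrtrM ?sqr_ge0//.
congr Num.sqrt.
transitivity (s ^+ 2 * ((z.2.1 ^+ 2 + z.2.2 ^+ 2) * (cos z.1 ^+ 2 + sin z.1 ^+ 2))); first by ring.
by rewrite cos2Dsin2 mulr1.
Qed.

(** Rotations are isometries: instead of rotating [(u, v)] by [th], one may
    rotate [(a, b)] by [- th]. *)
Lemma enorm_sub_spin (s a b th u v : R) : 0 < s ->
  enorm (planar_point a b - spin s (th, (u, v))) =
  s * planar_dist (a / s * cos th + b / s * sin th) (b / s * cos th - a / s * sin th) u v.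
Proof.
move=> s0; have sE : Num.sqrt (s ^+ 2) = s by rewrite sqrtr_sqr gtr0_norm.
rewrite planar_pointB enorm_planar_point /planar_dist -[X in _ = X * _]sE.
rewrite -sqrtrM ?sqr_ge0//; congr Num.sqrt => /=.
set c := cos th; set d := sin th.
have cd : c ^+ 2 + d ^+ 2 = 1 by rewrite cos2Dsin2.
have aE : a = s * (a / s) by rewrite mulrCA divff ?mulr1// gt_eqF.
have bE : b = s * (b / s) by rewrite mulrCA divff ?mulr1// gt_eqF.
rewrite {1}aE {1}bE; move: (a / s) (b / s) => x y.
transitivity (s ^+ 2 * (x ^+ 2 + y ^+ 2 - 2 * (x * (u * c - v * d) + y * (u * d + v * c))
  + (u ^+ 2 + v ^+ 2) * (c ^+ 2 + d ^+ 2))); first by ring.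
transitivity (s ^+ 2 * ((x ^+ 2 + y ^+ 2) * (c ^+ 2 + d ^+ 2) - 2 * (x * (u * c - v * d) + y * (u * d + v * c))
  + (u ^+ 2 + v ^+ 2))); last by ring.
by rewrite cd !mulr1.
Qed.

Lemma measurable_spin s :
  measurable_fun setT (fun z : R * (R * R) => plane_to_space (spin s z) : borelRn R 3).
Proof.
have mc : measurable_fun setT (fun z : R * (R * R) => cos z.1).
  exact: (measurableT_comp (@measurable_cos R) measurable_fst).
have ms : measurable_fun setT (fun z : R * (R * R) => sin z.1).
  exact: (measurableT_comp (@measurable_sin R) measurable_fst).
have mu : measurable_fun setT (fun z : R * (R * R) => z.2.1).
  exact: (measurableT_comp measurable_fst measurable_snd).
have mv : measurable_fun setT (fun z : R * (R * R) => z.2.2).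
  exact: (measurableT_comp measurable_snd measurable_snd).
apply: measurable_space_point.
- apply: measurable_funM; first exact: measurable_cst.
  by apply: measurable_funB; exact: measurable_funM.
- apply: measurable_funM; first exact: measurable_cst.
  by apply: measurable_funD; exact: measurable_funM.
Qed.

Notation leb := (@lebesgue_measure R).

(** [tau] is the image of [d(th) * disc_density(u, v) du dv] under [spin s]. *)
Lemma exists_disc_average (s r : R) : 0 < s -> s <= r ->
  measurable (@plane_to_space R @` disk r : set (borelRn R 3)) ->
  exists tau : {finite_measure set (borelRn R 3) -> \bar R},
    tau (~` (@plane_to_space R @` disk r)) = 0%E /\
    forall x : 'rV[R]_2, pot (@dkernel R 3 (@newton R)) tau (plane_to_space x) =
      (s^-1%:E * disc_profile (enorm x / s))%E.
Proof.
move=> s0 sr mB.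
pose h1 : R -> R := \1_(`]0%R, (2 * pi)%R]%classic).
pose h2 (z : R * R) := disc_density z.1 z.2.
have mh1 : measurable_fun setT h1 by exact: measurable_indic.
have h10 x : 0 <= h1 x by [].
have h20 z : 0 <= h2 z by exact: disc_density_ge0.
have h1oo : (\int[leb]_x (h1 x)%:E < +oo)%E.
  have <- : (\int[leb]_(x in `]0%R, (2 * pi)%R]) 1%:E = \int[leb]_x (h1 x)%:E)%E.
    rewrite integral_mkcond; apply: eq_integral => x _.
    by rewrite patchE /h1 indicE; case: ifP.
  by rewrite integral_cst_period ltry.
have h2oo : (\int[leb]_y \int[leb]_z (h2 (y, z))%:E < +oo)%E.
  by apply: le_lt_trans (disc_mass_le R) _; rewrite ltry.
have [tau tauE] := @exists_iterated_image _ _ _ _ _ _ _ (borelRn R 3) R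
  leb leb leb (fun z => plane_to_space (spin s z)) h1 h2 (measurable_spin s) mh1
  (@measurable_disc_density R) h10 h20 h1oo h2oo.
exists tau; split.
  rewrite -[X in tau X]setIT -integral_indic//; last exact: measurableC.
  rewrite tauE//; last first.
    by apply/measurable_EFinP; apply: measurable_indic; exact: measurableC.
  rewrite integral0_eq// => th _; rewrite integral0_eq// => u _; rewrite integral0_eq// => v _.
  have [uv|uv] := leP 1 (u ^+ 2 + v ^+ 2).
    by rewrite /h2 /disc_density invsqrt_npos ?subr_le0//= mulr0 mule0.
  rewrite indicE memNset ?mul0e//= => H; apply: H; exists (spin s (th, (u, v))) => //.
  rewrite /disk /= enorm_spin//=; apply: le_trans sr.
  by rewrite ger_pMr// -sqrtr1 ler_wsqrtr// ltW.
move=> x; set a := x 0 ord0; set b := x 0 ord_max.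
rewrite /pot tauE; last 2 first.
- exact: (kernel_section (measurable_dkernel (admissible_newton R))).
- by move=> y; exact: dkernel_ge0 (admissible_newton R) _.
have xE : enorm x / s = Num.sqrt ((a / s) ^+ 2 + (b / s) ^+ 2).
  rewrite !expr_div_n -mulrDl sqrtrM ?addr_ge0 ?sqr_ge0// enorm2; congr (_ * _).
  by rewrite -exprVn sqrtr_sqr gtr0_norm// invr_gt0.
rewrite xE -rotated_pot_mean [in RHS]integral_mkcond epatch_indic.
have mrot : measurable_fun setT (rotated_pot (a / s) (b / s)).
  exact: measurable_rotated_pot1.
rewrite -ge0_integralZl_EFin ?invr_ge0 ?(ltW s0)//; last 2 first.
- by move=> th _; rewrite mule_ge0 ?rotated_pot_ge0// lee_fin.
- by apply: emeasurable_funM => //; exact/measurable_EFinP.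
apply: eq_integral => th _.
set A := a / s * cos th + b / s * sin th; set B := b / s * cos th - a / s * sin th.
have mI := measurable_disc_integrand A B.
have E u v : (dkernel (@newton R) (plane_to_space x, plane_to_space (spin s (th, (u, v)))) *
    (h1 th * h2 (u, v))%:E =
    (s^-1 * h1 th)%:E * (newton (planar_dist A B u v) * (disc_density u v)%:E))%E.
  rewrite /dkernel/= plane_to_spaceB enorm_plane_to_space.
  rewrite {1}(planar_pointP x) enorm_sub_spin// newtonZ// !EFinM -!muleA.
  by congr (_ * _)%E; rewrite muleCA.
have k0 : 0 <= s^-1 * h1 th by rewrite mulr_ge0// invr_ge0 ltW.
transitivity (\int[leb]_u ((s^-1 * h1 th)%:E *
    \int[leb]_v (newton (planar_dist A B u v) * (disc_density u v)%:E)))%E.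
  apply: eq_integral => u _; under eq_integral do rewrite E.
  rewrite ge0_integralZl_EFin//.
  - by move=> v _; exact: disc_integrand_ge0.
  - exact: (measurableT_comp mI (pair1_measurable u)).
rewrite ge0_integralZl_EFin//; last 2 first.
- by move=> u _; apply: integral_ge0 => v _; exact: disc_integrand_ge0.
- apply: (@measurable_fun_fubini_tonelli_F _ _ _ _ _ leb (fun z : R * R =>
    newton (planar_dist A B z.1 z.2) * (disc_density z.1 z.2)%:E)%E mI).
  by move=> z; exact: disc_integrand_ge0.
by rewrite EFinM -muleA; congr (_ * _)%E; rewrite muleC.
Qed.

End plane.

(** * Borel sets and energies *)

Section borel_sets.
Context (R : realType).

Lemma compact_measurable_rV n (A : set 'rV[R]_n) : compact A ->
  measurable (A : set (borelRn R n)).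
Proof.
move=> cA; rewrite -[A]setCK; apply: measurableC; apply: sub_sigma_algebra.
by apply/closed_openC; apply: compact_closed => //; exact: norm_hausdorff.
Qed.

Lemma compact_measurable_real (A : set R) : compact A -> measurable A.
Proof.
by move=> cA; apply: closed_measurable; apply: compact_closed => //; exact: norm_hausdorff.
Qed.

Lemma compact_enorm_bounded (A : set 'rV[R]_2) : compact A ->
  exists M : R, forall x, A x -> enorm x <= M.
Proof.
move=> /compact_bounded[M0 [_ HM]].
exists (2 * (`|M0| + 1)) => x Ax.
have Mp : M0 < `|M0| + 1 by rewrite (le_lt_trans (ler_norm _))// ltrDl.
have xM : `|x| <= `|M0| + 1 by exact: HM.
have ci i : `|x 0 i| <= `|M0| + 1.
  apply: le_trans xM; rewrite /Num.norm/= mx_normrE.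
  exact: (le_bigmax _ (fun ij => `|x ij.1 ij.2|) (0, i)).
have b0 : 0 <= `|M0| + 1 by rewrite addr_ge0.
rewrite -(ler_pXn2r (n := 2))// ?nnegrE ?enorm_ge0 ?mulr_ge0//.
rewrite enorm2 sqr_sqrtr ?addr_ge0 ?sqr_ge0//.
have sq i : x 0 i ^+ 2 <= (`|M0| + 1) ^+ 2.
  by rewrite -(real_normK (num_real (x 0 i))) ler_pXn2r// nnegrE.
have := sq ord0; have := sq ord_max; have := sqr_ge0 (`|M0| + 1); rewrite exprMn.
lra.
Qed.

(** The image is cut out by the vanishing of the third coordinate and by a
    measurable condition on the first two. *)
Lemma measurable_plane_image (A : set 'rV[R]_2) : measurable (A : set (borelRn R 2)) ->
  measurable (@plane_to_space R @` A : set (borelRn R 3)).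
Proof.
move=> mA; pose i0 : 'I_3 := @lshift 2 1 ord0; pose i1 : 'I_3 := @lshift 2 1 ord_max.
pose i2 : 'I_3 := @rshift 2 1 ord0.
pose p (x : 'rV[R]_3) : 'rV[R]_2 := planar_point (x 0 i0) (x 0 i1).
have mp : measurable_fun setT (p : borelRn R 3 -> borelRn R 2).
  apply: measurable_fun_rV => i; have [->|->] := ord2P i.
  - by under eq_fun do rewrite planar_point0; exact: measurable_coord.
  - by under eq_fun do rewrite planar_point1; exact: measurable_coord.
rewrite (_ : _ @` _ = (p @^-1` A) `&` [set x | x 0 i2 = 0]).
  apply: measurableI; first by rewrite -[X in measurable X]setTI; exact: mp.
  have := @measurable_coord R 3 i2 measurableT [set 0] (measurable_set1 _).
  by rewrite setTI.
apply/seteqP; split => [_ [x Ax <-]|x [pA x2]].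
  split; last exact: plane_to_space_r.
  by rewrite /preimage/= /p !plane_to_space_l -planar_pointP.
exists (p x) => //; apply/rowP => i; case: (@split_ordP 2 1 i) => j ->.
  rewrite plane_to_space_l; have [->|->] := ord2P j; first by rewrite planar_point0.
  by rewrite planar_point1.
by rewrite plane_to_space_r ord1; exact/esym/x2.
Qed.

Lemma measurable_line_image (A : set R) : measurable A ->
  measurable (@line_to_plane R @` A : set (borelRn R 2)).
Proof.
move=> mA; rewrite (_ : _ @` _ = [set x : 'rV[R]_2 | A (x 0 ord0)] `&` [set x | x 0 ord_max = 0]).
  apply: measurableI.
    by have := @measurable_coord R 2 ord0 measurableT A mA; rewrite setTI.
  have := @measurable_coord R 2 ord_max measurableT [set 0] (measurable_set1 _).
  by rewrite setTI.
apply/seteqP; split => [_ [x Ax <-]|x /= [pA x2]].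
  by rewrite /= line_coord0 line_coord1.
exists (x 0 ord0) => //; apply/rowP => i; have [->|->] := ord2P i.
  by rewrite line_coord0.
by rewrite line_coord1.
Qed.

Lemma measurable_disk (r : R) : measurable (disk r : set (borelRn R 2)).
Proof.
rewrite -[disk r]setTI; have := @measurable_enorm R 2 measurableT `]-oo, r]%classic (measurable_itv _).
by congr measurable; apply/seteqP; split => x /=; rewrite in_itv.
Qed.

End borel_sets.

Section energies.
Context (R : realType).
Local Open Scope ereal_scope.

Lemma riesz_kernel1 n (x y : 'rV[R]_n) : riesz_kernel 1 x y = newton (enorm (x - y)).
Proof.
rewrite /riesz_kernel oner_eq0 powRr1 ?enorm_ge0// inver /newton.
have := enorm_ge0 (x - y); rewrite le_eqVlt => /orP[/eqP <-|e0]; first by rewrite eqxx lexx.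
by rewrite gt_eqF// leNgt e0.
Qed.

(** The truncation at zero is inactive at distances at most [e^L]. *)
Lemma riesz_kernel0 n (L : R) (x y : 'rV[R]_n) : (ln (enorm (x - y)) <= L)%R ->
  riesz_kernel 0 x y = logpot L (enorm (x - y)) - L%:E.
Proof.
move=> eL; rewrite /riesz_kernel eqxx inver /logpot.
have := enorm_ge0 (x - y); rewrite le_eqVlt => /orP[/eqP e0|e0].
  by rewrite -e0 eqxx lexx.
rewrite gt_eqF// leNgt e0 lne_EFin ?invr_gt0// lnV ?posrE//= -EFinB; congr EFin.
by rewrite max_r; lra.
Qed.

Lemma energy_of_newton (K : set (borelRn R 3)) (P : probability (borelRn R 3) R) :
  measurable K -> P K = 1 ->
  energy_of 1 K P = mutual (@dkernel R 3 (@newton R)) P P.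
Proof.
move=> mK PK; rewrite /energy_of /mutual.
have adm := admissible_newton R; have mk := measurable_dkernel adm; have k0 := dkernel_ge0 adm.
rewrite -(integral_carrier mK PK (measurable_pot mk k0 P) (pot_ge0 k0 P)).
apply: eq_integral => y _; rewrite /pot.
rewrite -(integral_carrier mK PK (kernel_section mk y) (fun x => k0 (y, x))).
by apply: eq_integral => x _; rewrite riesz_kernel1 /dkernel/= enormB.
Qed.

(** The integral of [g] may be infinite.  The negative part of [g - L] is bounded
    by [L], so [(g - L)^+ + L = g + (g - L)^-] can be integrated and the finite
    terms moved across. *)
Lemma integral_sub_cst d (T : measurableType d) (P : probability T R) (K : set T)
    (g : T -> \bar R) (L : R) : measurable K -> P K = 1 -> measurable_fun setT g ->
  (forall x, 0 <= g x) -> (0 <= L)%R ->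
  \int[P]_(x in K) (g x - L%:E) = \int[P]_(x in K) g x - L%:E.
Proof.
move=> mK PK mg g0 L0; set f := fun x => g x - L%:E.
have mf : measurable_fun setT f by apply: emeasurable_funB => //; exact: measurable_cst.
have mfp : measurable_fun K f^\+ by apply: measurable_funTS; exact: measurable_funepos.
have mfn : measurable_fun K f^\- by apply: measurable_funTS; exact: measurable_funeneg.
have cL : \int[P]_(x in K) L%:E = L%:E 
  by rewrite integral_cst//= -[RHS]mule1; congr (_ * _); exact: PK.
have fn x : f^\- x <= L%:E.
  rewrite funenegE /f; case: (g x) (g0 x) => [r| |]//=; last by rewrite ge_max leNye/= lee_fin.
  by rewrite lee_fin -EFin_max lee_fin ge_max => r0; apply/andP; split; lra.
have I1 : \int[P]_(x in K) f^\- x <= L%:E.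
  by rewrite -[leRHS]cL; apply: ge0_le_integral => // x _; exact: funeneg_ge0.
have I0 : 0 <= \int[P]_(x in K) f^\- x by apply: integral_ge0 => x _; exact: funeneg_ge0.
have Ifin : \int[P]_(x in K) f^\- x \is a fin_num.
  by rewrite ge0_fin_numE// (le_lt_trans I1)// ltry.
have Eq : \int[P]_(x in K) f^\+ x + L%:E = \int[P]_(x in K) g x + \int[P]_(x in K) f^\- x.
  rewrite -[in LHS]cL -!ge0_integralD//; last exact: measurable_funTS.
  apply: eq_integral => x _; rewrite funeposE funenegE /f.
  case: (g x) (g0 x) => [r| |]//=; last by rewrite /maxe/= ltNge leey/=.
  rewrite lee_fin -!EFin_max -!EFinD => r0; congr EFin.
  have /orP[h|h] := le_total 0%R (r - L)%R.
    by rewrite max_l// max_r; lra.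
  by rewrite max_r// max_l; lra.
rewrite integralE -/f.
move: Eq Ifin; set a := \int[P]_(x in K) f^\+ x; set b := \int[P]_(x in K) f^\- x.
set c := \int[P]_(x in K) g x => Eq bf.
have : a + L%:E - b - L%:E = c + b - b - L%:E by rewrite Eq.
rewrite addeK// => <-.
by rewrite addeAC addeK.
Qed.

Lemma energy_of_log (L : R) (K : set (borelRn R 2)) (P : probability (borelRn R 2) R) :
  (0 <= L)%R -> measurable K -> P K = 1 ->
  (forall x y : 'rV[R]_2, K x -> K y -> (ln (enorm (x - y)) <= L)%R) ->
  energy_of 0 K P = mutual (@dkernel R 2 (logpot L)) P P - L%:E.
Proof.
move=> L0 mK PK KL; rewrite /energy_of /mutual.
have adm := admissible_logpot L; have mk := measurable_dkernel adm; have k0 := dkernel_ge0 adm.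
rewrite -(integral_carrier mK PK (measurable_pot mk k0 P) (pot_ge0 k0 P)).
rewrite -(integral_sub_cst mK PK (measurable_pot mk k0 P) (pot_ge0 k0 P) L0).
apply: eq_integral => y; rewrite inE => Ky; rewrite /pot.
rewrite -(integral_carrier mK PK (kernel_section mk y) (fun x => k0 (y, x))).
rewrite -(integral_sub_cst mK PK (kernel_section mk y) (fun x => k0 (y, x)) L0).
apply: eq_integral => x; rewrite inE => Kx.
by rewrite (riesz_kernel0 (KL _ _ Kx Ky)) /dkernel/= enormB.
Qed.

Lemma equilibrium_minimal n (p : R) (K : set 'rV[R]_n) (mu P : probability (borelRn R n) R) :
  is_equilibrium p K mu -> P K = 1 -> energy_of p K mu <= energy_of p K P.
Proof. by move=> [_ ->] PK; apply: ereal_inf_lbound; exists P. Qed.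

End energies.

(** * Comparison of the moments *)

Lemma lee_sub_cst (R : realType) (L : R) (a b : \bar R) :
  (a - L%:E <= b - L%:E)%E -> (a <= b)%E.
Proof. by rewrite leeD2rE. Qed.

Section capacities.
Context (R : realType) (n : nat).
Implicit Types A B : set 'rV[R]_n.
Local Open Scope ereal_scope.

Lemma Cap1E A : 0 <= energy 1 A -> Cap 1 A = (energy 1 A)^-1.
Proof.
rewrite /Cap oner_eq0 invr1; move: (energy 1 A) => v v0.
by rewrite poweRe1// inve_ge0.
Qed.

Lemma energy_eq_Cap1 A B : 0 <= energy 1 A -> 0 <= energy 1 B ->
  Cap 1 A = Cap 1 B -> energy 1 A = energy 1 B.
Proof. by move=> A0 B0; rewrite (Cap1E A0) (Cap1E B0) => /constructive_ereal.invr_inj. Qed.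

Lemma energy_lty_Cap1 A : 0 <= energy 1 A -> 0 < Cap 1 A -> energy 1 A < +oo.
Proof.
move=> A0; rewrite (Cap1E A0); move: (energy 1 A) => [r| |]//; first by rewrite ltry.
by rewrite invey ltxx.
Qed.

Lemma energy_eq_Cap0 A B : Cap 0 A = Cap 0 B -> energy 0 A = energy 0 B.
Proof. by rewrite /Cap eqxx => /expeR_inj /oppe_inj. Qed.

Lemma energy_lty_Cap0 A : 0 < Cap 0 A -> energy 0 A < +oo.
Proof.
rewrite /Cap eqxx lt_neqAle eq_sym expeR_eq0 => /andP[+ _].
by case: (energy 0 A) => [r| |]//; rewrite ltry.
Qed.

End capacities.

Section disc_comparison.
Context (R : realType).

Lemma exists_disc_gap (s r : R) : 0 < s -> s <= r ->
  measurable (@plane_to_space R @` disk r : set (borelRn R 3)) ->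
  exists tau : {finite_measure set (borelRn R 3) -> \bar R},
    tau (~` (@plane_to_space R @` disk r)) = 0%E /\
    forall x : 'rV[R]_2, ((s^-1 * disc_gap (enorm (plane_to_space x) / s))%:E +
      pot (@dkernel R 3 (@newton R)) tau (plane_to_space x) = (s^-1 * (2 * pi * disc_level R))%:E)%E.
Proof.
move=> s0 sr mB; have [tau [tauB tauE]] := exists_disc_average s0 sr mB.
exists tau; split => // y.
have d0 : 0 <= enorm y / s by rewrite divr_ge0 ?enorm_ge0// ltW.
rewrite tauE enorm_plane_to_space; move: (enorm y / s) d0 => t t0.
rewrite (EFinM s^-1 (2 * pi * _)) -(disc_gap_profile t0) (EFinM s^-1 (disc_gap t)).
move: (disc_gap t) (disc_gap_ge0 t) (disc_profile t) (disc_profile_ge0 t) => g g0 p p0.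
by rewrite muleDr// ge0_adde_def// inE ?lee_fin.
Qed.

Lemma newton_moment_le (q r : R) (K : set 'rV[R]_2) (mu nu : probability (borelRn R 3) R) :
  0 < q -> compact K ->
  Cap 1 (@plane_to_space R @` K) = Cap 1 (@plane_to_space R @` disk r) ->
  (0 < Cap 1 (@plane_to_space R @` disk r))%E ->
  is_equilibrium 1 (@plane_to_space R @` K) mu ->
  is_equilibrium 1 (@plane_to_space R @` disk r) nu ->
  (\int[nu]_(x in @plane_to_space R @` disk r) (enorm (x : 'rV[R]_3) `^ q)%:E
    <= \int[mu]_(x in @plane_to_space R @` K) (enorm (x : 'rV[R]_3) `^ q)%:E)%E.
Proof.
move=> q0 cK capE cap0 eqmu eqnu.
have adm := admissible_newton R; have k0 := dkernel_ge0 adm.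
set K3 := _ @` K in capE eqmu *; set B3 := _ @` _ in capE cap0 eqnu *.
have mK : measurable (K3 : set (borelRn R 3)).
  by apply: measurable_plane_image; exact: compact_measurable_rV.
have mB : measurable (B3 : set (borelRn R 3)).
  by apply: measurable_plane_image; exact: measurable_disk.
have [muK muE] := eqmu; have [nuB nuE] := eqnu.
rewrite (energy_of_newton mK muK) in muE; rewrite (energy_of_newton mB nuB) in nuE.
have V1 : (0 <= energy 1 K3)%E by rewrite -muE; exact: mutual_ge0.
have V2 : (0 <= energy 1 B3)%E by rewrite -nuE; exact: mutual_ge0.
have VE := energy_eq_Cap1 V1 V2 capE.
have [M HM] := compact_enorm_bounded cK.
have KM (x : 'rV[R]_3) : K3 x -> enorm x <= M.
  by move=> [y Ky <-]; rewrite enorm_plane_to_space; exact: HM.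
have Br (x : 'rV[R]_3) : B3 x -> enorm x <= r.
  by move=> [y yr <-]; rewrite enorm_plane_to_space.
have l1 : 0 < pi * disc_level R := mulr_gt0 (pi_gt0 R) (disc_level_gt0 R).
have l0 : 0 < 2 * pi * disc_level R by rewrite -mulrA; exact: (mulr_gt0 (ltr0Sn _ 1) l1).
have minmu (P : probability (borelRn R 3) R) : P K3 = 1%E ->
    (mutual (@dkernel R 3 (@newton R)) mu mu <= mutual (@dkernel R 3 (@newton R)) P P)%E.
  move=> PK; rewrite -(energy_of_newton mK muK) -(energy_of_newton mK PK).
  exact: equilibrium_minimal eqmu PK.
have minnu (P : probability (borelRn R 3) R) : P B3 = 1%E ->
    (mutual (@dkernel R 3 (@newton R)) nu nu <= mutual (@dkernel R 3 (@newton R)) P P)%E.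
  move=> PB; rewrite -(energy_of_newton mB nuB) -(energy_of_newton mB PB).
  exact: equilibrium_minimal eqnu PB.
have muoo : (mutual (@dkernel R 3 (@newton R)) mu mu < +oo)%E.
  by rewrite muE VE; exact: energy_lty_Cap1.
have munu : mutual (@dkernel R 3 (@newton R)) mu mu = mutual (@dkernel R 3 (@newton R)) nu nu.
  by rewrite muE nuE.
apply: (moment_comparison adm isT mK mB muK nuB KM minmu minnu muoo munu
  (@measurable_disc_gap R) (@disc_gap_ge0 R) q0 (ltW l0) l1 (ler1n R 3)
  (@disc_gap0 R) (fun t => @disc_gap_le R q t q0) (@disc_gap_lower R) Br).
move=> s s0 sr; have [tau [tauB key]] := exists_disc_gap s0 sr mB.
have si : 0 < s^-1 by rewrite invr_gt0.
exists tau, s^-1, (s^-1 * (2 * pi * disc_level R)); split;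
  [exact: tauB|exact: si|exact: (ltW (mulr_gt0 si l0))|].
by move=> x [[y _ <-]|[y _ <-]]; exact: key.
Qed.

End disc_comparison.

Section interval_comparison.
Context (R : realType).
Notation leb := (@lebesgue_measure R).

Lemma exists_arcsine (L s r : R) : 0 < s -> s <= r ->
  measurable (@line_to_plane R @` `[- r, r] : set (borelRn R 2)) ->
  exists tau : {finite_measure set (borelRn R 2) -> \bar R},
    tau (~` (@line_to_plane R @` `[- r, r])) = 0%E /\
    forall t : R, pot (@dkernel R 2 (logpot L)) tau (line_to_plane t) = arcsine_pot L s t.
Proof.
move=> s0 sr mI.
pose h : R -> R := \1_(`]0%R, (2 * pi)%R]%classic).
have mh : measurable_fun setT h by exact: measurable_indic.
have h0 x : 0 <= h x by [].
have hoo : (\int[leb]_x (h x)%:E < +oo)%E.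
  have <- : (\int[leb]_(x in `]0%R, (2 * pi)%R]) 1%:E = \int[leb]_x (h x)%:E)%E.
    rewrite integral_mkcond; apply: eq_integral => x _.
    by rewrite patchE /h indicE; case: ifP.
  by rewrite integral_cst_period ltry.
have mc : measurable_fun setT (fun u : R => s * cos u).
  by apply: measurable_funM; [exact: measurable_cst|exact: measurable_cos].
have [tau tauE] := @exists_weighted_image _ _ _ (borelRn R 2) R leb
  (fun u => line_to_plane (s * cos u)) h (measurable_line mc) mh h0 hoo.
exists tau; split.
  rewrite -[X in tau X]setIT -integral_indic//; last exact: measurableC.
  rewrite tauE//; last first.
    by apply/measurable_EFinP; apply: measurable_indic; exact: measurableC.
  rewrite integral0_eq// => u _.
  rewrite indicE memNset ?mul0e//= => H; apply: H; exists (s * cos u) => //=.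
  rewrite in_itv/= -ler_norml normrM (gtr0_norm s0); apply: le_trans sr.
  by rewrite ger_pMr// ler_norml cos_geN1 cos_le1.
move=> t; have adm := admissible_logpot L.
rewrite /pot tauE; last 2 first.
- exact: (kernel_section (measurable_dkernel adm)).
- by move=> y; exact: dkernel_ge0 adm _.
rewrite /arcsine_pot [in RHS]integral_mkcond epatch_indic; apply: eq_integral => u _.
by rewrite /dkernel/= lineB enorm_line.
Qed.

(** [tau] is the image of the Lebesgue measure of one period under
    [u |-> s cos u]; the bound on [s + M] keeps the truncation of the kernel
    inactive. *)
Lemma exists_arcsine_gap (L M s r : R) : 0 < s -> s <= r -> s <= M -> s + M <= expR L ->
  measurable (@line_to_plane R @` `[- r, r] : set (borelRn R 2)) ->
  exists (tau : {finite_measure set (borelRn R 2) -> \bar R}) (C : R),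
    [/\ tau (~` (@line_to_plane R @` `[- r, r])) = 0%E, 0 <= C &
    forall t : R, `|t| <= M -> ((1 * loggap (enorm (line_to_plane t) / s))%:E +
      pot (@dkernel R 2 (logpot L)) tau (line_to_plane t) = C%:E)%E].
Proof.
move=> s0 sr sM sML mI; have [tau [tauI tauE]] := exists_arcsine L s0 sr mI.
have sL : 2 * s <= expR L by lra.
have ss : `|s| <= s by rewrite gtr0_norm.
have Cf : arcsine_pot L s s \is a fin_num.
  rewrite arcsine_pot_inside//.
  have lf : (\int[leb]_(u in `]0%R, (2 * pi)%R]) logsin u)%E \is a fin_num.
    by rewrite ge0_fin_numE ?integral_logsin_lty// integral_ge0// => u _; exact: logsin_ge0.
  rewrite fin_numD; apply/andP; split; first by [].
  by rewrite fin_numD; apply/andP; split; exact: lf.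
exists tau, (fine (arcsine_pot L s s)); split => //.
  by rewrite fine_ge0// integral_ge0// => u _; exact: logpot_ge0.
move=> t tM; have tL : `|t| + s <= expR L by lra.
by rewrite tauE enorm_line mul1r [RHS]fineK//; exact: loggap_arcsine.
Qed.

Lemma compact_abs_bounded (r : R) (K : set R) : compact K ->
  exists M : R, [/\ 0 <= M, r <= M & forall t, K t -> `|t| <= M].
Proof.
move=> /compact_bounded[M [_ HM]]; exists (`|r| + (`|M| + 1)).
have r0 := normr_ge0 r; have rr := ler_norm r; have M0 := normr_ge0 M.
split; [by lra|by lra|move=> t Kt].
have : `|t| <= `|M| + 1; last by lra.
by apply: HM => //; have := ler_norm M; lra.
Qed.

(** The logarithmic kernel is not positive.  On the two bounded sets it differs
    by the constant [L = ln (2 M + 1)] from the positive kernel [logpot L], so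
    that energies shift by [L] and the minimisers are the same. *)
Lemma log_moment_le (q r : R) (K : set R) (mu nu : probability (borelRn R 2) R) :
  0 < q -> 0 <= r -> compact K ->
  Cap 0 (@line_to_plane R @` K) = Cap 0 (@line_to_plane R @` `[- r, r]) ->
  (0 < Cap 0 (@line_to_plane R @` `[(- r)%R, r]))%E ->
  is_equilibrium 0 (@line_to_plane R @` K) mu ->
  is_equilibrium 0 (@line_to_plane R @` `[- r, r]) nu ->
  (\int[nu]_(x in @line_to_plane R @` `[(- r)%R, r]) (enorm (x : 'rV[R]_2) `^ q)%:E
    <= \int[mu]_(x in @line_to_plane R @` K) (enorm (x : 'rV[R]_2) `^ q)%:E)%E.
Proof.
move=> q0 r0 cK.
have [M [M0 rM HM]] := compact_abs_bounded r cK.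
have E0 : 0 < 2 * M + 1 by rewrite ltr_wpDl// mulr_ge0.
pose L : R := ln (2 * M + 1).
have EL : expR L = 2 * M + 1 by rewrite lnK ?posrE.
have L0 : 0 <= L by rewrite ln_ge0// lerDr mulr_ge0.
have diam (A : set R) : (forall t, A t -> `|t| <= M) -> forall x y : 'rV[R]_2,
    (@line_to_plane R @` A) x -> (@line_to_plane R @` A) y -> ln (enorm (x - y)) <= L.
  move=> AM _ _ [a Aa <-] [b Ab <-]; rewrite lineB enorm_line.
  have ab : `|a - b| <= 2 * M + 1.
    by apply: le_trans (ler_normB _ _) _; have := AM _ Aa; have := AM _ Ab; lra.
  have [->|abn] := eqVneq `|a - b| 0; first by rewrite ln0.
  by rewrite ler_ln ?posrE// lt_neqAle eq_sym abn normr_ge0.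
have IM t : [set` `[- r, r]] t -> `|t| <= M.
  by rewrite /= in_itv/= -ler_norml => /le_trans; exact.
have KL := diam _ HM; have IL := diam _ IM.
have adm := admissible_logpot L; have k0 := dkernel_ge0 adm.
have [C [C0 HC]] := @loggap_le R q q0.
have c0 : 0 < 2 * pi * ln 2 :> R.
  by rewrite -mulrA mulr_gt0// mulr_gt0 ?pi_gt0// ln_gt0// ltr1n.
move=> capE cap0 eqmu eqnu.
set K2 := _ @` K in capE eqmu *; set I2 := _ @` _ in capE cap0 eqnu *.
have mK : measurable (K2 : set (borelRn R 2)).
  by apply: measurable_line_image; exact: compact_measurable_real.
have mB : measurable (I2 : set (borelRn R 2)).
  by apply: measurable_line_image; exact: measurable_itv.
have [muK muE] := eqmu; have [nuB nuE] := eqnu.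
have enK P PK := @energy_of_log R L K2 P L0 mK PK KL.
have enI P PI := @energy_of_log R L I2 P L0 mB PI IL.
rewrite (enK mu muK) in muE; rewrite (enI nu nuB) in nuE.
have Lf : L%:E \is a fin_num by [].
have muV : mutual (@dkernel R 2 (logpot L)) mu mu = (energy 0 K2 + L%:E)%E.
  by rewrite -muE subeK.
have nuV : mutual (@dkernel R 2 (logpot L)) nu nu = (energy 0 I2 + L%:E)%E.
  by rewrite -nuE subeK.
have VE := energy_eq_Cap0 capE.
have KM (x : 'rV[R]_2) : K2 x -> enorm x <= M.
  by move=> [t Kt <-]; rewrite enorm_line; exact: HM.
have Br (x : 'rV[R]_2) : I2 x -> enorm x <= r.
  by move=> [t]; rewrite /= in_itv/= => tr <-; rewrite enorm_line ler_norml.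
have minmu (P : probability (borelRn R 2) R) : P K2 = 1%E ->
    (mutual (@dkernel R 2 (logpot L)) mu mu <= mutual (@dkernel R 2 (logpot L)) P P)%E.
  move=> PK; apply: (@lee_sub_cst R L); rewrite -(enK mu muK) -(enK P PK).
  exact: equilibrium_minimal eqmu PK.
have minnu (P : probability (borelRn R 2) R) : P I2 = 1%E ->
    (mutual (@dkernel R 2 (logpot L)) nu nu <= mutual (@dkernel R 2 (logpot L)) P P)%E.
  move=> PI; apply: (@lee_sub_cst R L); rewrite -(enI nu nuB) -(enI P PI).
  exact: equilibrium_minimal eqnu PI.
have muoo : (mutual (@dkernel R 2 (logpot L)) mu mu < +oo)%E.
  by rewrite muV VE; apply: lte_add_pinfty; [exact: energy_lty_Cap0|exact: ltry].
have munu : mutual (@dkernel R 2 (logpot L)) mu mu = mutual (@dkernel R 2 (logpot L)) nu nu.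
  exact: (etrans muV (etrans (congr1 (fun v => v + L%:E)%E VE) (esym nuV))).
apply: (moment_comparison adm isT mK mB muK nuB KM minmu minnu muoo munu
  (@measurable_loggap R) (@loggap_ge0 R) q0 C0 c0 (ler1n R 3)
  (@loggap0 R) HC (@loggap_lower R) Br).
move=> s s0 sr; have sM : s + M <= expR L by rewrite EL; lra.
have [tau [C' [tauI C'0 key]]] := exists_arcsine_gap s0 sr (le_trans sr rM) sM mB.
exists tau, 1, C'; split; [exact: tauI|exact: ltr01|exact: C'0|].
by move=> x [[t Kt <-]|[t It <-]]; apply: key; [exact: HM|exact: IM].
Qed.

End interval_comparison.

Theorem corollary1p3 (R : realType) (q : R) (hq0 : 0 < q) (hq2 : q <= 2) :
  (forall (K : set 'rV[R]_2) (r : R)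
     (mu nu : probability (borelRn R 3) R),
     compact K -> 0 <= r ->
     let K3 := @plane_to_space R @` K in
     let B3 := @plane_to_space R @` disk r in
     Cap 1 K3 = Cap 1 B3 -> (0 < Cap 1 B3)%E ->
     is_equilibrium 1 K3 mu -> is_equilibrium 1 B3 nu ->
     (\int[nu]_(x in B3) (enorm x `^ q)%:E
        <= \int[mu]_(x in K3) (enorm x `^ q)%:E)%E)
  /\
  (forall (K : set R) (r : R)
     (mu nu : probability (borelRn R 2) R),
     compact K -> 0 <= r ->
     let K2 := @line_to_plane R @` K in
     let I2 := @line_to_plane R @` `[- r, r] in
     Cap 0 K2 = Cap 0 I2 -> (0 < Cap 0 I2)%E ->
     is_equilibrium 0 K2 mu -> is_equilibrium 0 I2 nu ->
     (\int[nu]_(x in I2) (enorm x `^ q)%:E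
        <= \int[mu]_(x in K2) (enorm x `^ q)%:E)%E).
Proof.
split=> K r mu nu cK r0 K' B capE cap0 eqmu eqnu.
  exact: (newton_moment_le hq0 cK capE cap0 eqmu eqnu).
exact: (log_moment_le hq0 r0 cK capE cap0 eqmu eqnu).
Qed.
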